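(* For every $\mu\in\mathcal{P}^1(\mathbb{P}_{2n})$, $$\widehat{d}^{\,\frac1r}(G(\mu^r))\prec_{\log}G(\widehat{d}_*\mu),\qquad 0<r\le1.$$
   Context: $\mathbb{P}_{2n}$ is the set of $2n\times 2n$ real symmetric positive definite matrices with Riemannian distance $\delta(A,B)=\|\log A^{-1/2}BA^{-1/2}\|_2$, where $\|X\|_2=(\operatorname{tr}X^2)^{1/2}$. $\mathbb{R}_+=(0,\infty)$, and $\mathbb{R}_+^{2n}$ is identified with the diagonal matrices in $\mathbb{P}_{2n}$, so $\delta(a,b)=\|\log a-\log b\|_2$ for $a,b\in\mathbb{R}_+^{2n}$ (componentwise logarithm). Let $J=\begin{bmatrix}0&I\\-I&0\end{bmatrix}$ and $\mathrm{Sp}(2n,\mathbb{R})=\{M\in M_{2n}(\mathbb{R}):M^TJM=J\}$. By Williamson's theorem, for each $A\in\mathbb{P}_{2n}$ there are a unique diagonal matrix $D=\mathrm{diag}(d_1,\dots,d_n)$ with $0<d_1\le\dots\le d_n$ and some $M\in\mathrm{Sp}(2n,\mathbb{R})$ with $A=M^T\begin{bmatrix}D&0\\0&D\end{bmatrix}M$. The extended symplectic eigenvalue map $\widehat{d}:\mathbb{P}_{2n}\to\mathbb{R}_+^{2n}$ is $\widehat{d}(A)=(\widehat d_1(A),\dots,\widehat d_{2n}(A))=(d_n,d_n,d_{n-1},d_{n-1},\dots,d_1,d_1)$; $\widehat{d}^{\,1/r}(A)$ is the vector of entrywise powers $\widehat d_i(A)^{1/r}$. For $X=\mathbb{P}_{2n}$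 or $\mathbb{R}_+^{2n}$, $\mathcal{P}^1(X)$ is the set of Borel probability measures $\mu$ on $X$ with $\int_X\delta(a,x)\,d\mu(a)<\infty$ for some $x\in X$. The Cartan barycenter $G(\mu)\in X$ of $\mu\in\mathcal{P}^1(X)$ is the unique minimizer over $z\in X$ of $\int_X[\delta^2(z,a)-\delta^2(y,a)]\,d\mu(a)$, independent of the fixed $y\in X$; on $\mathbb{R}_+^{2n}$ it is $G(\mu)=\exp\int\log x\,d\mu(x)$ (componentwise). $\mu^r$ is the push-forward of $\mu$ by the power map $A\mapsto A^r$ (it belongs to $\mathcal{P}^1(\mathbb{P}_{2n})$), and $\widehat{d}_*\mu$ is the push-forward of $\mu$ by $\widehat{d}$ (it belongs to $\mathcal{P}^1(\mathbb{R}_+^{2n})$). For $a,b\in\mathbb{R}_+^{N}$ arranged in decreasing order, $a\prec_{\log}b$ means $\prod_{i=1}^ka_i\le\prod_{i=1}^kb_i$ for $1\le k\le N$, with equality for $k=N$. *)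

(* Defs.v *)
From HB Require Import structures.
From mathcomp Require Import all_boot all_order all_algebra.
From mathcomp Require Import all_classical all_reals all_analysis.
Set Implicit Arguments.
Unset Strict Implicit.
Unset Printing Implicit Defensive.
Import Order.TTheory GRing.Theory Num.Theory.
Import numFieldNormedType.Exports.
Local Open Scope classical_set_scope.
Local Open Scope ring_scope.

Definition posdef (R : realType) (N : nat) (A : 'M[R]_N) : Prop :=
  A^T = A /\ forall x : 'cV[R]_N, x != 0 -> 0 < (x^T *m A *m x) 0 0.

Lemma posdef1 (R : realType) (N : nat) : posdef (1%:M : 'M[R]_N).
Proof.
split; first exact: trmx1.
move=> x x0; rewrite mulmx1 mxE.
have ge0 (i : 'I_N) : true -> 0 <= x^T 0 i * x i 0.
  by move=> _; rewrite mxE -expr2 sqr_ge0.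
rewrite lt_def sumr_ge0 // andbT; apply: contra_neq x0 => s0.
apply/matrixP => i j; rewrite ord1 [RHS]mxE.
move: (psumr_eq0P ge0 s0 (i := i) isT); rewrite mxE => /eqP.
by rewrite mulf_eq0 orbb => /eqP.
Qed.

Definition posdef_set (R : realType) (N : nat) : set 'M[R]_N :=
  [set A | posdef A].

Definition posrow_set (R : realType) (N : nat) : set 'rV[R]_N :=
  [set a | forall i, 0 < a 0 i].

Lemma posrow1 (R : realType) (N : nat) : posrow_set (const_mx 1 : 'rV[R]_N).
Proof. by move=> i; rewrite mxE ltr01. Qed.

(* Both spaces are subtypes carrying the topology induced by the entries; it
   agrees with the topology of the distances [riem_dist] and [log_dist]. *)
Definition pdmx (R : realType) (N : nat) : Type := set_type (@posdef_set R N).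
HB.instance Definition _ (R : realType) (N : nat) :=
  Topological.on (pdmx R N).
HB.instance Definition _ (R : realType) (N : nat) :=
  isPointed.Build (pdmx R N)
    (exist (fun A => A \in @posdef_set R N) 1%:M (mem_set (posdef1 R N))).

Definition posrow (R : realType) (N : nat) : Type := set_type (@posrow_set R N).
HB.instance Definition _ (R : realType) (N : nat) :=
  Topological.on (posrow R N).
HB.instance Definition _ (R : realType) (N : nat) :=
  isPointed.Build (posrow R N)
    (exist (fun a => a \in @posrow_set R N) (const_mx 1)
       (mem_set (@posrow1 R N))).

Definition mx_of_pd (R : realType) (N : nat) (A : pdmx R N) : 'M[R]_N :=
  set_val A.
Definition row_of_pos (R : realType) (N : nat) (a : posrow R N) : 'rV[R]_N :=
  set_val a.

(* Spectral functional calculus: B = f(A) for the symmetric matrix A.  B does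
   not depend on the diagonalization of A. *)
Definition is_mxfun (R : realType) (N : nat) (f : R -> R) (A B : 'M[R]_N) :
    Prop :=
  exists (U : 'M[R]_N) (d : 'rV[R]_N),
    [/\ U^T *m U = 1%:M, A = U^T *m diag_mx d *m U &
        B = U^T *m diag_mx (map_mx f d) *m U].

Definition mxfun (R : realType) (N : nat) (f : R -> R) (A : 'M[R]_N) : 'M[R]_N :=
  get [set B | is_mxfun f A B].

(* A |-> A^r, with values again in the positive definite matrices. *)
Definition pd_pow (R : realType) (N : nat) (r : R) (A : pdmx R N) : pdmx R N :=
  get [set B : pdmx R N |
    is_mxfun (fun x => x `^ r) (mx_of_pd A) (mx_of_pd B)].

Definition frobenius (R : realType) (N : nat) (X : 'M[R]_N) : R :=
  Num.sqrt (\tr (X *m X)).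

Definition riem_dist (R : realType) (N : nat) (A B : pdmx R N) : R :=
  let A' := mxfun (fun x => x `^ (- 2^-1)) (mx_of_pd A) in
  frobenius (mxfun (@ln R) (A' *m mx_of_pd B *m A')).

Definition log_dist (R : realType) (N : nat) (a b : posrow R N) : R :=
  Num.sqrt (\sum_i (ln (row_of_pos a 0 i) - ln (row_of_pos b 0 i)) ^+ 2).

Definition symplJ (R : realType) (n : nat) : 'M[R]_(n + n) :=
  block_mx 0 1%:M (- 1%:M) 0.

Definition symplectic (R : realType) (n : nat) (M : 'M[R]_(n + n)) : Prop :=
  M^T *m symplJ R n *m M = symplJ R n.

(* d = (d_1 <= ... <= d_n) are the symplectic eigenvalues of A. *)
Definition williamson (R : realType) (n : nat) (A : 'M[R]_(n + n))
    (d : 'rV[R]_n) : Prop :=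
  [/\ forall i, 0 < d 0 i,
      forall i j : 'I_n, (i <= j)%N -> d 0 i <= d 0 j &
      exists2 M : 'M[R]_(n + n), symplectic M &
        A = M^T *m block_mx (diag_mx d) 0 0 (diag_mx d) *m M].

Lemma half_ord_subproof (n : nat) (i : 'I_(n + n)) : (i./2 < n)%N.
Proof. by rewrite ltn_half_double -addnn. Qed.

Definition half_ord (n : nat) (i : 'I_(n + n)) : 'I_n :=
  Ordinal (half_ord_subproof i).

(* (d_1, ..., d_n) |-> (d_n, d_n, d_(n-1), d_(n-1), ..., d_1, d_1) *)
Definition double_rev (R : realType) (n : nat) (d : 'rV[R]_n) : 'rV[R]_(n + n) :=
  \row_i d 0 (rev_ord (half_ord i)).

Definition dhat (R : realType) (n : nat) (A : pdmx R (n + n)) :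
    posrow R (n + n) :=
  get [set v : posrow R (n + n) |
    exists2 d, williamson (mx_of_pd A) d & row_of_pos v = double_rev d].

Definition borel (T : ptopologicalType) := g_sigma_algebraType (@open T).

Definition finite_first_moment (R : realType) (T : ptopologicalType)
    (dist : T -> T -> R) (mu : probability (borel T) R) : Prop :=
  exists x : T, (\int[mu]_a (dist a x)%:E < +oo)%E.

(* [mu] is only a set function so that [pushforward] applies without a proof
   that the map is measurable. *)
Definition cartan_barycenter (R : realType) (T : ptopologicalType)
    (dist : T -> T -> R) (mu : set (borel T) -> \bar R) : T :=
  get [set z : T | forall y w : T,
    (\int[mu]_a ((dist z a) ^+ 2 - (dist y a) ^+ 2)%:E <=
     \int[mu]_a ((dist w a) ^+ 2 - (dist y a) ^+ 2)%:E)%E].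

Definition push_pow (R : realType) (N : nat) (r : R)
    (mu : set (borel (pdmx R N)) -> \bar R) :
    set (borel (pdmx R N)) -> \bar R :=
  pushforward mu (pd_pow r : borel (pdmx R N) -> borel (pdmx R N)).

Definition push_dhat (R : realType) (n : nat)
    (mu : set (borel (pdmx R (n + n))) -> \bar R) :
    set (borel (posrow R (n + n))) -> \bar R :=
  pushforward mu
    (@dhat R n : borel (pdmx R (n + n)) -> borel (posrow R (n + n))).

Definition decr_prod (R : realType) (N : nat) (a : 'rV[R]_N) (k : nat) : R :=
  \prod_(x <- take k (sort >=%R [seq a 0 i | i <- enum 'I_N])) x.

Definition log_major (R : realType) (N : nat) (a b : 'rV[R]_N) : Prop :=
  (forall k : nat, (1 <= k <= N)%N -> decr_prod a k <= decr_prod b k) /\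
  decr_prod a N = decr_prod b N.

(* Main.v *)
(* Let s_m(A) be the product of the m largest symplectic eigenvalues of A.  It
   is the best constant in the inequality
     det (W^T J V)^2 <= s_m(A)^4 det (W^T A^-1 W) det (V^T A^-1 V)
   for 2n x 2m matrices V and W, which is attained at the frame of A provided by
   Williamson's theorem.  Hence ln s_m is Lipschitz, convex along geodesics and
   zero at the identity; on the geodesic from 1 to A the convexity reads
   ln s_m(A^r) <= r ln s_m(A).
   At the barycenter Z of mu^r, the first variation of the squared distances in
   the direction given by the Williamson frame of Z is bounded below by 0 and
   above by a multiple of the integral of ln s_m(A^r) - ln s_m(Z), the frame
   being a subgradient of ln s_m at Z.  So ln s_m(Z) <= r * integral of ln s_m,
   and for m = n the variation by scalings turns this into an equality of
   determinants.  Finally the k-th partial product of the doubled vector is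
   s_m s_m' with m = floor (k/2) and m' = ceil (k/2). *)
From mathcomp Require Import all_boot all_order all_algebra ring lra zify.
From mathcomp Require Import fingroup perm complex.
From mathcomp Require Import all_classical all_reals all_analysis measurable_realfun.
Require Import Defs.
Set Implicit Arguments.
Unset Strict Implicit.
Unset Printing Implicit Defensive.
Import Order.TTheory GRing.Theory Num.Theory.
Import numFieldNormedType.Exports.
Local Open Scope classical_set_scope.
Local Open Scope ring_scope.

(** Only a first moment is available, so squared distances occur as differences, which grow at most
    linearly in the distance ([dist_sq_diff_le]). The same bound dominates the difference quotients
    of the first variation. Their second-order error, however, carries a constant that depends on
    the spectrum of A and need not be integrable; hence a pointwise expansion followed by a reverse
    Fatou argument. The direction of the variation matters: it is by shrinking Z along the top
    directions of its Williamson frame that the lower bound from minimality meets the upper bound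
    from the subgradient inequality. Of the barycenter only minimality is used: [get] returns some
    minimizer once one exists, existence comes from coercivity and compactness, and the estimates
    are made at an arbitrary minimizer. *)

Lemma dot_gt0 (R : realType) N (v : 'rV[R]_N) : v != 0 -> 0 < (v *m v^T) 0 0.
Proof.
move=> v0; have [_ /(_ v^T)] := posdef1 R N.
by rewrite mulmx1 trmxK; apply; rewrite trmx_eq0.
Qed.

Lemma dot_ge0 (R : realType) N (v : 'rV[R]_N) : 0 <= (v *m v^T) 0 0.
Proof.
by have [->|/dot_gt0/ltW//] := eqVneq v 0; rewrite mul0mx mxE.
Qed.

(** * Spectral theorem for real symmetric matrices *)

Section Spectral.
Variable R : realType.
Local Notation C := (complex.complex R).

(** A left eigenvector of [T] over the algebraically closed field of complex numbers, split into
    real and imaginary parts; the eigenvalue is a + ib. *)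
Lemma complex_eigenvector N (T : 'M[R]_N.+1) :
  exists a b (x y : 'rV[R]_N.+1), [/\ (x != 0) || (y != 0),
    x *m T = a *: x - b *: y & y *m T = b *: x + a *: y].
Proof.
have [l /eigenvalueP[z zT z0]] :=
  eigenvalue_closed (map_mx (fun x => complex.Complex x 0 : C) T) (ltn0Sn N).
pose x := map_mx (@complex.Re R) z; pose y := map_mx (@complex.Im R) z.
have ReD : {morph (@complex.Re R) : u v / u + v} by move=> [? ?] [? ?].
have ImD : {morph (@complex.Im R) : u v / u + v} by move=> [? ?] [? ?].
exists (complex.Re l), (complex.Im l), x, y; split.
- apply: contraNT z0; rewrite negb_or !negbK => /andP[/eqP x0 /eqP y0].
  apply/eqP/rowP => i; move/rowP/(_ i): x0; move/rowP/(_ i): y0.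
  by rewrite !mxE; case: (z 0 i) => a b /= -> ->.
- apply/rowP => j; move/rowP/(_ j)/(congr1 (@complex.Re R)): zT.
  rewrite !mxE (big_morph _ ReD (erefl : complex.Re (0 : C) = 0)).
  case: (l) => a b /=; case: (z 0 j) => c d /= <-.
  by apply: eq_bigr => i _; rewrite !mxE; case: (z 0 i) => e f /=; ring.
- apply/rowP => j; move/rowP/(_ j)/(congr1 (@complex.Im R)): zT.
  rewrite !mxE (big_morph _ ImD (erefl : complex.Im (0 : C) = 0)).
  case: (l) => a b /=; case: (z 0 j) => c d /= => E.
  rewrite addrC -E.
  by apply: eq_bigr => i _; rewrite !mxE; case: (z 0 i) => e f /=; ring.
Qed.

Lemma mx11_tr (A : 'M[R]_1) : A^T = A.
Proof. by apply/matrixP => i j; rewrite !mxE !ord1. Qed.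

(** Symmetry equates x T y^T with y T x^T, which gives b (|x|^2 + |y|^2) = 0. Hence b = 0, and
    whichever of x and y is nonzero is a real eigenvector. *)
Lemma sym_eigenvector N (T : 'M[R]_N.+1) : T^T = T ->
  exists a (v : 'rV[R]_N.+1), v != 0 /\ v *m T = a *: v.
Proof.
move=> sT; have [a [b [x [y [xy xT yT]]]]] := complex_eigenvector T.
have : x *m T *m y^T = y *m T *m x^T.
  by rewrite -[LHS]mx11_tr !trmx_mul trmxK sT mulmxA.
rewrite xT yT mulmxBl mulmxDl -!scalemxAl -[y *m x^T]mx11_tr trmx_mul trmxK.
rewrite [RHS]addrC => /addrI/esym/eqP; rewrite -addr_eq0 -scalerDr.
move=> /eqP/matrixP/(_ 0 0); rewrite !mxE => /eqP; rewrite mulf_eq0.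
have := dot_ge0 x; have := dot_ge0 y; rewrite !mxE => y0 x0.
case/orP=> [/eqP b0|]; last first.
  rewrite paddr_eq0// => /andP[/eqP x00 /eqP y00].
  by case/orP: xy => /dot_gt0; rewrite mxE ?x00 ?y00 ltxx.
move: xT yT; rewrite b0 !scale0r subr0 add0r => xT yT.
by case/orP: xy => [x1|y1]; [exists a, x|exists a, y].
Qed.

Lemma sym_unit_eigenvector N (T : 'M[R]_N.+1) : T^T = T ->
  exists a (v : 'rV[R]_N.+1), v *m v^T = 1%:M /\ v *m T = a *: v.
Proof.
move=> /sym_eigenvector[a [v [v0 vT]]].
have d0 := dot_gt0 v0; pose s := Num.sqrt ((v *m v^T) 0 0).
have s0 : s != 0 by rewrite gt_eqF // sqrtr_gt0.
exists a, (s^-1 *: v); split; last by rewrite -scalemxAl vT !scalerA mulrC.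
rewrite linearZ/= -scalemxAl -scalemxAr scalerA.
apply/matrixP => i j; rewrite !ord1 mxE [RHS]mxE /=.
have : s ^+ 2 = (v *m v^T) 0 0 by rewrite sqr_sqrtr ?ltW.
by move=> <-; rewrite expr2; field.
Qed.

(* Completion by the Householder reflection exchanging [v] and the first basis vector. *)
Lemma orthogonal_completion N (v : 'rV[R]_(1 + N)) : v *m v^T = 1%:M ->
  exists Q : 'M[R]_(1 + N), Q *m Q^T = 1%:M /\ usubmx Q = v.
Proof.
move=> v1; pose e : 'rV[R]_(1 + N) := row_mx 1%:M 0.
have e1 : e *m e^T = 1%:M.
  by rewrite tr_row_mx mul_row_col trmx0 mulmx0 addr0 trmx1 mulmx1.
have [->|ve] := eqVneq v e.
  exists 1%:M; split; first by rewrite trmx1 mulmx1.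
  by rewrite (scalar_mx_block 1 N 1) block_mxEv col_mxKu.
have [w wE] : exists w : 'rV[R]_(1 + N), w = v - e by exists (v - e).
have w0 : w != 0 by rewrite wE subr_eq0.
pose c := (w *m w^T) 0 0; have c0 : c != 0 by rewrite gt_eqF // dot_gt0.
have wwc : w *m w^T = c%:M by rewrite [LHS]mx11_scalar.
(* Since v and e are unit vectors, c = 2 - 2 <e, v>, so <e, w> = - c / 2 and the reflection sends e
   to e + w = v. *)
have ewc : e *m w^T = (- (c / 2))%:M.
  pose s := (e *m v^T) 0 0.
  have ev : e *m v^T = s%:M by rewrite [LHS]mx11_scalar.
  have ve' : v *m e^T = s%:M by rewrite -[LHS]mx11_tr trmx_mul trmxK ev.
  have : w *m w^T = (2 - 2 * s)%:M.
    rewrite wE linearB/= mulmxBl !mulmxBr v1 e1 ev ve'.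
    by apply/matrixP => i j; rewrite !mxE !ord1 /= ?mulr1n; ring.
  rewrite wwc => /matrixP/(_ 0 0); rewrite !mxE /= !mulr1n => cs.
  rewrite {1}wE linearB/= mulmxBr e1 ev cs.
  by apply/matrixP => i j; rewrite !mxE !ord1 /= !mulr1n; field.
exists (1%:M - (2 / c) *: (w^T *m w)); split.
  have At : ((2 / c) *: (w^T *m w))^T = (2 / c) *: (w^T *m w).
    by rewrite linearZ /= trmx_mul trmxK.
  rewrite linearB /= At trmx1 mulmxBl !mulmxBr !mulmx1 mul1mx.
  rewrite -!scalemxAl -!scalemxAr mulmxA -(mulmxA w^T w) wwc.
  rewrite mul_mx_scalar -scalemxAl.
  move: (w^T *m w) => q; apply/matrixP => i j; rewrite !mxE.
  by field.
have -> (Q : 'M[R]_(1 + N)) : usubmx Q = e *m Q.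
  by rewrite -{2}[Q]vsubmxK mul_row_col mul1mx mul0mx addr0.
rewrite mulmxBr mulmx1 -scalemxAr mulmxA ewc mul_scalar_mx scalerA.
have -> : 2 / c * - (c / 2) = -1 by field.
by rewrite scaleN1r opprK wE addrC subrK.
Qed.

Theorem sym_spectral N (T : 'M[R]_N) : T^T = T ->
  exists (U : 'M[R]_N) (d : 'rV[R]_N),
    U^T *m U = 1%:M /\ T = U^T *m diag_mx d *m U.
Proof.
elim: N T => [|N IH] T sT.
  by exists 1%:M, 0; split; apply/matrixP => -[].
have [a [v [v1 vT]]] := sym_unit_eigenvector sT.
have [Q [Q1 Qv]] := @orthogonal_completion N v v1.
have Q2 := mulmx1C Q1.
have [T1 T1def] : exists T1 : 'M[R]_(1 + N), T1 = Q *m T *m Q^T by eexists.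
have sT1 : T1^T = T1 by rewrite T1def !trmx_mul trmxK sT mulmxA.
(* The first row of [Q] is the eigenvector, so conjugation by [Q] clears the rest of the first row;
   symmetry then clears the first column. *)
have T1u : usubmx T1 = row_mx a%:M 0.
  rewrite T1def -!mul_usub_mx Qv vT -scalemxAl.
  rewrite -[v]Qv mul_usub_mx Q1 scalar_mx_block /block_mx col_mxKu.
  by rewrite scale_row_mx scaler0 scale_scalar_mx mulr1.
have T1E : T1 = block_mx a%:M 0 0 (drsubmx T1).
  rewrite -[LHS]submxK; congr block_mx.
  - by rewrite /ulsubmx T1u row_mxKl.
  - by rewrite /ursubmx T1u row_mxKr.
  - by rewrite -sT1 -trmx_ursub /ursubmx T1u row_mxKr trmx0.
have [|U [d [U1 dE]]] := IH (drsubmx T1).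
  by rewrite trmx_drsub sT1.
pose W : 'M[R]_(1 + N) := block_mx 1%:M 0 0 U *m Q.
have W1 : W^T *m W = 1%:M.
  rewrite /W trmx_mul tr_block_mx !trmx0 trmx1 mulmxA -(mulmxA Q^T).
  rewrite mulmx_block !mul0mx !mulmx0 !addr0 mul1mx add0r U1.
  by rewrite -(scalar_mx_block 1 N 1) mulmx1.
have TE : T = W^T *m diag_mx (row_mx a%:M d) *m W.
  rewrite /W trmx_mul tr_block_mx !trmx0 trmx1 diag_mx_row.
  have -> : T = Q^T *m T1 *m Q.
    by rewrite T1def !mulmxA Q2 mul1mx -mulmxA Q2 mulmx1.
  rewrite -!mulmxA; congr (Q^T *m _); rewrite !mulmxA; congr (_ *m Q).
  rewrite T1E dE !mulmx_block !mul0mx !mulmx0 !addr0 !mul1mx !add0r mulmx1.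
  congr (block_mx _ _ _ _); rewrite ?mul0mx //.
  by apply/matrixP => i j; rewrite !mxE !ord1.
by exists W; exists (row_mx a%:M d).
Qed.

End Spectral.

(** * Positive definite matrices, functional calculus and a formula for the distance *)

Section PosDef.
Variable R : realType.

Lemma trmxMM m n p q (A : 'M[R]_(m, n)) (B : 'M[R]_(n, p)) (C : 'M[R]_(p, q)) :
  (A *m B *m C)^T = C^T *m B^T *m A^T.
Proof. by rewrite !trmx_mul mulmxA. Qed.

Lemma quad_diag N (d : 'rV[R]_N) (x : 'cV[R]_N) :
  (x^T *m diag_mx d *m x) 0 0 = \sum_i d 0 i * x i 0 ^+ 2.
Proof.
rewrite mul_mx_diag mxE; apply: eq_bigr => i _.
by rewrite !mxE expr2 mulrA [d 0 i * _]mulrC.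
Qed.

Lemma posdef_congr N (A M : 'M[R]_N) : posdef A -> M \in unitmx ->
  posdef (M^T *m A *m M).
Proof.
move=> [sA pA] uM; split; first by rewrite trmxMM trmxK sA.
move=> x x0; rewrite !mulmxA -trmx_mul -mulmxA; apply: pA.
by apply: contra_neq x0 => Mx0; rewrite -[x](mulKmx uM) Mx0 mulmx0.
Qed.

Lemma posdef_diag N (d : 'rV[R]_N) : (forall i, 0 < d 0 i) -> posdef (diag_mx d).
Proof.
move=> d0; split; first by rewrite tr_diag_mx.
move=> x x0; rewrite quad_diag.
have /existsP[i xi] : [exists i, x i 0 != 0].
  apply: contraR x0; rewrite negb_exists => /forallP x0.
  apply/eqP/matrixP => i j; rewrite !ord1 mxE.
  by have := x0 i; rewrite negbK => /eqP.
have xi2 : 0 < x i 0 ^+ 2 by rewrite exprn_even_gt0.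
rewrite (bigD1 i) //= ltr_pwDl ?(mulr_gt0 (d0 i) xi2)//.
by apply: sumr_ge0 => j _; rewrite mulr_ge0 ?sqr_ge0 ?ltW.
Qed.

Lemma delta_col_neq0 N (i : 'I_N) : delta_mx i 0 != 0 :> 'cV[R]_N.
Proof.
by apply/eqP => /matrixP/(_ i 0); rewrite !mxE !eqxx => /eqP; rewrite oner_eq0.
Qed.

Lemma posdef_diag_gt0 N (d : 'rV[R]_N) : posdef (diag_mx d) -> forall i, 0 < d 0 i.
Proof.
move=> [_ pd] i; have := pd _ (delta_col_neq0 i); rewrite quad_diag.
rewrite (bigD1 i)//= !mxE !eqxx expr1n mulr1 big1 ?addr0// => j ji.
by rewrite !mxE (negPf ji) expr0n mulr0.
Qed.

Lemma posdef_spectral N (A : 'M[R]_N) : posdef A ->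
  exists (U : 'M[R]_N) (d : 'rV[R]_N),
    [/\ U^T *m U = 1%:M, A = U^T *m diag_mx d *m U & forall i, 0 < d 0 i].
Proof.
move=> pA; have [U [d [U1 AE]]] := sym_spectral pA.1.
exists U, d; split=> //; apply: posdef_diag_gt0.
have -> : diag_mx d = U^T^T *m A *m U^T.
  have U2 := mulmx1C U1.
  by rewrite trmxK AE !mulmxA U2 mul1mx -mulmxA U2 mulmx1.
by apply: posdef_congr => //; rewrite unitmx_tr; case: (mulmx1_unit U1).
Qed.

Lemma det_diag_gt0 N (d : 'rV[R]_N) : (forall i, 0 < d 0 i) -> 0 < \det (diag_mx d).
Proof. by move=> d0; rewrite det_diag prodr_gt0. Qed.

Lemma orth_det_sq N (U : 'M[R]_N) : U^T *m U = 1%:M -> \det U * \det U = 1.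
Proof. by move/(congr1 determinant); rewrite det_mulmx det_tr det1. Qed.

Lemma posdef_det N (A : 'M[R]_N) : posdef A -> 0 < \det A.
Proof.
move=> /posdef_spectral[U [d [U1 -> d0]]].
rewrite !det_mulmx det_tr mulrAC orth_det_sq// mul1r; exact: det_diag_gt0.
Qed.

Lemma posdef_unit N (A : 'M[R]_N) : posdef A -> A \in unitmx.
Proof. by move/posdef_det => A0; rewrite unitmxE unitfE gt_eqF. Qed.

Lemma posdef_inv N (A : 'M[R]_N) : posdef A -> posdef (invmx A).
Proof.
move=> pA; have uA := posdef_unit pA.
have sA : (invmx A)^T = invmx A by rewrite trmx_inv pA.1.
have -> : invmx A = (invmx A)^T *m A *m invmx A.
  by rewrite sA mulVmx// mul1mx.
by apply: posdef_congr => //; rewrite unitmx_inv.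
Qed.

Lemma posdef_gram N (M : 'M[R]_N) : M \in unitmx -> posdef (M^T *m M).
Proof. by move=> uM; rewrite -[M^T]mulmx1; apply/posdef_congr/uM/posdef1. Qed.

Lemma posdef_factor N (A : 'M[R]_N) : posdef A ->
  exists2 M : 'M[R]_N, M \in unitmx & A = M^T *m M.
Proof.
move=> /posdef_spectral[U [d [U1 -> d0]]].
pose s := map_mx Num.sqrt d.
exists (diag_mx s *m U).
  rewrite unitmx_mul (mulmx1_unit U1).2 andbT unitmxE unitfE gt_eqF//.
  by apply: det_diag_gt0 => i; rewrite mxE sqrtr_gt0.
rewrite trmx_mul tr_diag_mx mulmxA; congr (_ *m U); rewrite -mulmxA; congr (_ *m _).
rewrite mulmx_diag; congr diag_mx; apply/rowP => i; rewrite !mxE -expr2 sqr_sqrtr//.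
exact: ltW.
Qed.

(** After factoring A = L^T L, diagonalize the congruent of B by L^-1 orthogonally: the orthogonal
    factor does not affect the Gram form of A. *)
Lemma simult_diag N (A B : 'M[R]_N) : posdef A -> B^T = B ->
  exists (M : 'M[R]_N) (d : 'rV[R]_N),
    [/\ M \in unitmx, A = M^T *m M & B = M^T *m diag_mx d *m M].
Proof.
move=> /posdef_factor[L uL ->] sB.
have [|U [d [U1 E]]] := @sym_spectral R N ((invmx L)^T *m B *m invmx L).
  by rewrite trmxMM trmxK sB.
exists (U *m L), d; rewrite unitmx_mul uL (mulmx1_unit U1).2; split=> //.
  by rewrite trmx_mul mulmxA -(mulmxA L^T) U1 mulmx1.
rewrite trmx_mul; have -> : L^T *m U^T *m diag_mx d *m (U *m L) =
  L^T *m (U^T *m diag_mx d *m U) *m L by rewrite !mulmxA.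
rewrite -E !mulmxA -trmx_mul mulVmx// trmx1 mul1mx -mulmxA mulVmx// mulmx1 //.
Qed.

Lemma diag_congr_gt0 N (M : 'M[R]_N) (d : 'rV[R]_N) : M \in unitmx ->
  posdef (M^T *m diag_mx d *m M) -> forall i, 0 < d 0 i.
Proof.
move=> uM pB; apply: posdef_diag_gt0.
have -> : diag_mx d = (invmx M)^T *m (M^T *m diag_mx d *m M) *m invmx M.
  by rewrite !mulmxA -trmx_mul mulmxV// trmx1 mul1mx -mulmxA mulmxV// mulmx1.
by apply: posdef_congr; rewrite // unitmx_inv.
Qed.

(** An entry of [W] can be nonzero only where the two eigenvalues agree, and there f takes the same
    value. This makes the functional calculus independent of the diagonalization. *)
Lemma diag_intertwine N (f : R -> R) (W : 'M[R]_N) (d e : 'rV[R]_N) :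
  W *m diag_mx d = diag_mx e *m W ->
  W *m diag_mx (map_mx f d) = diag_mx (map_mx f e) *m W.
Proof.
rewrite !mul_mx_diag !mul_diag_mx => /matrixP E; apply/matrixP => i j.
move: (E i j); rewrite !mxE; have [->|W0] := eqVneq (W i j) 0.
  by move=> _; rewrite mul0r mulr0.
by rewrite mulrC => /(mulIf W0) ->; rewrite mulrC.
Qed.

Lemma is_mxfun_inj N f (A B B' : 'M[R]_N) :
  is_mxfun f A B -> is_mxfun f A B' -> B = B'.
Proof.
move=> [U [d [U1 AE ->]]] [V [e [V1 AE' ->]]].
have V2 := mulmx1C V1; have U2 := mulmx1C U1.
have /(diag_intertwine f) : (V *m U^T) *m diag_mx d = diag_mx e *m (V *m U^T).
  have := AE; rewrite AE' => /(congr1 (fun X => V *m X *m U^T)).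
  rewrite !mulmxA V2 mul1mx => E.
  by rewrite E -(mulmxA _ U) U2 mulmx1.
move=> /(congr1 (fun X => V^T *m X *m U)).
by rewrite !mulmxA V1 mul1mx -(mulmxA _ U^T) U1 mulmx1.
Qed.

Lemma mxfunE N f (A B : 'M[R]_N) : is_mxfun f A B -> mxfun f A = B.
Proof.
move=> AB; apply/esym; apply: (is_mxfun_inj AB); rewrite /mxfun.
by apply: (@getPex _ [set B | is_mxfun f A B]); exists B.
Qed.

Lemma is_mxfun_posdef N (f : R -> R) (A B : 'M[R]_N) :
  (forall x, 0 < x -> 0 < f x) -> posdef A -> is_mxfun f A B -> posdef B.
Proof.
move=> f0 pA [U [d [U1 AE ->]]]; have uU := (mulmx1_unit U1).2.
apply: posdef_congr => //; apply: posdef_diag => i; rewrite mxE.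
by apply: f0; apply: (diag_congr_gt0 uU); rewrite -AE.
Qed.

Lemma posdef_mxfun N (f : R -> R) (A : 'M[R]_N) : posdef A -> exists B, is_mxfun f A B.
Proof.
move=> /posdef_spectral[U [d [U1 AE _]]].
by exists (U^T *m diag_mx (map_mx f d) *m U), U, d.
Qed.

Lemma pdP N (A : pdmx R N) : posdef (mx_of_pd A).
Proof. exact: set_mem (valP A). Qed.

Lemma posP N (a : posrow R N) i : 0 < row_of_pos a 0 i.
Proof. exact: set_mem (valP a) i. Qed.

Definition pd_of N (A : 'M[R]_N) (pA : posdef A) : pdmx R N :=
  exist (fun A => A \in @posdef_set R N) A (mem_set pA).

Lemma pd_ofK N (A : 'M[R]_N) (pA : posdef A) : mx_of_pd (pd_of pA) = A.
Proof. by []. Qed.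

Lemma mx_of_pd_inj N : injective (@mx_of_pd R N).
Proof. exact: val_inj. Qed.

Lemma pd_powP N (r : R) (A : pdmx R N) :
  is_mxfun (fun x => x `^ r) (mx_of_pd A) (mx_of_pd (pd_pow r A)).
Proof.
have [B AB] := posdef_mxfun (fun x => x `^ r) (pdP A).
have pB : posdef B by apply: is_mxfun_posdef AB => [x x0|]; [exact: powR_gt0|exact: pdP].
rewrite /pd_pow.
by apply: (@getPex _ [set B : pdmx R N |
  is_mxfun (fun x => x `^ r) (mx_of_pd A) (mx_of_pd B)]); exists (pd_of pB).
Qed.

Lemma orth_sum_fun N (f : R -> R) (W : 'M[R]_N) (d e : 'rV[R]_N) :
  W^T *m W = 1%:M -> W *m diag_mx d = diag_mx e *m W ->
  \sum_i f (d 0 i) = \sum_i f (e 0 i).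
Proof.
move=> W1 /(diag_intertwine f) E.
have trE (c : 'rV[R]_N) : \sum_i f (c 0 i) = \tr (diag_mx (map_mx f c)).
  by rewrite mxtrace_diag; apply: eq_bigr => i _; rewrite mxE.
rewrite !trE -[diag_mx (map_mx f d)]mul1mx -W1 -mulmxA E mxtrace_mulC.
by rewrite -mulmxA (mulmx1C W1) mulmx1.
Qed.

(** Any simultaneous diagonalization computes the distance: with A' = A^-1/2, the matrix M A' is
    orthogonal because A' A A' = 1, and it conjugates A' B A' to diag d. *)
Lemma riem_distE N (A B : pdmx R N) (M : 'M[R]_N) (d : 'rV[R]_N) :
  M \in unitmx -> mx_of_pd A = M^T *m M -> mx_of_pd B = M^T *m diag_mx d *m M ->
  riem_dist A B = Num.sqrt (\sum_i ln (d 0 i) ^+ 2).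
Proof.
move=> uM AE BE.
have [U [a [U1 AU a0]]] := posdef_spectral (pdP A); have U2 := mulmx1C U1.
pose h := fun x : R => x `^ (- 2^-1).
have /mxfunE A'E : is_mxfun h (mx_of_pd A) (U^T *m diag_mx (map_mx h a) *m U) by exists U, a.
rewrite /riem_dist -/h A'E; set A' := _ *m U.
have sA' : A'^T = A' by rewrite /A' trmxMM trmxK tr_diag_mx.
have A'1 : A' *m mx_of_pd A *m A' = 1%:M.
  rewrite AU /A' !mulmxA -(mulmxA _ U U^T) U2 mulmx1 -(mulmxA _ U U^T) U2 mulmx1.
  rewrite -(mulmxA U^T) mulmx_diag -(mulmxA U^T) mulmx_diag -[RHS]U1.
  rewrite -[X in _ = X *m _]mulmx1; congr (_ *m _ *m _).
  apply/matrixP => i j; rewrite !mxE; congr (_ *+ _).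
  have ai := a0 j.
  rewrite mulrC mulrA /h -powRD; last by apply/implyP => _; rewrite gt_eqF.
  have -> : - 2^-1 + - 2^-1 = - 1 :> R by field.
  rewrite powRN powRr1 ?ltW// mulVf// gt_eqF //.
clearbody A'.
have sX : (A' *m mx_of_pd B *m A')^T = A' *m mx_of_pd B *m A'.
  by rewrite trmxMM sA' (pdP B).1.
have [V [e [V1 XE]]] := sym_spectral sX; have V2 := mulmx1C V1.
have /mxfunE -> : is_mxfun (@ln R) (A' *m mx_of_pd B *m A') (V^T *m diag_mx (map_mx (@ln R) e) *m V).
  by exists V, e.
rewrite /frobenius; congr (Num.sqrt _).
have -> : V^T *m diag_mx (map_mx (@ln R) e) *m V *m (V^T *m diag_mx (map_mx (@ln R) e) *m V)
  = V^T *m diag_mx (map_mx (fun x => ln x ^+ 2) e) *m V.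
  rewrite !mulmxA -(mulmxA _ V V^T) V2 mulmx1 -(mulmxA V^T) mulmx_diag.
  by congr (_ *m diag_mx _ *m _); apply/rowP => i; rewrite !mxE expr2.
rewrite mxtrace_mulC mulmxA V2 mul1mx mxtrace_diag.
pose W := M *m A' *m V^T.
rewrite -(@orth_sum_fun N (fun x => ln x ^+ 2) W e d).
- by apply: eq_bigr => i _; rewrite mxE.
- rewrite /W !trmx_mul trmxK sA' !mulmxA -(mulmxA _ M^T) -AE.
  by rewrite -2!(mulmxA V) A'1 mulmx1 V2.
- have -> : diag_mx e = V *m (A' *m mx_of_pd B *m A') *m V^T.
    by rewrite XE !mulmxA V2 mul1mx -mulmxA V2 mulmx1.
  rewrite BE; have W1 : W *m W^T = 1%:M.
    apply: mulmx1C; rewrite /W !trmx_mul trmxK sA' !mulmxA -(mulmxA _ M^T) -AE.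
    by rewrite -2!(mulmxA V) A'1 mulmx1 V2.
  rewrite -[RHS]mul1mx -W1 /W !trmx_mul trmxK sA' !mulmxA //.
Qed.

End PosDef.

(** * Determinants of compressions and products of the largest relative eigenvalues *)

Section Gram.
Variable R : realType.

Lemma sum_CS (I : finType) (a b : I -> R) :
  (\sum_i a i * b i) ^+ 2 <= (\sum_i a i ^+ 2) * (\sum_i b i ^+ 2).
Proof.
set p := \sum_i a i * b i; set A := \sum_i a i ^+ 2; set B := \sum_i b i ^+ 2.
have B0 : 0 <= B by apply: sumr_ge0 => i _; rewrite sqr_ge0.
have [B1|B1] := eqVneq B 0.
  suff -> : p = 0 by rewrite B1 expr0n mulr0.
  apply: big1 => i _.
  have /eqP := psumr_eq0P (fun i _ => sqr_ge0 (b i)) B1 (i := i) isT.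
  by rewrite sqrf_eq0 => /eqP ->; rewrite mulr0.
have : 0 <= \sum_i (a i * B - b i * p) ^+ 2 by apply: sumr_ge0 => i _; rewrite sqr_ge0.
have -> : \sum_i (a i * B - b i * p) ^+ 2 = B * (A * B - p ^+ 2).
  rewrite (eq_bigr (fun i => B ^+ 2 * a i ^+ 2 - 2 * B * p * (a i * b i)
    + p ^+ 2 * b i ^+ 2)); last by move=> i _; ring.
  rewrite big_split sumrB -!mulr_sumr /= -/p -/A -/B; ring.
by rewrite pmulr_rge0 ?subr_ge0 // lt_def B1.
Qed.

Lemma det_rowsub_noninj N k (f : 'I_k -> 'I_N) (B : 'M[R]_(N, k)) :
  ~~ injectiveb f -> \det (rowsub f B) = 0.
Proof.
case/injectivePn => i [j ij fij]; apply: (determinant_alternate ij) => l.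
by rewrite !mxE fij.
Qed.

Lemma det_mul_rowsub N k (A B : 'M[R]_(N, k)) (s : 'rV[R]_N) :
  \det (A^T *m diag_mx s *m B) = \sum_(f : {ffun 'I_k -> 'I_N})
    (\prod_i A (f i) i) * (\prod_i s 0 (f i)) * \det (rowsub f B).
Proof.
rewrite /determinant.
under eq_bigr => p _.
  under eq_bigr => i _.
    rewrite mul_mx_diag mxE; under eq_bigr do rewrite !mxE; over.
  rewrite bigA_distr_bigA mulr_sumr; over.
rewrite exchange_big /=; apply: eq_bigr => f _; rewrite mulr_sumr.
apply: eq_bigr => p _; rewrite mulrCA; congr (_ * _).
rewrite -!big_split /=; apply: eq_bigr => i _.
by rewrite !mxE.
Qed.

(* The Cauchy-Binet formula, summed over all maps instead of all subsets. *)
Lemma cauchy_binet N k (A B : 'M[R]_(N, k)) (s : 'rV[R]_N) :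
  k`!%:R * \det (A^T *m diag_mx s *m B) = \sum_(f : {ffun 'I_k -> 'I_N})
    (\prod_i s 0 (f i)) * (\det (rowsub f A) * \det (rowsub f B)).
Proof.
(* Reindexing the maps by p leaves the determinant unchanged; summing over the k! permutations then
   antisymmetrizes the product of entries of A into a minor. *)
have E (p : 'S_k) : \det (A^T *m diag_mx s *m B) = \sum_(f : {ffun 'I_k -> 'I_N})
    (\prod_i s 0 (f i)) *
    (((-1) ^+ p * \prod_i (rowsub f A)^T i (p i)) * \det (rowsub f B)).
  rewrite det_mul_rowsub.
  have h_bij : bijective (fun f : {ffun 'I_k -> 'I_N} => [ffun i => f (p i)]).
    exists (fun f : {ffun 'I_k -> 'I_N} => [ffun i => f (p^-1%g i)]) => f;
    by apply/ffunP => i; rewrite !ffunE ?permK ?permKV.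
  rewrite (reindex _ (onW_bij _ h_bij)) /=; apply: eq_bigr => f _.
  have -> : rowsub [ffun i => f (p i)] B = row_perm p (rowsub f B).
    by apply/matrixP => i j; rewrite !mxE ffunE.
  rewrite row_permE det_mulmx det_perm.
  under eq_bigr do rewrite ffunE.
  under [X in _ * X * _]eq_bigr do rewrite ffunE.
  rewrite [X in _ * X * _](reindex_inj (@perm_inj _ (p^-1)%g)) /=.
  under [X in _ * X * _]eq_bigr do rewrite permKV.
  under [X in _ = _ * (_ * X * _)]eq_bigr do rewrite !mxE.
  rewrite [X in X * _ = _]mulrC -!mulrA; congr (_ * _); exact: mulrCA.
rewrite -card_Sn -sum1_card natr_sum mulr_suml.
under eq_bigr => p _ do rewrite mul1r (E p).
rewrite (eq_bigl xpredT); last by move=> p; rewrite inE.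
rewrite exchange_big /=; apply: eq_bigr => f _.
rewrite -mulr_sumr; congr (_ * _); rewrite -mulr_suml; congr (_ * _).
by rewrite -[in RHS]det_tr.
Qed.

Lemma det_gram_sum N k (U V : 'M[R]_(N, k)) :
  k`!%:R * \det (U^T *m V) = \sum_(f : {ffun 'I_k -> 'I_N})
    \det (rowsub f U) * \det (rowsub f V).
Proof.
have := cauchy_binet U V (const_mx 1); rewrite diag_const_mx mulmx1 => ->.
by apply: eq_bigr => f _; rewrite big1 ?mul1r// => i _; rewrite mxE.
Qed.

Lemma fact_gt0R k : 0 < k`!%:R :> R.
Proof. by rewrite ltr0n fact_gt0. Qed.

Lemma det_gram_ge0 N k (U : 'M[R]_(N, k)) : 0 <= \det (U^T *m U).
Proof.
rewrite -(pmulr_rge0 _ (fact_gt0R k)) det_gram_sum.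
by apply: sumr_ge0 => f _; rewrite -expr2 sqr_ge0.
Qed.

(** By Cauchy-Binet these determinants are inner products of the families of k x k minors, so this
    is the scalar Cauchy-Schwarz inequality with a factor k! on each side. *)
Lemma det_CS N k (U V : 'M[R]_(N, k)) :
  \det (U^T *m V) ^+ 2 <= \det (U^T *m U) * \det (V^T *m V).
Proof.
have k0 := fact_gt0R k; have k2 : 0 < (k`!%:R : R) ^+ 2 by rewrite exprn_gt0.
rewrite -(ler_pM2l k2) -exprMn [X in _ <= X * _]expr2 mulrACA !det_gram_sum.
have h (W : 'M[R]_(N, k)) : \sum_(f : {ffun 'I_k -> 'I_N}) \det (rowsub f W) * \det (rowsub f W)
  = \sum_(f : {ffun 'I_k -> 'I_N}) \det (rowsub f W) ^+ 2.
  by apply: eq_bigr => f _; rewrite expr2.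
by rewrite !h sum_CS.
Qed.

Lemma det_gram_le N k (U : 'M[R]_(N, k)) (s : 'rV[R]_N) (c : R) :
  (forall f : 'I_k -> 'I_N, injective f -> \prod_i s 0 (f i) <= c) ->
  \det (U^T *m diag_mx s *m U) <= c * \det (U^T *m U).
Proof.
move=> sc; rewrite -(ler_pM2l (fact_gt0R k)) cauchy_binet mulrCA det_gram_sum.
rewrite mulr_sumr; apply: ler_sum => f _.
have [/injectiveP/sc|/det_rowsub_noninj->] := boolP (injectiveb f); last first.
  by rewrite !mulr0.
by move=> fc; rewrite ler_wpM2r// -expr2 sqr_ge0.
Qed.

(** The indices common to both images cancel. The remaining sets have equal cardinality, and the
    largest value of s on the rest of the image of f separates them. *)
Lemma prod_top_le N k (s : 'I_N -> R) (t f : 'I_k -> 'I_N) :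
  (forall i, 0 <= s i) -> injective t -> injective f ->
  (forall i j, i \notin codom t -> s i <= s (t j)) ->
  \prod_i s (f i) <= \prod_i s (t i).
Proof.
move=> s0 it if_ top.
have im (g : 'I_k -> 'I_N) : injective g -> \prod_i s (g i) = \prod_(i in g @: 'I_k) s i.
  by move=> ig; rewrite big_imset //= => i j _ _; apply: ig.
rewrite !im//; set F := f @: _; set T := t @: _.
rewrite (big_setID T) [X in _ <= X](big_setID F) /= finset.setIC.
apply: ler_wpM2l; first by apply: prodr_ge0.
have cFT : #|F :\: T| = #|T :\: F|.
  have : #|F| = #|T| by rewrite /F /T !card_imset.
  by rewrite -(cardsID T F) -(cardsID F T) finset.setIC => /addnI.
have [F0|/set0Pn[i0 i0F]] := eqVneq (F :\: T) finset.set0.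
  have -> : T :\: F = finset.set0 by apply/eqP; rewrite -cards_eq0 -cFT F0 cards0.
  by rewrite F0.
pose m := [arg max_(i > i0 in F :\: T) s i]%O.
have [mF mmax] : m \in F :\: T /\ forall i, i \in F :\: T -> s i <= s m.
  by rewrite /m; case: arg_maxP.
apply: (@le_trans _ _ (s m ^+ #|F :\: T|)).
  rewrite -prodr_const; apply: ler_prod => i iF.
  by rewrite s0 mmax.
rewrite cFT -prodr_const; apply: ler_prod => i; rewrite inE => /andP[_ /imsetP[j _ ->]].
rewrite s0 /= top//; move: mF; rewrite inE => /andP[mT _].
by apply: contra mT => /codomP[l ->]; apply: imset_f.
Qed.

(** Together with [pair_det_attained] this is the extremal principle for the product of the k
    largest eigenvalues of M^T diag(d) M relative to M^T M, with t selecting their positions. *)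
Lemma pair_det_le N k (M : 'M[R]_N) (d : 'rV[R]_N) (t : 'I_k -> 'I_N) (V : 'M[R]_(N, k)) :
  (forall i, 0 <= d 0 i) -> injective t ->
  (forall i j, i \notin codom t -> d 0 i <= d 0 (t j)) ->
  \det (V^T *m (M^T *m diag_mx d *m M) *m V) <=
  (\prod_j d 0 (t j)) * \det (V^T *m (M^T *m M) *m V).
Proof.
move=> d0 it top.
have -> : V^T *m (M^T *m diag_mx d *m M) *m V = (M *m V)^T *m diag_mx d *m (M *m V).
  by rewrite trmx_mul !mulmxA.
have -> : V^T *m (M^T *m M) *m V = (M *m V)^T *m (M *m V).
  by rewrite trmx_mul !mulmxA.
by apply: det_gram_le => f if_; apply: (prod_top_le d0).
Qed.

Definition frame N k (t : 'I_k -> 'I_N) : 'M[R]_(N, k) := colsub t 1%:M.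

Lemma frame_diag N k (t : 'I_k -> 'I_N) (d : 'rV[R]_N) : injective t ->
  (frame t)^T *m diag_mx d *m frame t = diag_mx (\row_j d 0 (t j)).
Proof.
move=> it; rewrite mul_mx_diag; apply/matrixP => i j.
rewrite !mxE (bigD1 (t i)) //= big1 ?addr0; last first.
  by move=> l lt; rewrite !mxE (negPf lt) mul0r mul0r.
by rewrite !mxE eqxx mul1r (inj_eq it) mulr_natr.
Qed.

Lemma frame_gram N k (t : 'I_k -> 'I_N) : injective t ->
  (frame t)^T *m frame t = 1%:M.
Proof.
move=> it; have := @frame_diag N k t (const_mx 1) it.
rewrite diag_const_mx mulmx1 => ->; rewrite -diag_const_mx.
by congr diag_mx; apply/rowP => j; rewrite !mxE.
Qed.

Lemma pair_det_attained N k (M : 'M[R]_N) (d : 'rV[R]_N) (t : 'I_k -> 'I_N) :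
  M \in unitmx -> injective t -> exists V : 'M[R]_(N, k),
  V^T *m (M^T *m M) *m V = 1%:M /\
  \det (V^T *m (M^T *m diag_mx d *m M) *m V) = \prod_j d 0 (t j).
Proof.
move=> uM it; exists (invmx M *m frame t).
have h (X : 'M[R]_N) : (invmx M *m frame t)^T *m (M^T *m X *m M) *m (invmx M *m frame t)
  = (frame t)^T *m X *m frame t.
  by rewrite trmx_mul -!mulmxA mulKVmx// !mulmxA -(mulmxA _ _ M^T) -trmx_mul mulmxV// trmx1 mulmx1.
split; first by rewrite -[M^T]mulmx1 h mulmx1 frame_gram.
by rewrite h frame_diag// det_diag; apply: eq_bigr => i _; rewrite mxE.
Qed.

Lemma sorting_perm N (d : 'I_N -> R) :
  exists p : 'S_N, forall i j : 'I_N, (i <= j)%N -> d (p j) <= d (p i).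
Proof.
pose t := [tuple d i | i < N].
have /tuple_permP[p pE] : perm_eq (sort >=%R t) t by rewrite perm_sort.
exists p => i j ij.
have st : sorted >=%R (sort >=%R t).
  by apply: sort_sorted => x y; apply: le_total.
have sz : size (sort >=%R t) = N by rewrite size_sort size_tuple.
have := sorted_leq_nth (rev_trans le_trans) (fun x => lexx x) 0 st.
move/(_ i j); rewrite !inE sz !ltn_ord => /(_ isT isT ij).
by rewrite pE -!tnth_nth !tnth_map !tnth_ord_tuple.
Qed.

Lemma diag_perm N (M : 'M[R]_N) (d : 'rV[R]_N) (p : 'S_N) :
  (perm_mx p *m M)^T *m diag_mx (\row_i d 0 (p i)) *m (perm_mx p *m M) =
  M^T *m diag_mx d *m M.
Proof.
rewrite trmx_mul !mulmxA; congr (_ *m M); rewrite -!mulmxA; congr (_ *m _).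
have -> : diag_mx (\row_i d 0 (p i)) *m perm_mx p = perm_mx p *m diag_mx d.
  rewrite mul_diag_mx mul_mx_diag; apply/matrixP => i j; rewrite !mxE.
  by case: eqP => [->|]; rewrite ?mulr1 ?mul1r// mulr0 mul0r.
by rewrite mulmxA tr_perm_mx -perm_mxM mulVg perm_mx1 mul1mx.
Qed.

Lemma simult_diag_sorted N (A B : 'M[R]_N) : posdef A -> B^T = B ->
  exists (M : 'M[R]_N) (d : 'rV[R]_N),
    [/\ M \in unitmx, A = M^T *m M, B = M^T *m diag_mx d *m M &
     forall i j : 'I_N, (i <= j)%N -> d 0 j <= d 0 i].
Proof.
move=> pA sB; have [M [d [uM AE BE]]] := simult_diag pA sB.
have [p pd] := sorting_perm (d 0).
exists (perm_mx p *m M), (\row_i d 0 (p i)); split.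
- by rewrite unitmx_mul unitmx_perm.
- have := diag_perm M (const_mx 1) p.
  have -> : (\row_i (const_mx 1 : 'rV[R]_N) 0 (p i)) = const_mx 1.
    by apply/rowP => i; rewrite !mxE.
  by rewrite diag_const_mx !mulmx1 -AE => ->.
- by rewrite diag_perm.
- by move=> i j ij; rewrite !mxE pd.
Qed.

(** Summation by parts: the last and smallest weight c takes over the role of b, and the induction
    treats the remaining terms. *)
Lemma abel_ge0 N (c z : 'I_N -> R) (b : R) : (forall i, b <= c i) ->
  (forall i j : 'I_N, (i <= j)%N -> c j <= c i) ->
  (forall k, (k <= N)%N -> 0 <= \sum_(i < N | (i < k)%N) z i) ->
  b * \sum_i z i <= \sum_i c i * z i.
Proof.
elim: N c z b => [|N IH] c z b bc cd S0; first by rewrite !big_ord0 mulr0.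
have SN : 0 <= \sum_i z i.
  by have := S0 N.+1 (leqnn _); under eq_bigl do rewrite ltn_ord.
apply: (@le_trans _ _ (c ord_max * \sum_i z i)); first by rewrite ler_wpM2r.
rewrite !big_ord_recr mulrDr lerD2r /=.
apply: IH => [i|i j ij|k kN].
- by apply: cd; rewrite /= ltnW.
- exact: cd.
- have := S0 k (leqW kN); rewrite big_mkcond big_ord_recr /= ltnNge kN addr0.
  by rewrite -big_mkcond.
Qed.

Lemma sorted_notin_widen N k (kN : (k <= N)%N) (i : 'I_N) (j : 'I_k) :
  i \notin codom (widen_ord kN) -> (j <= i)%N.
Proof.
apply: contraR; rewrite -ltnNge => ij.
by apply/codomP; exists (Ordinal (ltn_trans ij (ltn_ord j))); apply/val_inj.
Qed.

Lemma widen_ord_inj N k (kN : (k <= N)%N) : injective (widen_ord kN).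
Proof. by move=> i j /(congr1 val) /= /val_inj. Qed.

Lemma ln_prod (I : Type) (r : seq I) (P : pred I) (f : I -> R) :
  (forall i, P i -> 0 < f i) ->
  ln (\prod_(i <- r | P i) f i) = \sum_(i <- r | P i) ln (f i).
Proof.
move=> f0; have [] : 0 < \prod_(i <- r | P i) f i /\
    ln (\prod_(i <- r | P i) f i) = \sum_(i <- r | P i) ln (f i); last by [].
apply: (big_ind2 (fun x y => 0 < x /\ ln x = y)).
- by rewrite ln1.
- by move=> x y u v [x0 <-] [u0 <-]; rewrite mulr_gt0// lnM ?posrE.
- by move=> i Pi; rewrite f0.
Qed.

(* The product of the [k] largest relative eigenvalues is the maximal ratio of
   compressed determinants. *)
Lemma relative_log_major N (A B C L M S : 'M[R]_N) (a b c : 'rV[R]_N) k :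
  (k <= N)%N -> M \in unitmx -> L \in unitmx -> S \in unitmx ->
  (forall i, 0 < a 0 i) -> (forall i, 0 < b 0 i) -> (forall i, 0 < c 0 i) ->
  (forall i j : 'I_N, (i <= j)%N -> a 0 j <= a 0 i) ->
  (forall i j : 'I_N, (i <= j)%N -> b 0 j <= b 0 i) ->
  A = L^T *m L -> B = L^T *m diag_mx a *m L ->
  B = M^T *m M -> C = M^T *m diag_mx b *m M ->
  A = S^T *m S -> C = S^T *m diag_mx c *m S ->
  \sum_(i < N | (i < k)%N) ln (c 0 i) <=
  \sum_(i < N | (i < k)%N) (ln (a 0 i) + ln (b 0 i)).
Proof.
move=> kN uM uL uS a0 b0 c0 ad bd AL BL BM CM AS CS.
have sumE (d : 'I_N -> R) : \sum_(i < N | (i < k)%N) d i = \sum_(i < k) d (widen_ord kN i).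
  by rewrite big_ord_narrow.
rewrite !sumE big_split /=.
rewrite -!ln_prod//; rewrite -lnM ?posrE ?prodr_gt0//.
rewrite ler_ln ?posrE ?mulr_gt0 ?prodr_gt0//.
have [V [V1 <-]] := pair_det_attained c uS (@widen_ord_inj N k kN).
rewrite -CS CM.
apply: le_trans (pair_det_le _ _ _ (@widen_ord_inj N k kN) _) _.
- by move=> i; exact: ltW.
- by move=> i j /(@sorted_notin_widen _ _ _ _ j) ji; apply: bd.
rewrite mulrC ler_pM2r ?prodr_gt0// -BM BL.
apply: le_trans (pair_det_le _ _ _ (@widen_ord_inj N k kN) _) _.
- by move=> i; exact: ltW.
- by move=> i j /(@sorted_notin_widen _ _ _ _ j) ji; apply: ad.
by rewrite -AL AS V1 det1 mulr1.
Qed.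

End Gram.

(** * The Riemannian distance: triangle inequality, symmetry and comparison of forms *)

Section Metric.
Variable R : realType.

Lemma pd_rep N (A B : pdmx R N) : exists (M : 'M[R]_N) (d : 'rV[R]_N),
  [/\ M \in unitmx, mx_of_pd A = M^T *m M, mx_of_pd B = M^T *m diag_mx d *m M,
   forall i, 0 < d 0 i & forall i j : 'I_N, (i <= j)%N -> d 0 j <= d 0 i].
Proof.
have [M [d [uM AE BE ds]]] := simult_diag_sorted (pdP A) (pdP B).1.
exists M, d; split=> //; apply: (diag_congr_gt0 uM); rewrite -BE; exact: pdP.
Qed.

Lemma riem_dist_ge0 N (A B : pdmx R N) : 0 <= riem_dist A B.
Proof. exact: sqrtr_ge0. Qed.

Lemma riem_dist_sq N (A B : pdmx R N) (M : 'M[R]_N) (d : 'rV[R]_N) :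
  M \in unitmx -> mx_of_pd A = M^T *m M -> mx_of_pd B = M^T *m diag_mx d *m M ->
  riem_dist A B ^+ 2 = \sum_i ln (d 0 i) ^+ 2.
Proof.
move=> uM AE BE; rewrite (riem_distE uM AE BE) sqr_sqrtr//.
by apply: sumr_ge0 => i _; rewrite sqr_ge0.
Qed.

Lemma ln_le_riem_dist N (A B : pdmx R N) (M : 'M[R]_N) (d : 'rV[R]_N) i :
  M \in unitmx -> mx_of_pd A = M^T *m M -> mx_of_pd B = M^T *m diag_mx d *m M ->
  `|ln (d 0 i)| <= riem_dist A B.
Proof.
move=> uM AE BE; rewrite -(@ler_pXn2r _ 2) ?nnegrE ?riem_dist_ge0//.
rewrite (riem_dist_sq uM AE BE) (bigD1 i)//= -normrX ger0_norm ?sqr_ge0//.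
by rewrite lerDl; apply: sumr_ge0 => j _; rewrite sqr_ge0.
Qed.

Lemma det_diag_congr N (M : 'M[R]_N) (d : 'rV[R]_N) :
  \det (M^T *m diag_mx d *m M) = \det (M^T *m M) * \prod_i d 0 i.
Proof. by rewrite !det_mulmx det_diag mulrAC. Qed.

Lemma sum_ln_det N (A B : pdmx R N) (M : 'M[R]_N) (d : 'rV[R]_N) :
  (forall i, 0 < d 0 i) ->
  mx_of_pd A = M^T *m M -> mx_of_pd B = M^T *m diag_mx d *m M ->
  \sum_i ln (d 0 i) = ln (\det (mx_of_pd B)) - ln (\det (mx_of_pd A)).
Proof.
move=> d0 AE BE; rewrite BE det_diag_congr -AE lnM ?posrE ?prodr_gt0//; last first.
  exact: posdef_det (pdP A).
by rewrite ln_prod// addrC addKr.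
Qed.

(** The decreasing vector ln c is majorized by ln a + ln b, with equal total sums by the
    determinant. Summation by parts against ln c gives |ln c|^2 <= <ln c, ln a + ln b>;
    Cauchy-Schwarz and division by |ln c| conclude. *)
Lemma riem_dist_triangle N (B A C : pdmx R N) :
  riem_dist A C <= riem_dist A B + riem_dist B C.
Proof.
have [L [a [uL AL BL a0 ad]]] := pd_rep A B.
have [M [b [uM BM CM b0 bd]]] := pd_rep B C.
have [S [c [uS AS CS c0 cd]]] := pd_rep A C.
set x := riem_dist A C; set y := riem_dist A B; set w := riem_dist B C.
have xE : x ^+ 2 = \sum_i ln (c 0 i) ^+ 2 by exact: (riem_dist_sq uS AS CS).
have yE : y ^+ 2 = \sum_i ln (a 0 i) ^+ 2 by exact: (riem_dist_sq uL AL BL).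
have wE : w ^+ 2 = \sum_i ln (b 0 i) ^+ 2 by exact: (riem_dist_sq uM BM CM).
have [x0|x0] := leP x 0; first by apply: le_trans x0 _; rewrite addr_ge0 ?riem_dist_ge0.
pose z i := ln (a 0 i) + ln (b 0 i) - ln (c 0 i).
have z0 : \sum_i z i = 0.
  rewrite sumrB big_split /= (sum_ln_det a0 AL BL) (sum_ln_det b0 BM CM) (sum_ln_det c0 AS CS).
  by ring.
have : 0 <= \sum_i ln (c 0 i) * z i.
  (* Any lower bound on the ln c_i would do, as it gets multiplied by the total sum of z, which is
     0. *)
  have := @abel_ge0 R N (fun i => ln (c 0 i)) z (- x); rewrite z0 mulr0; apply.
  - by move=> i; have := ln_le_riem_dist i uS AS CS; rewrite ler_norml => /andP[].
  - by move=> i j ij; rewrite ler_ln ?posrE// cd.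
  - move=> k kN; rewrite sumrB subr_ge0.
    exact: (relative_log_major kN uM uL uS a0 b0 c0 ad bd AL BL BM CM AS CS).
have CS1 (u v : 'rV[R]_N) (p q : R) : 0 <= p -> 0 <= q ->
    p ^+ 2 = \sum_i ln (u 0 i) ^+ 2 -> q ^+ 2 = \sum_i ln (v 0 i) ^+ 2 ->
    \sum_i ln (u 0 i) * ln (v 0 i) <= p * q.
  move=> p0 q0 pE qE; apply: le_trans (ler_norm _) _.
  rewrite -(@ler_pXn2r _ 2) ?nnegrE ?mulr_ge0//.
  by rewrite -normrX ger0_norm ?sqr_ge0// exprMn pE qE sum_CS.
have -> : \sum_i ln (c 0 i) * z i =
    \sum_i ln (c 0 i) * ln (a 0 i) + \sum_i ln (c 0 i) * ln (b 0 i) - x ^+ 2.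
  by rewrite xE -big_split -sumrB; apply: eq_bigr => i _; rewrite /z /=; ring.
have := CS1 c a x y (riem_dist_ge0 _ _) (riem_dist_ge0 _ _) xE yE.
have := CS1 c b x w (riem_dist_ge0 _ _) (riem_dist_ge0 _ _) xE wE.
move=> h1 h2 h3; rewrite -(ler_pM2l x0) mulrDr -expr2; lra.
Qed.

Lemma invmx_unique N (A B : 'M[R]_N) : A *m B = 1%:M -> invmx A = B.
Proof. by move=> AB; have [uA _] := mulmx1_unit AB; rewrite -[B](mulKmx uA) AB mulmx1. Qed.

Lemma invmx_gram N (M : 'M[R]_N) : M \in unitmx ->
  invmx (M^T *m M) = (invmx M^T)^T *m invmx M^T.
Proof.
move=> uM; have uMT : M^T \in unitmx by rewrite unitmx_tr.
apply: invmx_unique; rewrite trmx_inv trmxK -!mulmxA mulKVmx// mulmxV//.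
Qed.

Lemma invmx_diag_gram N (M : 'M[R]_N) (d : 'rV[R]_N) : M \in unitmx ->
  (forall i, 0 < d 0 i) ->
  invmx (M^T *m diag_mx d *m M) =
  (invmx M^T)^T *m diag_mx (map_mx GRing.inv d) *m invmx M^T.
Proof.
move=> uM d0; have uMT : M^T \in unitmx by rewrite unitmx_tr.
apply: invmx_unique; rewrite trmx_inv trmxK -!mulmxA mulKVmx// [diag_mx d *m _]mulmxA.
have -> : diag_mx d *m diag_mx (map_mx GRing.inv d) = 1%:M.
  rewrite mulmx_diag -diag_const_mx; congr diag_mx; apply/rowP => i.
  by rewrite !mxE mulfV// gt_eqF.
by rewrite mul1mx mulmxV.
Qed.

Definition pd_inv N (A : pdmx R N) : pdmx R N := pd_of (posdef_inv (pdP A)).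

Lemma riem_dist_inv N (A B : pdmx R N) :
  riem_dist (pd_inv A) (pd_inv B) = riem_dist A B.
Proof.
have [M [d [uM AE BE d0 _]]] := pd_rep A B.
have uM' : invmx M^T \in unitmx by rewrite unitmx_inv unitmx_tr.
have AE' : mx_of_pd (pd_inv A) = (invmx M^T)^T *m invmx M^T.
  by rewrite /= pd_ofK AE invmx_gram.
have BE' : mx_of_pd (pd_inv B) =
    (invmx M^T)^T *m diag_mx (map_mx GRing.inv d) *m invmx M^T.
  by rewrite /= pd_ofK BE invmx_diag_gram.
rewrite (riem_distE uM' AE' BE') (riem_distE uM AE BE); congr Num.sqrt.
by apply: eq_bigr => i _; rewrite mxE lnV ?posrE// sqrrN.
Qed.

Lemma riem_dist_sym N (A B : pdmx R N) : riem_dist A B = riem_dist B A.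
Proof.
have [M [d [uM AE BE d0 _]]] := pd_rep A B.
pose s := map_mx Num.sqrt d; pose L := diag_mx s *m M.
have s0 i : s 0 i != 0 by rewrite mxE gt_eqF // sqrtr_gt0.
have uL : L \in unitmx.
  rewrite unitmx_mul uM andbT unitmxE unitfE det_diag; apply/prodf_neq0 => i _.
  exact: s0.
have BL : mx_of_pd B = L^T *m L.
  rewrite BE /L trmx_mul tr_diag_mx mulmxA -(mulmxA _ _ (diag_mx s)) mulmx_diag.
  congr (_ *m diag_mx _ *m _); apply/rowP => i; rewrite !mxE -expr2 sqr_sqrtr//.
  exact: ltW.
have AL : mx_of_pd A = L^T *m diag_mx (map_mx GRing.inv d) *m L.
  rewrite AE /L trmx_mul tr_diag_mx mulmxA -(mulmxA M^T) mulmx_diag.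
  rewrite -(mulmxA M^T) mulmx_diag -[X in X *m _]mulmx1 -diag_const_mx.
  congr (_ *m diag_mx _ *m _); apply/rowP => i; rewrite !mxE.
  have := sqr_sqrtr (ltW (d0 i)); have := s0 i; rewrite mxE.
  by set q := Num.sqrt _ => q0 <-; field.
rewrite (riem_distE uM AE BE) (riem_distE uL BL AL); congr Num.sqrt.
by apply: eq_bigr => i _; rewrite mxE lnV ?posrE// sqrrN.
Qed.

Lemma riem_distxx N (A : pdmx R N) : riem_dist A A = 0.
Proof.
have [M uM AE] := posdef_factor (pdP A).
rewrite (riem_distE (d := const_mx 1) uM AE) ?big1 ?sqrtr0//.
  by move=> i _; rewrite mxE ln1 expr0n.
by rewrite diag_const_mx mulmx1.
Qed.

Lemma det_riem_le N k (A B : pdmx R N) (V : 'M[R]_(N, k)) :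
  \det (V^T *m mx_of_pd B *m V) <=
  expR (k%:R * riem_dist A B) * \det (V^T *m mx_of_pd A *m V).
Proof.
have [M [d [uM AE BE d0 _]]] := pd_rep A B.
have -> : V^T *m mx_of_pd B *m V = (M *m V)^T *m diag_mx d *m (M *m V).
  by rewrite BE trmx_mul !mulmxA.
have -> : V^T *m mx_of_pd A *m V = (M *m V)^T *m (M *m V).
  by rewrite AE trmx_mul !mulmxA.
apply: det_gram_le => f _.
have -> : expR (k%:R * riem_dist A B) = \prod_(i < k) expR (riem_dist A B).
  by rewrite prodr_const card_ord -expRM_natl mulr_natl.
apply: ler_prod => i _; rewrite ltW//= -[leLHS]lnK ?posrE// ler_expR.
exact: le_trans (ler_norm _) (ln_le_riem_dist _ uM AE BE).
Qed.

Lemma quad_riem_le N (A B : pdmx R N) (x : 'cV[R]_N) :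
  (x^T *m mx_of_pd B *m x) 0 0 <=
  expR (riem_dist A B) * (x^T *m mx_of_pd A *m x) 0 0.
Proof. by have := det_riem_le A B x; rewrite !det_mx11 mul1r. Qed.

Lemma ln_dist1 (x : R) : `|x - 1| <= 2^-1 -> `|ln x| <= 2 * `|x - 1|.
Proof.
move=> x1; have x0 : 2^-1 <= x by move: x1; rewrite ler_norml => /andP[]; lra.
have xp : 0 < x by lra.
have h1 := le_ln1Dx (x := x - 1); have h2 := le_ln1Dx (x := x^-1 - 1).
have : ln x <= x - 1.
  by have := h1 ltac:(lra); rewrite addrC subrK.
have : - ln x <= x^-1 - 1.
  rewrite -lnV ?posrE//; have := h2 _; rewrite [1 + _]addrC subrK; apply.
  have : 0 < x^-1 by rewrite invr_gt0.
  by lra.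
have : x^-1 - 1 <= 2 * `|x - 1|.
  have -> : x^-1 - 1 = x^-1 * (1 - x) by field; lra.
  apply: le_trans (ler_norm _) _; rewrite normrM distrC ler_wpM2r//.
  by rewrite gtr0_norm ?invr_gt0// -[leRHS]invrK lef_pV2 ?posrE ?invr_gt0.
have : x - 1 <= 2 * `|x - 1|.
  by have := ler_norm (x - 1); have := normr_ge0 (x - 1); lra.
by rewrite ler_norml => *; lra.
Qed.

End Metric.

(** * Existence of Williamson's normal form *)

Section Williamson.
Variable R : realType.

Lemma symplJ_tr n : (symplJ R n)^T = - symplJ R n.
Proof. by rewrite /symplJ tr_block_mx opp_block_mx !trmx0 !oppr0 opprK linearN /= trmx1. Qed.

Lemma symplJ_sq n : symplJ R n *m symplJ R n = - 1%:M.
Proof.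
rewrite /symplJ mulmx_block !mul0mx !mulmx0 !add0r !addr0 mul1mx mulmx1.
by rewrite scalar_mx_block opp_block_mx !oppr0.
Qed.

Lemma symplJ_gram n : (symplJ R n)^T *m symplJ R n = 1%:M.
Proof. by rewrite symplJ_tr mulNmx symplJ_sq opprK. Qed.

Lemma symplJ_unit n : symplJ R n \in unitmx.
Proof. exact: (mulmx1_unit (symplJ_gram n)).2. Qed.

Lemma symplectic_tr n (S : 'M[R]_(n + n)) : symplectic S ->
  S *m symplJ R n *m S^T = symplJ R n.
Proof.
rewrite /symplectic => SJ.
have /mulmx1C : - S^T *m symplJ R n *m (S *m symplJ R n) = 1%:M.
  by rewrite mulmxA !mulNmx SJ symplJ_sq opprK.
rewrite !mulNmx mulmxN !mulmxA => /(congr1 (mulmx^~ (symplJ R n))).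
by rewrite mulNmx -(mulmxA _ (symplJ R n) (symplJ R n)) symplJ_sq mulmxN opprK mulmx1 mul1mx.
Qed.

Lemma symplectic_trV n (S : 'M[R]_(n + n)) : S *m symplJ R n *m S^T = symplJ R n ->
  symplectic S.
Proof.
by move=> SJ; have := @symplectic_tr n S^T; rewrite /symplectic trmxK; apply.
Qed.

Lemma symplectic_unit n (S : 'M[R]_(n + n)) : symplectic S -> S \in unitmx.
Proof.
move=> SJ; have := symplJ_unit n; rewrite -SJ -mulmxA unitmx_mul => /andP[_].
by rewrite unitmx_mul => /andP[].
Qed.

Lemma symplectic_det n (S : 'M[R]_(n + n)) : symplectic S -> \det S ^+ 2 = 1.
Proof.
move=> SJ; have J0 : \det (symplJ R n) != 0.
  by rewrite -unitfE -unitmxE symplJ_unit.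
have := congr1 determinant SJ; rewrite !det_mulmx det_tr mulrAC -expr2.
by rewrite -[RHS]mul1r => /(mulIf J0).
Qed.

(** m mutually orthogonal planes, each spanned by a row of [Q1] and the matching row of [Q2], on
    which K acts as d_i times a quarter turn. *)
Definition antisym_frame n m (K : 'M[R]_(n + n)) := exists (Q1 Q2 : 'M[R]_(m, n + n)) (d : 'rV[R]_m),
  [/\ forall i, 0 < d 0 i, [/\ Q1 *m Q1^T = 1%:M, Q2 *m Q2^T = 1%:M & Q1 *m Q2^T = 0],
   Q1 *m K = diag_mx d *m Q2 & Q2 *m K = - (diag_mx d *m Q1)].

(** The projection P on the complement of the planes found so far commutes with K, hence with K K^T
    = - K^2. A unit eigenvector u of K K^T in that complement and the normalized u K span a new
    plane. *)
Lemma antisym_frameS n m (K : 'M[R]_(n + n)) : K^T = - K -> K \in unitmx ->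
  (m < n)%N -> antisym_frame m K -> antisym_frame (1 + m) K.
Proof.
move=> aK uK mn [Q1 [Q2 [d [d0 [Q11 Q22 Q12] Q1K Q2K]]]].
have Q21 : Q2 *m Q1^T = 0 by rewrite -[LHS]trmxK trmx_mul trmxK Q12 trmx0.
have pT : posdef (K *m K^T).
  by rewrite -{1}[K]trmxK; apply: posdef_gram; rewrite unitmx_tr.
have [U [e [U1 TE e0]]] := posdef_spectral pT.
have [P PE] : exists P : 'M[R]_(n + n), P = 1%:M - Q1^T *m Q1 - Q2^T *m Q2 by eexists.
have KQ1 : K *m Q1^T = - (Q2^T *m diag_mx d).
  by apply: trmx_inj; rewrite trmx_mul trmxK aK mulmxN Q1K linearN/= trmx_mul trmxK tr_diag_mx.
have KQ2 : K *m Q2^T = Q1^T *m diag_mx d.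
  by apply: trmx_inj; rewrite trmx_mul trmxK aK mulmxN Q2K opprK trmx_mul trmxK tr_diag_mx.
have PK : P *m K = K *m P.
  rewrite PE !mulmxBl !mulmxBr mul1mx mulmx1 !mulmxA KQ1 KQ2 -!mulmxA Q1K Q2K.
  by rewrite mulmxN !mulNmx !mulmxA !opprK -!addrA; congr (_ + _); rewrite addrC.
have PT : P *m (K *m K^T) = K *m K^T *m P.
  by rewrite aK !mulmxN mulNmx mulmxA PK -!mulmxA PK.
(* The trace of P is 2n - 2m, which is nonzero. A nonzero row of U P is then an eigenvector of K K^T
   orthogonal to the previous planes. *)
have P0 : U *m P != 0.
  apply: contraTneq (mn) => UP0; have : \tr P = 0.
    by rewrite -[P]mul1mx -U1 -mulmxA UP0 mulmx0 linear0.
  rewrite PE !linearB /= mxtrace1 mxtrace_mulC Q11 mxtrace1 mxtrace_mulC Q22 mxtrace1.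
  rewrite -leqNgt -addrA -opprD => /eqP; rewrite subr_eq0 -natrD eqr_nat => /eqP.
  by rewrite !addnn => /double_inj ->.
have [i wi] : exists i, row i (U *m P) != 0.
  apply/existsP; apply: contraR P0; rewrite negb_exists => /forallP h.
  apply/eqP/row_matrixP => i; rewrite row0; apply/eqP.
  by have := h i; rewrite negbK.
have [w wE] : exists w, w = row i (U *m P) by eexists.
rewrite -wE in wi.
have tP : P^T = P by rewrite PE !linearB /= trmx1 !trmx_mul !trmxK.
have Q1P : Q1 *m P = 0.
  by rewrite PE !mulmxBr mulmx1 !mulmxA Q11 Q12 mul1mx mul0mx subrr subr0.
have Q2P : Q2 *m P = 0.
  by rewrite PE !mulmxBr mulmx1 !mulmxA Q22 Q21 mul1mx mul0mx subr0 subrr.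
have Q1w : Q1 *m w^T = 0 by rewrite wE row_mul trmx_mul mulmxA tP Q1P mul0mx.
have Q2w : Q2 *m w^T = 0 by rewrite wE row_mul trmx_mul mulmxA tP Q2P mul0mx.
have wT : w *m (K *m K^T) = e 0 i *: w.
  rewrite wE -row_mul -mulmxA PT TE !mulmxA (mulmx1C U1) mul1mx -mulmxA.
  by rewrite row_mul row_diag_mx -scalemxAl -rowE.
pose s := Num.sqrt ((w *m w^T) 0 0).
have w0 := dot_gt0 wi.
have s0 : 0 < s by rewrite sqrtr_gt0.
have [u uE] : exists u, u = s^-1 *: w by eexists.
have uu : u *m u^T = 1%:M.
  rewrite uE linearZ/= -scalemxAl -scalemxAr scalerA.
  apply/matrixP => j k; rewrite !ord1 mxE [RHS]mxE /=.
  have : s ^+ 2 = (w *m w^T) 0 0 by rewrite sqr_sqrtr ?ltW.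
  by move=> <-; rewrite expr2; field; rewrite gt_eqF.
have uT : u *m (K *m K^T) = e 0 i *: u by rewrite uE -scalemxAl wT scalerA mulrC -scalerA.
have Q1u : Q1 *m u^T = 0 by rewrite uE linearZ/= -scalemxAr Q1w scaler0.
have Q2u : Q2 *m u^T = 0 by rewrite uE linearZ/= -scalemxAr Q2w scaler0.
pose l := Num.sqrt (e 0 i).
have l0 : 0 < l by rewrite sqrtr_gt0.
have l2 : l ^+ 2 = e 0 i by rewrite sqr_sqrtr ?ltW.
(* Since l^2 is the eigenvalue of K K^T at u, this v is a unit vector and v K = - l u. *)
have [v vE] : exists v, v = l^-1 *: (u *m K) by eexists.
have uK' : u *m K = l *: v by rewrite vE scalerA mulfV ?scale1r// gt_eqF.
have vK : v *m K = - (l *: u).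
  have : u *m (K *m K) = - (e 0 i *: u) by rewrite -uT aK !mulmxN opprK.
  rewrite mulmxA uK' -scalemxAl -l2 expr2 -scalerA -scalerN => /(congr1 (fun x => l^-1 *: x)).
  by rewrite !scalerA mulVf ?gt_eqF// !scale1r.
have vv : v *m v^T = 1%:M.
  rewrite vE linearZ/= trmx_mul -scalemxAl -scalemxAr scalerA mulmxA -(mulmxA u) uT.
  rewrite -scalemxAl uu scalerA -l2 expr2.
  have -> : l^-1 * l^-1 * (l * l) = 1 by field; rewrite gt_eqF.
  by rewrite scale1r.
have uv : u *m v^T = 0.
  apply/matrixP => j k; rewrite !ord1.
  have : u *m v^T = - (u *m v^T).
    rewrite {1}vE linearZ/= trmx_mul -scalemxAr aK mulNmx mulmxN.
    rewrite -[u *m _ as X in _ = - X]mx11_tr trmx_mul trmxK.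
    by rewrite vE -scalemxAl -mulmxA scalerN.
  move=> /matrixP/(_ 0 0); rewrite !mxE; lra.
have Qv (Q Q' : 'M[R]_(m, n + n)) (D : 'M[R]_m) : Q *m K = D *m Q' -> Q' *m u^T = 0 -> Q *m v^T = 0.
  move=> QK Q'u; rewrite vE linearZ/= trmx_mul -scalemxAr aK mulNmx mulmxN mulmxA QK.
  by rewrite -mulmxA Q'u mulmx0 oppr0 scaler0.
have Q1v : Q1 *m v^T = 0 by exact: Qv Q1K Q2u.
have Q2v : Q2 *m v^T = 0.
  by apply: (Qv _ Q1 (- diag_mx d)) => //; rewrite mulNmx.
have flip (Q : 'M[R]_(m, n + n)) (x : 'rV[R]_(n + n)) : Q *m x^T = 0 -> x *m Q^T = 0.
  by move=> h; rewrite -[LHS]trmxK trmx_mul trmxK h trmx0.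
exists (col_mx u Q1), (col_mx v Q2), (row_mx l%:M d); split.
- move=> j; rewrite mxE; case: splitP => k _; last exact: d0.
  by rewrite !ord1 mxE mulr1n.
- rewrite !tr_col_mx !mul_col_row uu vv uv Q11 Q22 Q12 Q1u Q2v Q1v !flip// -!scalar_mx_block.
  by split=> //; rewrite block_mx0.
- rewrite mul_col_mx diag_mx_row mul_block_col !mul0mx addr0 add0r Q1K uK'.
  by congr col_mx; rewrite -mul_scalar_mx; congr (_ *m _); apply/matrixP => j k; rewrite !mxE !ord1.
- rewrite mul_col_mx diag_mx_row mul_block_col !mul0mx addr0 add0r Q2K vK opp_col_mx.
  by congr col_mx; congr (- _); rewrite -mul_scalar_mx; congr (_ *m _); apply/matrixP => j k; rewrite !mxE !ord1.
Qed.

Lemma antisym_frame_full n (K : 'M[R]_(n + n)) : K^T = - K -> K \in unitmx ->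
  antisym_frame n K.
Proof.
move=> aK uK; suff : forall m, (m <= n)%N -> antisym_frame m K by apply.
elim=> [_|m IH mn]; last by apply: antisym_frameS => //; apply: IH; exact: ltnW.
by exists 0, 0, 0; split=> [[]//|||]; [split| |]; apply/matrixP => -[].
Qed.

(** With A = L^T L, the matrix K = L J L^T is antisymmetric and invertible, and an orthogonal Q
    brings it to the block form with c and -c off the diagonal. Rescaling both halves by c^-1/2
    turns Q L into a matrix M with M J M^T = J, and M^T diag(c, c) M = L^T Q^T Q L = A. *)
Lemma williamson_ex n (A : 'M[R]_(n + n)) : posdef A -> exists d, williamson A d.
Proof.
move=> /posdef_factor[L uL AE].
pose K := L *m symplJ R n *m L^T.
have aK : K^T = - K by rewrite trmxMM trmxK symplJ_tr mulmxN mulNmx.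
have uK : K \in unitmx by rewrite !unitmx_mul unitmx_tr uL symplJ_unit.
have [Q1 [Q2 [d [d0 [Q11 Q22 Q12] Q1K Q2K]]]] := antisym_frame_full aK uK.
have Q21 : Q2 *m Q1^T = 0 by rewrite -[LHS]trmxK trmx_mul trmxK Q12 trmx0.
(* Negated because [sorting_perm] sorts decreasingly, whereas a Williamson form lists its values
   increasingly. *)
have [p pd] := sorting_perm (fun i => - d 0 i).
pose c : 'rV[R]_n := \row_i d 0 (p i).
pose s : 'rV[R]_n := \row_i (Num.sqrt (c 0 i))^-1.
have c0 i : 0 < c 0 i by rewrite mxE.
have sc : diag_mx s *m diag_mx c *m diag_mx s = 1%:M.
  rewrite !mulmx_diag -diag_const_mx; congr diag_mx; apply/rowP => i.
  have := sqr_sqrtr (ltW (c0 i)); rewrite !mxE; set q := Num.sqrt _ => <-.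
  by field; rewrite gt_eqF// /q sqrtr_gt0.
have [P P1] : exists2 P : 'M[R]_n, P *m P^T = 1%:M & P *m diag_mx d *m P^T = diag_mx c.
  exists (perm_mx p); first by rewrite tr_perm_mx -perm_mxM mulgV perm_mx1.
  have -> : perm_mx p *m diag_mx d = diag_mx c *m perm_mx p.
    rewrite mul_diag_mx mul_mx_diag; apply/matrixP => i j; rewrite !mxE.
    by case: eqP => [->|]; rewrite ?mulr1 ?mul1r// mulr0 mul0r.
  by rewrite -mulmxA tr_perm_mx -perm_mxM mulgV perm_mx1 mulmx1.
have cm (i j : 'I_n) : (i <= j)%N -> c 0 i <= c 0 j.
  by move=> ij; have := pd i j ij; rewrite lerN2 !mxE.
move=> Pd; clearbody s c.
pose D := diag_mx s.
have tD : D^T = D by exact: tr_diag_mx.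
pose Q := col_mx (P *m Q1) (P *m Q2).
have QQ : Q *m Q^T = 1%:M.
  rewrite /Q tr_col_mx mul_col_row !trmx_mul.
  have h (X Y : 'M[R]_(n, n + n)) : P *m X *m (Y^T *m P^T) = P *m (X *m Y^T) *m P^T.
    by rewrite !mulmxA.
  by rewrite !h Q11 Q12 Q21 Q22 !mulmx0 mulmx1 P1 mul0mx -scalar_mx_block.
have QK : Q *m K *m Q^T = block_mx 0 (diag_mx c) (- diag_mx c) 0.
  rewrite /Q tr_col_mx mul_col_mx mul_col_row !trmx_mul -!(mulmxA P) Q1K Q2K.
  have h (X Y : 'M[R]_(n, n + n)) (E : 'M[R]_n) :
      P *m (E *m X *m (Y^T *m P^T)) = P *m E *m (X *m Y^T) *m P^T.
    by rewrite !mulmxA.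
  by rewrite !mulNmx !mulmxN !h Q11 Q12 Q21 Q22 !mulmx0 mulmx1 Pd mul0mx oppr0.
have [D2 D2E] : exists D2 : 'M[R]_(n + n), D2 = block_mx D 0 0 D by eexists.
have tD2 : D2^T = D2 by rewrite D2E tr_block_mx !trmx0 tD.
exists c; split=> //.
exists (D2 *m Q *m L).
  apply: symplectic_trV.
  have -> : D2 *m Q *m L *m symplJ R n *m (D2 *m Q *m L)^T = D2 *m (Q *m K *m Q^T) *m D2.
    by rewrite !trmx_mul tD2 /K !mulmxA.
  rewrite QK D2E !mulmx_block !mul0mx !mulmx0 !addr0 !add0r mulmxN mulNmx.
  by rewrite sc !mul0mx.
have QQ' := mulmx1C QQ.
have -> : (D2 *m Q *m L)^T *m block_mx (diag_mx c) 0 0 (diag_mx c) *m (D2 *m Q *m L)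
  = L^T *m Q^T *m (D2 *m block_mx (diag_mx c) 0 0 (diag_mx c) *m D2) *m Q *m L.
  by rewrite !trmx_mul tD2 !mulmxA.
rewrite D2E !mulmx_block !mul0mx !mulmx0 !addr0 !add0r sc !mul0mx -scalar_mx_block mulmx1.
by rewrite -(mulmxA L^T) QQ' mulmx1.
Qed.

End Williamson.

(** * Products of the largest symplectic eigenvalues and their extremal characterization *)

Section SymplecticProducts.
Variable R : realType.

Lemma dhatP n (A : pdmx R (n + n)) :
  exists2 d, williamson (mx_of_pd A) d & row_of_pos (dhat A) = double_rev d.
Proof.
have [d wd] := williamson_ex (pdP A).
have pd : posrow_set (double_rev d) by move=> i; rewrite mxE; case: wd => + _ _; apply.
apply: (@getPex _ [set v : posrow R (n + n) |
  exists2 d, williamson (mx_of_pd A) d & row_of_pos v = double_rev d]).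
by exists (exist (fun a => a \in @posrow_set R (n + n)) _ (mem_set pd)), d.
Qed.

(** The vector is chosen jointly with its relation to [dhat], so that both refer to the same
    Williamson form. *)
Definition symp_eig n (A : pdmx R (n + n)) : 'rV[R]_n :=
  get [set d | williamson (mx_of_pd A) d /\ row_of_pos (dhat A) = double_rev d].

Lemma symp_eig_spec n (A : pdmx R (n + n)) :
  williamson (mx_of_pd A) (symp_eig A) /\ row_of_pos (dhat A) = double_rev (symp_eig A).
Proof.
by have [d wd dE] := dhatP A; apply: (@getPex _ [set d |
  williamson (mx_of_pd A) d /\ row_of_pos (dhat A) = double_rev d]); exists d.
Qed.

Lemma symp_eigP n (A : pdmx R (n + n)) : williamson (mx_of_pd A) (symp_eig A).
Proof. by case: (symp_eig_spec A). Qed.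

Lemma dhatE n (A : pdmx R (n + n)) : row_of_pos (dhat A) = double_rev (symp_eig A).
Proof. by case: (symp_eig_spec A). Qed.

Lemma symp_eig_gt0 n (A : pdmx R (n + n)) i : 0 < symp_eig A 0 i.
Proof. by have [+ _ _] := symp_eigP A. Qed.

(** Symplectic eigenvalues increase with the index, so the m largest sit at the last m positions. *)
Definition top_idx n m (mn : (m <= n)%N) (j : 'I_m) : 'I_n := rev_ord (widen_ord mn j).

Lemma top_idx_inj n m (mn : (m <= n)%N) : injective (top_idx mn).
Proof. by move=> i j /rev_ord_inj /widen_ord_inj. Qed.

(** In the doubled vector (d, d) the m largest values of d occur once in each half, which gives 2m
    positions. *)
Definition top2 n m (mn : (m <= n)%N) (j : 'I_(m + m)) : 'I_(n + n) :=
  match fintype.split j with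
  | inl j => lshift n (top_idx mn j)
  | inr j => rshift n (top_idx mn j)
  end.

Lemma top2_lshift n m (mn : (m <= n)%N) j : top2 mn (lshift m j) = lshift n (top_idx mn j).
Proof. by rewrite /top2; case: split_ordP => k => [/lshift_inj->|/eqP]; rewrite ?eq_lrshift. Qed.

Lemma top2_rshift n m (mn : (m <= n)%N) j : top2 mn (rshift m j) = rshift n (top_idx mn j).
Proof. by rewrite /top2; case: split_ordP => k => [/eqP|/rshift_inj->]; rewrite ?eq_rlshift. Qed.

Lemma top2_inj n m (mn : (m <= n)%N) : injective (top2 mn).
Proof.
move=> i j; case: (split_ordP i) => i' ->; case: (split_ordP j) => j' ->;
  rewrite ?top2_lshift ?top2_rshift.
- by move=> /lshift_inj /top_idx_inj ->.
- by move/eqP; rewrite eq_lrshift.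
- by move/eqP; rewrite eq_rlshift.
- by move=> /rshift_inj /top_idx_inj ->.
Qed.

Definition symp_prod n m (mn : (m <= n)%N) (A : pdmx R (n + n)) : R :=
  \prod_(j < m) symp_eig A 0 (top_idx mn j).

Lemma symp_prod_gt0 n m (mn : (m <= n)%N) (A : pdmx R (n + n)) : 0 < symp_prod mn A.
Proof. by apply: prodr_gt0 => j _; exact: symp_eig_gt0. Qed.

Lemma prod_top2 n m (mn : (m <= n)%N) (d : 'rV[R]_n) :
  \prod_j (row_mx d d) 0 (top2 mn j) = (\prod_(j < m) d 0 (top_idx mn j)) ^+ 2.
Proof.
rewrite big_split_ord /= expr2; congr (_ * _); apply: eq_bigr => j _.
  by rewrite top2_lshift row_mxEl.
by rewrite top2_rshift row_mxEr.
Qed.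

Lemma top2_max n m (mn : (m <= n)%N) (d : 'rV[R]_n) :
  (forall i j : 'I_n, (i <= j)%N -> d 0 i <= d 0 j) ->
  forall i j, i \notin codom (top2 mn) -> (row_mx d d) 0 i <= (row_mx d d) 0 (top2 mn j).
Proof.
move=> dm i j it.
have [k kE] : exists k : 'I_m, (row_mx d d) 0 (top2 mn j) = d 0 (top_idx mn k).
  case: (split_ordP j) => k ->; exists k; first by rewrite top2_lshift row_mxEl.
  by rewrite top2_rshift row_mxEr.
rewrite kE; have h (l : 'I_n) : l \notin codom (top_idx mn) -> d 0 l <= d 0 (top_idx mn k).
  move=> lt; apply: dm => /=; rewrite leqNgt; apply: contra lt => lk.
  have rl : (rev_ord l < m)%N by have := ltn_ord k; have := ltn_ord l; move: lk => /=; lia.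
  apply/codomP; exists (Ordinal rl); apply/val_inj => /=.
  by have := ltn_ord l; lia.
case: (split_ordP i) it => l -> lt; rewrite ?row_mxEl ?row_mxEr; apply: h;
  apply: contra lt => /codomP[q ->]; apply/codomP.
  by exists (lshift m q); rewrite top2_lshift.
by exists (rshift m q); rewrite top2_rshift.
Qed.

Lemma frame_top2 n m (mn : (m <= n)%N) : frame R (top2 mn) =
  block_mx (frame R (top_idx mn)) 0 0 (frame R (top_idx mn)).
Proof.
apply/matrixP => i j; rewrite [LHS]mxE [LHS]mxE.
case: (split_ordP i) => i' ->; case: (split_ordP j) => j' ->;
  rewrite ?top2_lshift ?top2_rshift ?block_mxEul ?block_mxEur ?block_mxEdl ?block_mxEdr
    !mxE ?eq_lshift ?eq_rshift ?eq_lrshift ?eq_rlshift //.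
Qed.

Lemma symplJ_frame n m (mn : (m <= n)%N) :
  symplJ R n *m frame R (top2 mn) = frame R (top2 mn) *m symplJ R m.
Proof.
rewrite frame_top2 /symplJ !mulmx_block !mul0mx !mulmx0 !addr0 !add0r.
by rewrite !mulmx1 !mul1mx mulNmx mulmxN mul1mx mulmx1.
Qed.

Lemma symplJ_diag n (d : 'rV[R]_n) :
  symplJ R n *m diag_mx (row_mx d d) = diag_mx (row_mx d d) *m symplJ R n.
Proof.
rewrite diag_mx_row /symplJ !mulmx_block !mul0mx !mulmx0 !addr0 !add0r.
by rewrite !mulmx1 !mul1mx mulNmx mulmxN mul1mx mulmx1.
Qed.

Lemma symplJ_det n : \det (symplJ R n) ^+ 2 = 1.
Proof. by have := congr1 determinant (symplJ_gram R n); rewrite det_mulmx det_tr det1. Qed.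

Lemma symp_frame n (A : pdmx R (n + n)) : exists S : 'M[R]_(n + n),
  [/\ S \in unitmx, S *m symplJ R n *m S^T = symplJ R n, \det S ^+ 2 = 1 &
   mx_of_pd A = S^T *m diag_mx (row_mx (symp_eig A) (symp_eig A)) *m S].
Proof.
have [_ _ [S SJ AE]] := symp_eigP A.
exists S; split; [exact: symplectic_unit|exact: symplectic_tr|exact: symplectic_det|].
by rewrite diag_mx_row.
Qed.

Lemma row_mx_gt0 n (d : 'rV[R]_n) : (forall i, 0 < d 0 i) -> forall i, 0 < (row_mx d d) 0 i.
Proof. by move=> d0 i; rewrite mxE; case: splitP. Qed.

(* The doubled squares of the symplectic eigenvalues of [A] are the
   eigenvalues of [J^T A J] relative to [A^-1]. *)
Lemma symp_pair n (A : pdmx R (n + n)) : exists N : 'M[R]_(n + n),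
  [/\ N \in unitmx, invmx (mx_of_pd A) = N^T *m N &
   (symplJ R n)^T *m mx_of_pd A *m symplJ R n =
   N^T *m diag_mx (map_mx (fun x => x ^+ 2) (row_mx (symp_eig A) (symp_eig A))) *m N].
Proof.
have [S [uS SJ _ AE]] := symp_frame A.
have := row_mx_gt0 (symp_eig_gt0 A).
have := symplJ_diag (symp_eig A); move: AE.
set d := row_mx _ _ => AE Jd d0; clearbody d.
pose s : 'rV[R]_(n + n) := \row_i Num.sqrt (d 0 i)^-1.
have s0 i : s 0 i != 0 by rewrite mxE gt_eqF // sqrtr_gt0 invr_gt0.
have s2 i : s 0 i * s 0 i = (d 0 i)^-1.
  by rewrite mxE -expr2 sqr_sqrtr// invr_ge0 ltW.
have uST : S^T \in unitmx by rewrite unitmx_tr.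
exists (diag_mx s *m invmx S^T); split.
- rewrite unitmx_mul unitmx_inv uST andbT unitmxE unitfE det_diag.
  by apply/prodf_neq0 => i _.
- rewrite AE invmx_diag_gram// trmx_mul tr_diag_mx [RHS]mulmxA.
  rewrite -[X in _ = X *m _]mulmxA mulmx_diag; congr (_ *m diag_mx _ *m _).
  by apply/rowP => i; rewrite [LHS]mxE [RHS]mxE s2.
(* Since S J = J S^-T and J commutes with diag(d, d), the form J^T A J equals S^-1 diag(d, d) S^-T,
   while A^-1 is S^-1 diag(d, d)^-1 S^-T. *)
- have SJ' : S *m symplJ R n = symplJ R n *m invmx S^T by rewrite -[in RHS]SJ mulmxK.
  have -> : (symplJ R n)^T *m mx_of_pd A *m symplJ R n =
      (S *m symplJ R n)^T *m diag_mx d *m (S *m symplJ R n).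
    by rewrite AE trmx_mul !mulmxA.
  rewrite SJ' !trmx_mul tr_diag_mx; set Y := invmx S^T.
  have -> : Y^T *m (symplJ R n)^T *m diag_mx d *m (symplJ R n *m Y) =
      Y^T *m ((symplJ R n)^T *m (diag_mx d *m symplJ R n)) *m Y by rewrite !mulmxA.
  rewrite -Jd mulmxA symplJ_gram mul1mx.
  have -> (D : 'M[R]_(n + n)) : Y^T *m diag_mx s *m D *m (diag_mx s *m Y) =
      Y^T *m (diag_mx s *m D *m diag_mx s) *m Y by rewrite !mulmxA.
  rewrite !mulmx_diag; congr (_ *m diag_mx _ *m _).
  apply/rowP => i; rewrite !mxE; have := s2 i; rewrite mxE => h.
  by rewrite mulrAC h expr2 mulrA mulVf ?mul1r// gt_eqF.
Qed.

Lemma sq_mono (x y : R) : 0 <= x -> x <= y -> x ^+ 2 <= y ^+ 2.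
Proof. by move=> x0 xy; rewrite ler_pXn2r// nnegrE// (le_trans x0). Qed.

Lemma prod_top2_sq n m (mn : (m <= n)%N) (A : pdmx R (n + n)) :
  \prod_j (map_mx (fun x => x ^+ 2) (row_mx (symp_eig A) (symp_eig A))) 0 (top2 mn j)
  = symp_prod mn A ^+ 4.
Proof.
by under eq_bigr do rewrite mxE; rewrite prodrXl prod_top2 -exprM.
Qed.

(** The extremal principle for the pair of [symp_pair]. The exponent 4 combines the squares of the
    d_i with their double occurrence. *)
Lemma symp_prod_le n m (mn : (m <= n)%N) (A : pdmx R (n + n)) (V : 'M[R]_(n + n, m + m)) :
  \det (V^T *m ((symplJ R n)^T *m mx_of_pd A *m symplJ R n) *m V) <=
  symp_prod mn A ^+ 4 * \det (V^T *m invmx (mx_of_pd A) *m V).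
Proof.
have [N [uN -> ->]] := symp_pair A; rewrite -prod_top2_sq.
have d0 := row_mx_gt0 (symp_eig_gt0 A).
apply: pair_det_le; first by move=> i; rewrite mxE sqr_ge0.
- exact: top2_inj.
- move=> i j it; rewrite [leLHS]mxE [leRHS]mxE sq_mono ?(ltW (d0 _))//.
  by have [_ dm _] := symp_eigP A; exact: top2_max dm _ _ it.
Qed.

Lemma symp_prod_attained n m (mn : (m <= n)%N) (A : pdmx R (n + n)) :
  exists V : 'M[R]_(n + n, m + m), V^T *m invmx (mx_of_pd A) *m V = 1%:M /\
  \det (V^T *m ((symplJ R n)^T *m mx_of_pd A *m symplJ R n) *m V) = symp_prod mn A ^+ 4.
Proof.
have [N [uN -> ->]] := symp_pair A; rewrite -prod_top2_sq.
exact: pair_det_attained uN (top2_inj (mn := mn)).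
Qed.

(** The top Williamson directions of A span a space of dimension 2m that is invariant under A J,
    since A J S^T E = S^T diag(d, d) J E. On it A J acts by diag times J_m, of determinant s_m(A)^2
    up to sign. *)
Lemma symp_prod_invariant n m (mn : (m <= n)%N) (A : pdmx R (n + n)) :
  exists (U : 'M[R]_(n + n, m + m)) (B : 'M[R]_(m + m)),
  [/\ mx_of_pd A *m symplJ R n *m U = U *m B, \det B ^+ 2 = symp_prod mn A ^+ 4 &
      forall C : pdmx R (n + n), 0 < \det (U^T *m mx_of_pd C *m U)].
Proof.
have [S [uS SJ _ AE]] := symp_frame A.
set d := row_mx _ _ in AE.
exists (S^T *m frame R (top2 mn)), (diag_mx (\row_j d 0 (top2 mn j)) *m symplJ R m); split.
- have -> : mx_of_pd A *m symplJ R n *m (S^T *m frame R (top2 mn)) =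
    S^T *m (diag_mx d *m (S *m symplJ R n *m S^T *m frame R (top2 mn))).
    by rewrite AE !mulmxA.
  rewrite SJ symplJ_frame -[RHS]mulmxA; congr (S^T *m _); rewrite !mulmxA; congr (_ *m _).
  rewrite mul_mx_diag mul_diag_mx; apply/matrixP => i j; rewrite !mxE.
  by case: eqP => [->|]; rewrite ?mulr1 ?mul1r ?mulr0 ?mul0r.
- rewrite det_mulmx exprMn symplJ_det mulr1 det_diag.
  by under eq_bigr do rewrite mxE; rewrite prod_top2 -exprM.
- move=> C; have uST : invmx S^T \in unitmx by rewrite unitmx_inv unitmx_tr.
  (* U is orthonormal for the form S^-1 S^-T, and its Gram determinant for C is comparable to the
     one for that form. *)
  have := det_riem_le C (pd_of (posdef_gram uST)) (S^T *m frame R (top2 mn)).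
  rewrite pd_ofK.
  have -> : (S^T *m frame R (top2 mn))^T *m ((invmx S^T)^T *m invmx S^T) *m (S^T *m frame R (top2 mn)) = 1%:M.
    rewrite trmx_mul trmxK trmx_inv trmxK -!mulmxA mulKVmx//.
    by rewrite mulKmx ?unitmx_tr// frame_gram//; exact: top2_inj.
  rewrite det1 => h; have := lt_le_trans (ltr01) h.
  by rewrite pmulr_rgt0// expR_gt0.
Qed.

(* The hypothesis says that [G] is the geodesic midpoint of [A] and [B]. *)
Lemma symp_prod_midpoint n m (mn : (m <= n)%N) (A B G : pdmx R (n + n)) :
  mx_of_pd B = mx_of_pd G *m invmx (mx_of_pd A) *m mx_of_pd G ->
  symp_prod mn G ^+ 2 <= symp_prod mn A * symp_prod mn B.
Proof.
move=> BE; have [U [X [GU X2 U0]]] := symp_prod_invariant mn G.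
have h1 := symp_prod_le mn A U.
(* As B = G A^-1 G, the form B^-1 on G J U is J^T A J on U, the left side of [h1]. Since G J maps U
   to U X, the form J^T B J on G J U is A^-1 on U X^2. Chaining the two bounds leaves det X ^ 4 =
   s_m(G)^8 against s_m(A)^4 s_m(B)^4. *)
have h2 := symp_prod_le mn B (mx_of_pd G *m symplJ R n *m U).
have uG := posdef_unit (pdP G); have uA := posdef_unit (pdP A).
have sG := (pdP G).1; have sJ := symplJ_tr R n.
have BV : invmx (mx_of_pd B) = invmx (mx_of_pd G) *m mx_of_pd A *m invmx (mx_of_pd G).
  apply: invmx_unique; rewrite BE -!mulmxA mulKVmx// mulKmx//.
  by rewrite mulmxV.
have E1 : (mx_of_pd G *m symplJ R n *m U)^T *m invmx (mx_of_pd B) *m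
    (mx_of_pd G *m symplJ R n *m U) =
    U^T *m ((symplJ R n)^T *m mx_of_pd A *m symplJ R n) *m U.
  rewrite BV !trmx_mul sG -!mulmxA (mulmxA (invmx (mx_of_pd G)) (mx_of_pd G)) mulVmx// mul1mx.
  by rewrite mulKVmx.
have E2 : (mx_of_pd G *m symplJ R n *m U)^T *m ((symplJ R n)^T *m mx_of_pd B *m symplJ R n) *m
    (mx_of_pd G *m symplJ R n *m U) =
    (X *m X)^T *m (U^T *m invmx (mx_of_pd A) *m U) *m (X *m X).
  have -> : (mx_of_pd G *m symplJ R n *m U)^T *m ((symplJ R n)^T *m mx_of_pd B *m symplJ R n) *m
    (mx_of_pd G *m symplJ R n *m U) =
    (mx_of_pd G *m symplJ R n *m (mx_of_pd G *m symplJ R n *m U))^T *m invmx (mx_of_pd A)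
    *m (mx_of_pd G *m symplJ R n *m (mx_of_pd G *m symplJ R n *m U)).
    by rewrite BE !trmx_mul sG !mulmxA.
  by rewrite GU [_ *m (U *m X)]mulmxA GU -(mulmxA U) trmx_mul !mulmxA.
rewrite E1 E2 in h2; clear E1 E2.
have a0 := symp_prod_gt0 mn A; have b0 := symp_prod_gt0 mn B; have g0 := symp_prod_gt0 mn G.
pose x := \det (U^T *m invmx (mx_of_pd A) *m U).
have x0 : 0 < x := U0 (pd_inv A).
rewrite -/x in h1.
have h3 : symp_prod mn G ^+ 8 * x <= (symp_prod mn A * symp_prod mn B) ^+ 4 * x.
  have -> : symp_prod mn G ^+ 8 * x = \det ((X *m X)^T *m (U^T *m invmx (mx_of_pd A) *m U) *m (X *m X)).
    rewrite !det_mulmx det_tr det_mulmx -/x.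
    have -> : symp_prod mn G ^+ 8 = \det X ^+ 4 by rewrite (exprM _ 4 2) -X2 -exprM.
    by rewrite -/x; ring.
  apply: le_trans h2 _; 
  have -> : (symp_prod mn A * symp_prod mn B) ^+ 4 * x =
    symp_prod mn B ^+ 4 * (symp_prod mn A ^+ 4 * x) by ring.
  by rewrite ler_pM2l ?exprn_gt0.
by move: h3; rewrite ler_pM2r// (exprM _ 2 4) ler_pXn2r ?nnegrE ?exprn_ge0 ?mulr_ge0 ?(ltW a0) ?(ltW b0) ?(ltW g0)//.
Qed.

(** At the extremal frame of B, replacing B by A in J^T B J and A^-1 by B^-1 costs a factor exp(2m
    delta) each, which is the fourth power of exp(m delta); inversion preserves the distance. *)
Lemma symp_prod_lip n m (mn : (m <= n)%N) (A B : pdmx R (n + n)) :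
  symp_prod mn B <= expR (m%:R * riem_dist A B) * symp_prod mn A.
Proof.
have [V [V1 VB]] := symp_prod_attained mn B.
have h1 := symp_prod_le mn A V.
have h2 := det_riem_le A B (symplJ R n *m V).
have h3 := det_riem_le (pd_inv B) (pd_inv A) V.
move: h3; rewrite riem_dist_inv riem_dist_sym !pd_ofK V1 det1 mulr1 => h3.
have E (C : 'M[R]_(n + n)) : (symplJ R n *m V)^T *m C *m (symplJ R n *m V) =
    V^T *m ((symplJ R n)^T *m C *m symplJ R n) *m V by rewrite trmx_mul !mulmxA.
move: h2; rewrite !E VB => h2.
have a0 := symp_prod_gt0 mn A; have b0 := symp_prod_gt0 mn B.
set e := expR (m%:R * _).
have ee : expR ((m + m)%:R * riem_dist A B) = e ^+ 2.
  by rewrite /e -expRM_natl; congr expR; rewrite natrD; ring.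
rewrite ee in h2 h3.
have e0 : 0 < e by exact: expR_gt0.
rewrite -(@ler_pXn2r _ 4) ?nnegrE ?mulr_ge0 ?(ltW a0) ?(ltW b0) ?(ltW e0)// exprMn.
apply: le_trans h2 _; have -> a : e ^+ 4 * a = e ^+ 2 * (e ^+ 2 * a) by ring.
rewrite ler_pM2l ?exprn_gt0//.
apply: le_trans h1 _; rewrite mulrC ler_pM2r ?exprn_gt0//.
Qed.

Lemma symp_prod_det n (A : pdmx R (n + n)) :
  symp_prod (leqnn n) A ^+ 2 = \det (mx_of_pd A).
Proof.
have [S [_ _ S2 ->]] := symp_frame A.
rewrite !det_mulmx det_tr mulrAC -expr2 S2 mul1r det_diag big_split_ord /= expr2.
have h : \prod_(j < n) symp_eig A 0 j = symp_prod (leqnn n) A.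
  rewrite (reindex_inj rev_ord_inj) /=; apply: eq_bigr => j _.
  by congr (_ 0 _); apply/val_inj.
by rewrite -h; congr (_ * _); apply: eq_bigr => j _; rewrite ?row_mxEl ?row_mxEr.
Qed.

(** With A^-1 = N^T N, write W^T J V = (N W)^T (N^-T J V). Cauchy-Schwarz for determinants leaves
    the Gram matrix V^T J^T A J V, which [symp_prod_le] bounds. *)
Lemma symp_prod_pairing n m (mn : (m <= n)%N) (A : pdmx R (n + n)) (W V : 'M[R]_(n + n, m + m)) :
  \det (W^T *m symplJ R n *m V) ^+ 2 <= symp_prod mn A ^+ 4 *
    (\det (W^T *m invmx (mx_of_pd A) *m W) * \det (V^T *m invmx (mx_of_pd A) *m V)).
Proof.
have [N uN AE] := posdef_factor (posdef_inv (pdP A)).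
have uNT : N^T \in unitmx by rewrite unitmx_tr.
have AE' : mx_of_pd A = invmx N *m (invmx N)^T.
  rewrite -[mx_of_pd A]invmxK AE invmx_gram// trmx_inv trmxK.
  by rewrite trmx_inv.
have -> : W^T *m symplJ R n *m V = (N *m W)^T *m ((invmx N)^T *m symplJ R n *m V).
  by rewrite trmx_mul -!mulmxA trmx_inv mulKVmx.
apply: le_trans (det_CS _ _) _.
have -> : (N *m W)^T *m (N *m W) = W^T *m invmx (mx_of_pd A) *m W.
  by rewrite AE trmx_mul !mulmxA.
have -> : ((invmx N)^T *m symplJ R n *m V)^T *m ((invmx N)^T *m symplJ R n *m V) =
   V^T *m ((symplJ R n)^T *m mx_of_pd A *m symplJ R n) *m V.
  by rewrite AE' !trmx_mul trmxK !mulmxA.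
rewrite mulrCA; apply: ler_wpM2l; last exact: symp_prod_le.
have -> : W^T *m invmx (mx_of_pd A) *m W = (N *m W)^T *m (N *m W).
  by rewrite AE trmx_mul !mulmxA.
exact: det_gram_ge0.
Qed.

End SymplecticProducts.

(** * Geodesics, convexity of ln s_m and its subgradient *)

Section Geodesics.
Variable R : realType.

(* Iterating midpoint convexity halves the bound at each step, so no
   continuity is needed to reach real parameters. *)
Lemma midpoint_convex_le0 (h : R -> R) (B : R) :
  h 0 = 0 -> h 1 = 0 -> (forall t, 0 <= t <= 1 -> h t <= B) ->
  (forall s t, 0 <= s <= 1 -> 0 <= t <= 1 -> 2 * h ((s + t) / 2) <= h s + h t) ->
  forall t, 0 <= t <= 1 -> h t <= 0.
Proof.
move=> h0 h1 hB mid.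
have step k : forall t, 0 <= t <= 1 -> h t <= `|B| / 2 ^+ k.
  elim: k => [t t01|k IH t /andP[t0 t1]].
    by rewrite expr0 divr1 (le_trans (hB t t01)) ?ler_norm.
  have e : `|B| / 2 ^+ k.+1 = (`|B| / 2 ^+ k) / 2 by rewrite exprS; field; rewrite expf_neq0.
  rewrite e; have [t2|t2] := leP t (1 / 2).
    have := mid 0 (2 * t); have := IH (2 * t); rewrite h0.
    have -> : (0 + 2 * t) / 2 = t by field.
    by move=> /(_ ltac:(lra)) ? /(_ ltac:(lra) ltac:(lra)); lra.
  have := mid 1 (2 * t - 1); have := IH (2 * t - 1); rewrite h1.
  have -> : (1 + (2 * t - 1)) / 2 = t by field.
  by move=> /(_ ltac:(lra)) ? /(_ ltac:(lra) ltac:(lra)); lra.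
move=> t t01; rewrite leNgt; apply/negP => ht.
pose k := Num.bound (`|B| / h t).
have := archi_boundP (divr_ge0 (normr_ge0 B) (ltW ht)); rewrite -/k => kB.
have k2 : k%:R <= 2 ^+ k :> R by rewrite -natrX ler_nat ltnW // ltn_expl.
have := step k t t01; rewrite leNgt => /negP; apply.
rewrite ltr_pdivrMr ?exprn_gt0// mulrC.
by move: (lt_le_trans kB k2); rewrite ltr_pdivrMr.
Qed.

(** The difference between F and its chord vanishes at 0 and 1, inherits midpoint convexity and is
    at most 2 B. *)
Lemma midpoint_convex (F : R -> R) (B : R) :
  (forall s, 0 <= s <= 1 -> `|F 0 - F s| <= B) ->
  (forall s u, 0 <= s <= 1 -> 0 <= u <= 1 -> 2 * F ((s + u) / 2) <= F s + F u) ->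
  forall t, 0 <= t <= 1 -> F t <= (1 - t) * F 0 + t * F 1.
Proof.
move=> bd mid t t01; pose h t := F t - (1 - t) * F 0 - t * F 1.
suff : h t <= 0 by rewrite /h; lra.
apply: (@midpoint_convex_le0 h (B + B)) => //.
- by rewrite /h; ring.
- by rewrite /h; ring.
- move=> s s01; have := bd s s01; have := bd 1; rewrite lexx ler01 => /(_ isT).
  rewrite !ler_norml => /andP[a1 a2] /andP[b1 b2]; rewrite /h.
  have B0 : 0 <= B by lra.
  have := s01 => /andP[s0 s1].
  have : s * (F 0 - F 1) <= s * B by rewrite ler_wpM2l.
  have : s * B <= 1 * B by rewrite ler_wpM2r.
  lra.
- by move=> s u s01 u01; have := mid s u s01 u01; rewrite /h; lra.
Qed.

Lemma le_small_param (a b c t0 : R) : 0 < t0 ->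
  (forall t, 0 < t <= t0 -> b - t * c <= a) -> b <= a.
Proof.
move=> t00 h; apply/ler_addgt0Pr => e e0.
pose t := Num.min t0 (e / (`|c| + 1)).
have c1 : 0 < `|c| + 1 by rewrite ltr_wpDl.
have t0' : 0 < t by rewrite lt_min t00 divr_gt0.
have := h t; rewrite t0' ge_min lexx => /(_ isT).
have : t * c <= e.
  apply: le_trans (_ : t * (`|c| + 1) <= _).
    by rewrite ler_pM2l// (le_trans (ler_norm c))// lerDl.
  by rewrite -ler_pdivlMr// ge_min lexx orbT.
lra.
Qed.

Lemma ln_sq_le (a b c : R) : 0 < a -> 0 < b -> 0 < c -> a ^+ 2 <= b * c ->
  2 * ln a <= ln b + ln c.
Proof.
move=> a0 b0 c0; rewrite -ler_ln ?posrE ?exprn_gt0 ?mulr_gt0//.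
by rewrite lnXn// lnM ?posrE// mulr_natl.
Qed.

Lemma ln_sq_sq_le (a b c : R) : 0 < a -> 0 < b -> 0 < c -> a ^+ 2 <= b ^+ 2 * c ->
  2 * ln a <= 2 * ln b + ln c.
Proof.
move=> a0 b0 c0 /(ln_sq_le a0 (exprn_gt0 _ b0) c0); rewrite lnXn//.
by rewrite !mulr_natl.
Qed.

Lemma posdef_geo N (L : 'M[R]_N) (x : 'rV[R]_N) (t : R) : L \in unitmx ->
  (forall i, 0 < x 0 i) -> posdef (L^T *m diag_mx (map_mx (fun y => y `^ t) x) *m L).
Proof.
by move=> uL x0; apply: posdef_congr => //; apply: posdef_diag => i; rewrite mxE powR_gt0.
Qed.

(** The geodesic from L^T L at t = 0 to L^T diag(x) L at t = 1; by [pd_rep] any two positive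
    definite matrices are joined by one of this form. *)
Definition geo N (L : 'M[R]_N) (x : 'rV[R]_N) (uL : L \in unitmx)
    (x0 : forall i, 0 < x 0 i) (t : R) : pdmx R N := pd_of (posdef_geo t uL x0).

Section GeoPath.
Variables (N : nat) (L : 'M[R]_N) (x : 'rV[R]_N) (uL : L \in unitmx).
Hypothesis x0 : forall i, 0 < x 0 i.
Local Notation A := (geo uL x0).

Lemma geoE t : mx_of_pd (A t) = L^T *m diag_mx (map_mx (fun y => y `^ t) x) *m L.
Proof. by []. Qed.

Lemma geo0 : mx_of_pd (A 0) = L^T *m L.
Proof.
rewrite geoE -[X in _ = X *m _]mulmx1 -diag_const_mx; congr (_ *m diag_mx _ *m _).
by apply/rowP => i; rewrite !mxE powRr0.
Qed.

Lemma geo1 : mx_of_pd (A 1) = L^T *m diag_mx x *m L.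
Proof.
by rewrite geoE; congr (_ *m diag_mx _ *m _); apply/rowP => i; rewrite !mxE powRr1// ltW.
Qed.

Lemma geo_inv t : invmx (mx_of_pd (A t)) =
  (invmx L^T)^T *m diag_mx (map_mx (fun y => y `^ (- t)) x) *m invmx L^T.
Proof.
rewrite geoE invmx_diag_gram//; last by move=> i; rewrite mxE powR_gt0.
by congr (_ *m diag_mx _ *m _); apply/rowP => i; rewrite !mxE powRN.
Qed.

Lemma geo_mid s t : mx_of_pd (A t) =
  mx_of_pd (A ((s + t) / 2)) *m invmx (mx_of_pd (A s)) *m mx_of_pd (A ((s + t) / 2)).
Proof.
rewrite geo_inv !geoE trmx_inv trmxK.
set D := diag_mx _; set E := diag_mx _; set F := diag_mx _.
have -> : L^T *m E *m L *m (invmx L *m F *m invmx L^T) *m (L^T *m E *m L) =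
    L^T *m (E *m F *m E) *m L.
  by rewrite -!mulmxA mulKVmx// mulKmx ?unitmx_tr// !mulmxA.
congr (_ *m _ *m _); rewrite !mulmx_diag; congr diag_mx; apply/rowP => i.
rewrite !mxE -!powRD; try by apply/implyP => _; rewrite gt_eqF.
by congr powR; field.
Qed.

Lemma geo_dist t : riem_dist (A 0) (A t) <= `|t| * \sum_i `|ln (x 0 i)|.
Proof.
have h : 0 <= `|t| * \sum_i `|ln (x 0 i)| by rewrite mulr_ge0// sumr_ge0.
rewrite -(@ler_pXn2r _ 2) ?nnegrE ?riem_dist_ge0//.
rewrite (riem_dist_sq uL geo0 (geoE t)).
have -> : \sum_i ln ((map_mx (fun y => y `^ t) x) 0 i) ^+ 2 = `|t| ^+ 2 * \sum_i `|ln (x 0 i)| ^+ 2.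
  rewrite mulr_sumr; apply: eq_bigr => i _; rewrite mxE ln_powR// exprMn.
  by rewrite -!normrX !ger0_norm ?sqr_ge0.
rewrite exprMn ler_wpM2l ?sqr_ge0//.
rewrite [leRHS]expr2 mulr_suml; apply: ler_sum => i _; rewrite expr2 ler_wpM2l//.
by rewrite (bigD1 i)//= lerDl sumr_ge0.
Qed.

End GeoPath.

Definition ln_symp n m (mn : (m <= n)%N) (A : pdmx R (n + n)) : R := ln (symp_prod mn A).

Lemma ln_symp_lip n m (mn : (m <= n)%N) (A B : pdmx R (n + n)) :
  `|ln_symp mn A - ln_symp mn B| <= m%:R * riem_dist A B.
Proof.
have h (C D : pdmx R (n + n)) : ln_symp mn D <= m%:R * riem_dist C D + ln_symp mn C.
  rewrite /ln_symp -[m%:R * _]expRK -lnM ?posrE ?expR_gt0 ?symp_prod_gt0//.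
  by rewrite ler_ln ?posrE ?mulr_gt0 ?expR_gt0 ?symp_prod_gt0 ?symp_prod_lip.
have := h A B; have := h B A; rewrite (riem_dist_sym B A) ler_norml; lra.
Qed.

Lemma ln_symp_convex n m (mn : (m <= n)%N) (L : 'M[R]_(n + n)) (x : 'rV[R]_(n + n))
  (uL : L \in unitmx) (x0 : forall i, 0 < x 0 i) (t : R) : 0 <= t <= 1 ->
  ln_symp mn (geo uL x0 t) <=
  (1 - t) * ln_symp mn (geo uL x0 0) + t * ln_symp mn (geo uL x0 1).
Proof.
move=> t01.
have [F FE] : exists F : R -> R, forall s, F s = ln_symp mn (geo uL x0 s) by eexists.
rewrite -!FE; pose C : R := \sum_i `|ln (x 0 i)|.
have C0 : 0 <= C by apply: sumr_ge0.
apply: (@midpoint_convex F (m%:R * C)) => //.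
  move=> s /andP[s0 s1]; rewrite !FE; apply: le_trans (ln_symp_lip _ _ _) _.
  rewrite ler_wpM2l//; apply: le_trans (geo_dist _ _ _) _.
  by rewrite ger0_norm// -[leRHS]mul1r ler_wpM2r.
move=> s u s01 u01; rewrite !FE.
have := symp_prod_midpoint mn (geo_mid uL x0 s u).
by apply: ln_sq_le; exact: symp_prod_gt0.
Qed.

Lemma ln_symp_id n m (mn : (m <= n)%N) (A : pdmx R (n + n)) :
  mx_of_pd A = 1%:M -> ln_symp mn A = 0.
Proof.
move=> A1; have [V [V1 V2]] := symp_prod_attained mn A.
move: V1 V2; rewrite A1 invmx1 !mulmx1 symplJ_gram mulmx1 => ->; rewrite det1 => /esym p4.
have p0 := symp_prod_gt0 mn A.
have /eqP := p4; rewrite pexpr_eq1 ?ltW// => /eqP p1.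
by rewrite /ln_symp p1 ln1.
Qed.

Lemma pd_pow_spectral N (r : R) (A : pdmx R N) (U : 'M[R]_N) (d : 'rV[R]_N) :
  U^T *m U = 1%:M -> mx_of_pd A = U^T *m diag_mx d *m U ->
  mx_of_pd (pd_pow r A) = U^T *m diag_mx (map_mx (fun x => x `^ r) d) *m U.
Proof. by move=> U1 AE; apply: is_mxfun_inj (pd_powP r A) _; exists U, d. Qed.

Lemma ln_symp_pow n m (mn : (m <= n)%N) (r : R) (A : pdmx R (n + n)) : 0 < r <= 1 ->
  ln_symp mn (pd_pow r A) <= r * ln_symp mn A.
Proof.
move=> /andP[r0 r1]; have [U [d [U1 AE d0]]] := posdef_spectral (pdP A).
have uU := (mulmx1_unit U1).2.
have := ln_symp_convex mn uU d0 (t := r); rewrite (ltW r0) r1 => /(_ isT).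
rewrite (ln_symp_id mn (A := geo uU d0 0)) ?geo0// mulr0 add0r.
have -> : geo uU d0 1 = A by apply: mx_of_pd_inj; rewrite geo1.
by have -> : geo uU d0 r = pd_pow r A by apply: mx_of_pd_inj; rewrite (pd_pow_spectral r U1 AE).
Qed.

Lemma ln_symp_det n (A : pdmx R (n + n)) : 2 * ln_symp (leqnn n) A = ln (\det (mx_of_pd A)).
Proof. by rewrite -symp_prod_det lnXn ?symp_prod_gt0// mulr2n mulrDl !mul1r. Qed.

Lemma ln_det_pow N (r : R) (A : pdmx R N) :
  ln (\det (mx_of_pd (pd_pow r A))) = r * ln (\det (mx_of_pd A)).
Proof.
have [U [d [U1 AE d0]]] := posdef_spectral (pdP A).
rewrite (pd_pow_spectral r U1 AE) AE !det_diag_congr U1 det1 !mul1r.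
rewrite !ln_prod//; last by move=> i _; rewrite mxE powR_gt0.
by rewrite mulr_sumr; apply: eq_bigr => i _; rewrite mxE ln_powR.
Qed.

Lemma ln_det_le N (Y : 'M[R]_N) : posdef Y -> ln (\det Y) <= \tr Y - N%:R.
Proof.
move=> /posdef_spectral[U [d [U1 -> d0]]].
rewrite det_diag_congr U1 det1 mul1r mxtrace_mulC mulmxA (mulmx1C U1) mul1mx mxtrace_diag.
rewrite ln_prod// -[N in N%:R]card_ord -sum1_card natr_sum -sumrB; apply: ler_sum => i _.
have := d0 i; have := le_ln1Dx (x := d 0 i - 1); rewrite [1 + _]addrC subrK => h di.
by apply: h; lra.
Qed.

Lemma exp_first_order (u : R) : `|u| <= 2^-1 -> u - 2 * u ^+ 2 <= 1 - expR (- u).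
Proof.
rewrite ler_norml => /andP[u1 u2].
have u0 : 0 < 1 + u by lra.
have : expR (- u) <= (1 + u)^-1.
  by rewrite expRN lef_pV2 ?posrE ?expR_gt0// expR_ge1Dx.
have : u - 2 * u ^+ 2 <= 1 - (1 + u)^-1; last lra.
have -> : 1 - (1 + u)^-1 = u / (1 + u) by field; lra.
rewrite ler_pdivlMr//.
have : 0 <= u ^+ 2 * (1 + 2 * u) by rewrite mulr_ge0 ?sqr_ge0//; lra.
by lra.
Qed.

Lemma frame_congr N k (t : 'I_k -> 'I_N) (Y : 'M[R]_N) :
  (frame R t)^T *m Y *m frame R t = \matrix_(i, j) Y (t i) (t j).
Proof.
have colE p (B : 'M[R]_(p, N)) : B *m frame R t = colsub t B.
  rewrite -[in RHS](mulmx1 B); apply/matrixP => i j; rewrite !mxE.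
  by apply: eq_bigr => l _; rewrite !mxE.
rewrite -[_^T *m Y]trmxK trmx_mul trmxK !colE.
by apply/matrixP => i j; rewrite !mxE.
Qed.

Lemma posdef_frame N k (t : 'I_k -> 'I_N) (Y : 'M[R]_N) : injective t ->
  posdef Y -> posdef ((frame R t)^T *m Y *m frame R t).
Proof.
move=> it [sY pY]; split; first by rewrite trmxMM trmxK sY.
move=> x x0; rewrite !mulmxA -trmx_mul -mulmxA; apply: pY.
apply: contra_neq x0 => Ex; rewrite -[x]mul1mx -(frame_gram R it) -mulmxA Ex mulmx0 //.
Qed.

(* By convexity along the geodesic to [A] and the explicit value of the pairing
   at the symplectic frame of [Z]. *)
Lemma ln_symp_subgradient n m (mn : (m <= n)%N) (Z : pdmx R (n + n)) :
  exists M : 'M[R]_(n + n), [/\ M \in unitmx, mx_of_pd Z = M^T *m M &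
  forall (A : pdmx R (n + n)) (O : 'M[R]_(n + n)) (x : 'rV[R]_(n + n)),
    O^T *m O = 1%:M -> (forall i, 0 < x 0 i) ->
    mx_of_pd A = M^T *m (O^T *m diag_mx x *m O) *m M ->
    \sum_j \sum_i O i (top2 mn j) ^+ 2 * ln (x 0 i) <=
    2 * (ln_symp mn A - ln_symp mn Z)].
Proof.
have [S [uS SJ _ ZE]] := symp_frame Z.
have := row_mx_gt0 (symp_eig_gt0 Z); move: ZE (prod_top2 mn (symp_eig Z)).
set d := row_mx _ _ => ZE dprod d0; clearbody d.
rewrite -/(symp_prod mn Z) in dprod.
pose s : 'rV[R]_(n + n) := map_mx Num.sqrt d.
have s0 i : 0 < s 0 i by rewrite mxE sqrtr_gt0.
have s2 i : s 0 i * s 0 i = d 0 i by rewrite mxE -expr2 sqr_sqrtr// ltW.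
have us : diag_mx s \in unitmx.
  by rewrite unitmxE unitfE det_diag gt_eqF// prodr_gt0.
have uM : diag_mx s *m S \in unitmx by rewrite unitmx_mul us.
have ZM : mx_of_pd Z = (diag_mx s *m S)^T *m (diag_mx s *m S).
  rewrite ZE trmx_mul tr_diag_mx [RHS]mulmxA -[X in _ = X *m _]mulmxA mulmx_diag.
  by congr (_ *m diag_mx _ *m _); apply/rowP => i; rewrite [RHS]mxE s2.
exists (diag_mx s *m S); split=> // A O x O1 x0 AE.
have uO := (mulmx1_unit O1).2.
have uL : O *m (diag_mx s *m S) \in unitmx by rewrite unitmx_mul uO.
have A0 : geo uL x0 0 = Z.
  by apply: mx_of_pd_inj; rewrite geo0 trmx_mul mulmxA -(mulmxA _ O^T) O1 mulmx1.
have A1 : geo uL x0 1 = A.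
  by apply: mx_of_pd_inj; rewrite geo1 AE trmx_mul !mulmxA.
pose E := frame R (top2 mn).
(* The Gram determinant of the frame S^T E of Z for the inverse of the point at time t, normalized
   to be 1 at t = 0. *)
pose q t := \det (E^T *m (O^T *m diag_mx (map_mx (fun y => y `^ (- t)) x) *m O) *m E).
have qpd t : posdef (E^T *m (O^T *m diag_mx (map_mx (fun y => y `^ (- t)) x) *m O) *m E).
  apply: posdef_frame; first exact: top2_inj.
  by apply: posdef_congr => //; apply: posdef_diag => i; rewrite mxE powR_gt0.
pose s' : 'rV[R]_(n + n) := map_mx GRing.inv s.
have LS : invmx (O *m (diag_mx s *m S))^T *m S^T = O *m diag_mx s'.
  have ST : S^T = (O *m (diag_mx s *m S))^T *m (O *m diag_mx s').
    rewrite !trmx_mul tr_diag_mx -!mulmxA (mulmxA O^T) O1 mul1mx mulmx_diag.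
    rewrite -[LHS]mulmx1 -diag_const_mx; congr (_ *m diag_mx _).
    apply/rowP => i; rewrite [RHS]mxE [X in _ * X]mxE mulfV; first by rewrite mxE.
    exact: lt0r_neq0.
  by rewrite ST mulKmx// unitmx_tr.
have s'E : diag_mx s' *m E = E *m diag_mx (\row_j s' 0 (top2 mn j)).
  rewrite mul_mx_diag mul_diag_mx; apply/matrixP => i j; rewrite !mxE.
  by case: eqP => [->|]; rewrite ?mulr1 ?mul1r ?mulr0 ?mul0r.
(* The pairing bound with both frames equal to S^T E: their pairing is J_m, whose determinant
   squares to 1. *)
have key t : symp_prod mn Z ^+ 2 <= symp_prod mn (geo uL x0 t) ^+ 2 * q t.
  have := symp_prod_pairing mn (geo uL x0 t) (S^T *m E) (S^T *m E).
  have -> : (S^T *m E)^T *m symplJ R n *m (S^T *m E) = symplJ R m.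
    rewrite trmx_mul trmxK -!mulmxA (mulmxA S) (mulmxA _ S^T) SJ symplJ_frame.
    by rewrite mulmxA frame_gram ?mul1mx//; exact: top2_inj.
  rewrite symplJ_det.
  have -> : \det ((S^T *m E)^T *m invmx (mx_of_pd (geo uL x0 t)) *m (S^T *m E)) =
     q t / symp_prod mn Z ^+ 2.
    rewrite geo_inv.
    have -> (D : 'M[R]_(n + n)) : (S^T *m E)^T *m ((invmx (O *m (diag_mx s *m S))^T)^T *m D *m
        invmx (O *m (diag_mx s *m S))^T) *m (S^T *m E) =
        (invmx (O *m (diag_mx s *m S))^T *m S^T *m E)^T *m D *m
        (invmx (O *m (diag_mx s *m S))^T *m S^T *m E).
      by rewrite !trmx_mul !mulmxA.
    rewrite LS -(mulmxA O) s'E; set D := diag_mx (\row_j _); set Y := diag_mx (map_mx _ _).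
    have -> : (O *m (E *m D))^T *m Y *m (O *m (E *m D)) =
        D^T *m (E^T *m (O^T *m Y *m O) *m E) *m D by rewrite !trmx_mul !mulmxA.
    rewrite !det_mulmx det_tr mulrAC -/(q t) mulrC -[in RHS]dprod -prodfV det_diag -big_split.
    congr (_ * _); apply: eq_bigr => j _.
    by rewrite -s2 invfM; congr (_ * _); rewrite !mxE.
  have z0 := symp_prod_gt0 mn Z; have p0 := symp_prod_gt0 mn (geo uL x0 t).
  have q0 := posdef_det (qpd t); rewrite -/(q t) in q0.
  move: (symp_prod mn Z) (symp_prod mn (geo uL x0 t)) (q t) z0 p0 q0 => z p Q z0 p0 Q0 h.
  rewrite -(@ler_pXn2r _ 2) ?nnegrE ?mulr_ge0 ?exprn_ge0 ?(ltW z0) ?(ltW p0) ?(ltW Q0)//.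
  have -> : (p ^+ 2 * Q) ^+ 2 = (p ^+ 4 * (Q / z ^+ 2 * (Q / z ^+ 2))) * (z ^+ 2) ^+ 2.
    by field; rewrite gt_eqF.
  by rewrite -[leLHS]mul1r ler_pM2r// !exprn_gt0.
have trE t : \tr (E^T *m (O^T *m diag_mx (map_mx (fun y => y `^ (- t)) x) *m O) *m E) - (m + m)%:R =
   \sum_j \sum_i O i (top2 mn j) ^+ 2 * (x 0 i `^ (- t) - 1).
  rewrite frame_congr -[X in X%:R]card_ord -sum1_card natr_sum -sumrB.
  apply: eq_bigr => j _; under [RHS]eq_bigr do rewrite mulrBr mulr1.
  rewrite sumrB mxE mul_mx_diag mxE; congr (_ - _).
    by apply: eq_bigr => i _; rewrite !mxE; ring.
  have := congr1 (fun X : 'M[R]_(n + n) => X (top2 mn j) (top2 mn j)) O1.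
  rewrite !mxE eqxx => <-; apply: eq_bigr => i _; by rewrite !mxE expr2.
pose Lam := \sum_i `|ln (x 0 i)|.
have Lam0 : 0 <= Lam by apply: sumr_ge0.
pose c := \sum_j \sum_i O i (top2 mn j) ^+ 2 * (2 * ln (x 0 i) ^+ 2).
(* This range of t keeps |t ln x_i| <= 1/2, as [exp_first_order] requires, and t <= 1. *)
apply: (@le_small_param _ _ c (2^-1 / (1 + Lam))).
  by rewrite divr_gt0// ltr_wpDr.
move=> t /andP[t0]; rewrite ler_pdivlMr ?ltr_wpDr// => tL.
have tl i : `|t * ln (x 0 i)| <= 2^-1.
  rewrite normrM gtr0_norm//; apply: le_trans tL; rewrite ler_pM2l//.
  rewrite /Lam (bigD1 i)//= addrCA lerDl addr_ge0//; exact: sumr_ge0.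
have t1 : t <= 1.
  by apply: le_trans (_ : t * (1 + Lam) <= _); [rewrite ler_peMr ?lerDl// ltW|lra].
have h1 := ln_symp_convex mn uL x0 (t := t); rewrite A0 A1 in h1.
have {}h1 := h1 ltac:(by rewrite (ltW t0) t1).
have q0 : 0 < q t by exact: posdef_det.
have h2 : 2 * ln_symp mn Z <= 2 * ln_symp mn (geo uL x0 t) + ln (q t).
  by apply: ln_sq_sq_le (key t); rewrite ?symp_prod_gt0.
(* First ln det <= trace - 2m, then x^-t - 1 <= - t ln x + 2 (t ln x)^2 entrywise; c collects the
   quadratic terms. *)
have h3 : ln (q t) <= - (t * \sum_j \sum_i O i (top2 mn j) ^+ 2 * ln (x 0 i)) + t ^+ 2 * c.
  apply: le_trans (ln_det_le (qpd t)) _; rewrite trE /c !mulr_sumr -sumrN -big_split /=.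
  apply: ler_sum => j _; rewrite !mulr_sumr -sumrN -big_split /=; apply: ler_sum => i _.
  rewrite {1}/powR gt_eqF//= mulNr.
  have := ler_wpM2l (sqr_ge0 (O i (top2 mn j))) (exp_first_order (tl i)).
  move: (O i (top2 mn j)) (ln (x 0 i)) => o l.
  by move: (expR _) => e; lra.
(* Convexity bounds 2 (ln s_m(A(t)) - ln s_m(Z)) above by 2 t (ln s_m(A) - ln s_m(Z)), and the
   pairing bounds it below by - ln q(t). After division by t the error is t c. *)
rewrite -(ler_pM2l t0).
move: (\sum_j _) c (ln_symp mn A) (ln_symp mn Z) (ln_symp mn _) (ln _) h1 h2 h3 => a b e f g k.
by rewrite expr2; lra.
Qed.

End Geodesics.

(** * First variation of the squared distance *)

Section FirstVariation.
Variable R : realType.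

(** With u = ln y - ln x, the left side is u^2 - 2 ln x ((y - x) / x - u). Here |u| <= |y - x| / c,
    and (y - x) / x - u lies between 0 and (y - x)^2 / c^2, whence the constant (1 + 2 l) / c^2. *)
Lemma ln_sq_taylor (x y c l : R) : 0 < c -> c <= x -> c <= y -> `|ln x| <= l ->
  ln y ^+ 2 - ln x ^+ 2 - (y - x) * (2 * ln x / x) <=
  (1 + 2 * l) / c ^+ 2 * (y - x) ^+ 2.
Proof.
move=> c0 cx cy xl; have x0 : 0 < x by lra.
have y0 : 0 < y by lra.
have lnle (a b : R) : 0 < a -> 0 < b -> ln a - ln b <= (a - b) / b.
  move=> a0 b0; rewrite -ln_div ?posrE//.
  have := @le_ln1Dx R (a / b - 1); rewrite [1 + _]addrC subrK => h.
  have -> : (a - b) / b = a / b - 1 by field; lra.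
  by apply: h; have := divr_gt0 a0 b0; lra.
have d2 : (y - x) ^+ 2 / (x * y) <= (y - x) ^+ 2 / c ^+ 2.
  rewrite ler_wpM2l ?sqr_ge0// lef_pV2 ?posrE ?mulr_gt0 ?exprn_gt0// expr2.
  by apply: ler_pM; rewrite // ltW.
pose u := ln y - ln x.
have u1 : u <= (y - x) / x by exact: lnle.
have u2 : - u <= (x - y) / y by rewrite /u opprB; exact: lnle.
have uu : u ^+ 2 <= (y - x) ^+ 2 / c ^+ 2.
  have h (a b : R) : 0 <= b -> a <= b / c -> 0 <= a -> a ^+ 2 <= b ^+ 2 / c ^+ 2.
    by move=> b0 ab a0; rewrite -exprVn -exprMn ler_pXn2r ?nnegrE// divr_ge0// ltW.
  have hc (b z : R) : 0 <= b -> c <= z -> b / z <= b / c.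
    by move=> b0 cz; rewrite ler_wpM2l// lef_pV2 ?posrE//; lra.
  have [u0|/ltW u0] := leP 0 u.
    have yx : 0 <= y - x by rewrite -(pmulr_lge0 _ (_ : 0 < x^-1)) ?invr_gt0//; lra.
    by apply: h => //; apply: le_trans u1 _; exact: hc.
  have xy : 0 <= x - y by rewrite -(pmulr_lge0 _ (_ : 0 < y^-1)) ?invr_gt0//; lra.
  have -> : u ^+ 2 = (- u) ^+ 2 by rewrite sqrrN.
  have -> : (y - x) ^+ 2 = (x - y) ^+ 2 by ring.
  apply: h => //; last by rewrite oppr_ge0.
  by apply: le_trans u2 _; exact: hc.
have v0 : 0 <= (y - x) / x - u by lra.
have v1 : (y - x) / x - u <= (y - x) ^+ 2 / (x * y).
  have -> : (y - x) ^+ 2 / (x * y) = (y - x) / x + (x - y) / y by field; lra.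
  by lra.
have -> : ln y ^+ 2 - ln x ^+ 2 - (y - x) * (2 * ln x / x) =
   u ^+ 2 - 2 * ln x * ((y - x) / x - u) by rewrite /u; field; lra.
have l0 : 0 <= l by rewrite (le_trans _ xl).
have : - (ln x) * ((y - x) / x - u) <= l * ((y - x) ^+ 2 / c ^+ 2).
  apply: le_trans (_ : l * ((y - x) / x - u) <= _).
    by apply: ler_wpM2r => //; apply: le_trans xl; rewrite -normrN ler_norm.
  by apply: ler_wpM2l => //; apply: le_trans v1 _.
have -> : (1 + 2 * l) / c ^+ 2 * (y - x) ^+ 2 = (y - x) ^+ 2 / c ^+ 2 + 2 * (l * ((y - x) ^+ 2 / c ^+ 2)).
  by field; lra.
clearbody u; move: uu; move: ((y - x) / x) ((y - x) ^+ 2 / _) (ln x) => a b l' uu; lra.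
Qed.

(** For orthogonal V and O the weights, squared entries of O V^T, form a doubly stochastic array; on
    it sums over either spectrum become comparable double sums. *)
Lemma trace_double N (V O : 'M[R]_N) (a b : 'rV[R]_N) :
  \tr ((V^T *m diag_mx a *m V) *m (O^T *m diag_mx b *m O)) =
  \sum_i \sum_j (O *m V^T) i j ^+ 2 * (a 0 j * b 0 i).
Proof.
have -> : (V^T *m diag_mx a *m V) *m (O^T *m diag_mx b *m O) =
   V^T *m (diag_mx a *m (V *m O^T) *m (diag_mx b *m O)) by rewrite !mulmxA.
have E (P : 'M[R]_N) : P *m (diag_mx b *m O) *m V^T = P *m (diag_mx b *m (O *m V^T)).
  by rewrite !mulmxA.
rewrite mxtrace_mulC E -[V *m O^T]trmxK trmx_mul trmxK.
rewrite !mul_diag_mx; move: (O *m V^T) => W; rewrite /mxtrace exchange_big /=.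
apply: eq_bigr => i _; rewrite mxE; apply: eq_bigr => j _; rewrite !mxE; ring.
Qed.

Lemma orth_row_sum N (W : 'M[R]_N) : W *m W^T = 1%:M -> forall i, \sum_j W i j ^+ 2 = 1.
Proof.
move=> W1 i; have := congr1 (fun X : 'M[R]_N => X i i) W1; rewrite !mxE eqxx => E.
by rewrite -[RHS]/(true%:R) -E; apply: eq_bigr => j _; rewrite !mxE expr2.
Qed.

Section DoubleSpectral.
Variables (N : nat) (V O : 'M[R]_N).
Hypotheses (V1 : V^T *m V = 1%:M) (O1 : O^T *m O = 1%:M).
Local Notation W := (O *m V^T).

Let W1 : W *m W^T = 1%:M.
Proof. by rewrite trmx_mul trmxK mulmxA -(mulmxA O) V1 mulmx1 (mulmx1C O1). Qed.

Let W2 : W^T *m W^T^T = 1%:M.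
Proof. by rewrite trmxK; exact: mulmx1C W1. Qed.

Lemma sum_cols_orth (a : 'I_N -> R) : \sum_j a j = \sum_i \sum_j W i j ^+ 2 * a j.
Proof.
rewrite exchange_big /=; apply: eq_bigr => j _; rewrite -mulr_suml.
rewrite -[LHS]mul1r -(orth_row_sum W2 j); congr (_ * _).
by apply: eq_bigr => i _; rewrite mxE.
Qed.

Lemma sum_rows_orth (a : 'I_N -> R) : \sum_i a i = \sum_i \sum_j W i j ^+ 2 * a i.
Proof. by apply: eq_bigr => i _; rewrite -mulr_suml orth_row_sum// mul1r. Qed.

Lemma trace_same (Q : 'M[R]_N) (a b : 'rV[R]_N) : Q^T *m Q = 1%:M ->
  \tr ((Q^T *m diag_mx a *m Q) *m (Q^T *m diag_mx b *m Q)) = \sum_i a 0 i * b 0 i.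
Proof.
move=> Q1; rewrite trace_double; apply: eq_bigr => i _.
rewrite (mulmx1C Q1) (bigD1 i)//= big1 ?addr0; first by rewrite mxE eqxx expr1n mul1r.
by move=> j ji; rewrite mxE eq_sym (negPf ji) expr0n mul0r.
Qed.

Lemma trace_sq_diff (x y : 'rV[R]_N) :
  \tr ((V^T *m diag_mx y *m V - O^T *m diag_mx x *m O) *m
       (V^T *m diag_mx y *m V - O^T *m diag_mx x *m O)) =
  \sum_i \sum_j W i j ^+ 2 * (y 0 j - x 0 i) ^+ 2.
Proof.
have trB (P Q : 'M[R]_N) : \tr (P - Q) = \tr P - \tr Q by rewrite raddfB.
rewrite mulmxBl !mulmxBr !trB opprB.
rewrite [\tr (O^T *m diag_mx x *m O *m (V^T *m diag_mx y *m V))]mxtrace_mulC.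
rewrite !trace_same// trace_double.
rewrite (sum_cols_orth (fun j => y 0 j * y 0 j)) (sum_rows_orth (fun i => x 0 i * x 0 i)).
rewrite -!sumrB -big_split; apply: eq_bigr => i _ /=.
by rewrite -!sumrB -big_split; apply: eq_bigr => j _ /=; ring.
Qed.

End DoubleSpectral.

(* The double spectral representation of traces of products reduces this to
   the scalar bound [ln_sq_taylor] at each pair of eigenvalues. *)
Lemma trace_ln_sq_le N (V O : 'M[R]_N) (x y : 'rV[R]_N) (c l : R) :
  V^T *m V = 1%:M -> O^T *m O = 1%:M -> 0 < c ->
  (forall i, c <= x 0 i) -> (forall i, c <= y 0 i) -> (forall i, `|ln (x 0 i)| <= l) ->
  forall X Y : 'M[R]_N, X = O^T *m diag_mx x *m O -> Y = V^T *m diag_mx y *m V ->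
  \sum_i ln (y 0 i) ^+ 2 <= \sum_i ln (x 0 i) ^+ 2 +
    \tr ((Y - X) *m (O^T *m diag_mx (map_mx (fun z => 2 * ln z / z) x) *m O)) +
    (1 + 2 * l) / c ^+ 2 * \tr ((Y - X) *m (Y - X)).
Proof.
move=> V1 O1 c0 cx cy xl X Y XE YE.
pose W := O *m V^T.
have trB (P Q : 'M[R]_N) : \tr (P - Q) = \tr P - \tr Q by rewrite raddfB.
set g := map_mx _ x.
rewrite XE YE trace_sq_diff// mulmxBl trB trace_same// trace_double -/W.
rewrite (sum_cols_orth V1 O1 (fun j => ln (y 0 j) ^+ 2)).
rewrite (sum_rows_orth V1 O1 (fun i => ln (x 0 i) ^+ 2)).
rewrite (sum_rows_orth V1 O1 (fun i => x 0 i * g 0 i)).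
rewrite mulr_sumr -sumrB -!big_split; apply: ler_sum => i _ /=.
rewrite mulr_sumr -sumrB -!big_split; apply: ler_sum => j _ /=.
have := ler_wpM2l (sqr_ge0 (W i j)) (ln_sq_taylor c0 (cx i) (cy j) (xl i)).
have <- : g 0 i = 2 * ln (x 0 i) / x 0 i by rewrite mxE.
move: ((1 + 2 * l) / _) (W i j) (g 0 i) (ln _) (ln _) => a w e f h.
lra.
Qed.

Lemma sum_codom N k (t : 'I_k -> 'I_N) (F : 'I_N -> R) : injective t ->
  \sum_a (a \in codom t)%:R * F a = \sum_j F (t j).
Proof.
move=> it; have -> : \sum_j F (t j) = \sum_(a in t @: 'I_k) F a.
  by rewrite big_imset //= => i j _ _; exact: it.
rewrite [RHS]big_mkcond /=; apply: eq_bigr => a _.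
have -> : (a \in t @: 'I_k) = (a \in codom t).
  apply/imsetP/codomP => [[i _ ->]|[i ->]]; by exists i.
by case: ifP; rewrite ?mul1r ?mul0r.
Qed.

(** The scaling g of the perturbed point Ze = M^T g^-2 M. With the exponent -2, Ze is the Gram
    matrix of g^-1 M, and in that frame A = M^T X M becomes g X g, which is polynomial in e. *)
Definition shrink N k (t : 'I_k -> 'I_N) (e : R) : 'rV[R]_N :=
  \row_i (1 + (i \in codom t)%:R * e).

Lemma shrink_ge1 N k (t : 'I_k -> 'I_N) (e : R) i : 0 <= e -> 1 <= shrink t e 0 i.
Proof. by move=> e0; rewrite mxE lerDl mulr_ge0. Qed.

Lemma indic_sq_le9 (e u v : R) : 0 <= e -> e <= 1 -> u = 0 \/ u = 1 -> v = 0 \/ v = 1 ->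
  (u + v + e * (u * v)) ^+ 2 <= 9.
Proof.
move=> e0 e1; have -> : 9 = 3 ^+ 2 :> R by ring.
by case=> ->; case=> ->; rewrite ler_pXn2r ?nnegrE//; lra.
Qed.

(** In the frame g^-1 M the matrix A has coordinates Xe = g X g, and [trace_ln_sq_le] expands around
    X. To first order Xe - X is e (tau X + X tau), with tau the projection on the chosen
    coordinates; paired with G = 2 X^-1 ln X this gives 4 e tr(tau ln X). The constant C may depend
    on A but not on e. *)
Lemma riem_dist_variation N k (t : 'I_k -> 'I_N) (M O : 'M[R]_N) (x : 'rV[R]_N) (Z A : pdmx R N) :
  injective t -> M \in unitmx -> mx_of_pd Z = M^T *m M ->
  O^T *m O = 1%:M -> (forall i, 0 < x 0 i) ->
  mx_of_pd A = M^T *m (O^T *m diag_mx x *m O) *m M ->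
  exists C, forall (e : R) (Ze : pdmx R N), 0 < e <= 1 ->
    mx_of_pd Ze = M^T *m diag_mx (map_mx (fun z => z ^- 2) (shrink t e)) *m M ->
    riem_dist Ze A ^+ 2 <= riem_dist Z A ^+ 2 +
      4 * e * (\sum_j \sum_i O i (t j) ^+ 2 * ln (x 0 i)) + C * e ^+ 2.
Proof.
move=> it uM ZE O1 x0 AE.
have uO := (mulmx1_unit O1).2; have O2 := mulmx1C O1.
pose X := O^T *m diag_mx x *m O.
pose G := O^T *m diag_mx (map_mx (fun z => 2 * ln z / z) x) *m O.
pose tau a : R := (a \in codom t)%:R.
(* An explicit bound below every x_i that stays positive when N = 0. *)
have [c c0 cx] : exists2 c, 0 < c & forall i, c <= x 0 i.
  have S0 : 0 <= \sum_i (x 0 i)^-1 by apply: sumr_ge0 => i _; rewrite invr_ge0 ltW.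
  exists (1 + \sum_i (x 0 i)^-1)^-1; first by rewrite invr_gt0 ltr_wpDr.
  move=> i; rewrite -[leRHS]invrK lef_pV2 ?posrE ?invr_gt0 ?ltr_wpDr//.
  rewrite (bigD1 i)//= addrCA lerDl addr_ge0//; apply: sumr_ge0 => j _.
  by rewrite invr_ge0 ltW.
pose l := \sum_i `|ln (x 0 i)|.
have xl i : `|ln (x 0 i)| <= l by rewrite /l (bigD1 i)//= lerDl sumr_ge0.
pose K := \sum_a \sum_b X a b * G b a * (tau a * tau b).
(* The 9 bounds the square of tau a + tau b + e tau a tau b, three terms of size at most 1 since e
   <= 1. *)
pose Q := \sum_a \sum_b X a b ^+ 2 * 9.
pose C1 := (1 + 2 * l) / c ^+ 2.
exists (`|K| + C1 * Q) => e Ze /andP[e0 e1] ZeE.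
have g1 i := shrink_ge1 t i (ltW e0).
set g := shrink t e in ZeE g1.
have g0 i : 0 < g 0 i by apply: lt_le_trans (g1 i).
pose Ni := diag_mx (map_mx GRing.inv g) *m M.
have ug : diag_mx g \in unitmx by rewrite unitmxE unitfE det_diag gt_eqF// prodr_gt0.
have uN : Ni \in unitmx.
  rewrite unitmx_mul uM andbT unitmxE unitfE det_diag gt_eqF// prodr_gt0// => i _.
  by rewrite mxE invr_gt0.
have ZeN : mx_of_pd Ze = Ni^T *m Ni.
  rewrite ZeE /Ni trmx_mul tr_diag_mx [RHS]mulmxA -[X in _ = X *m _]mulmxA mulmx_diag.
  by congr (_ *m diag_mx _ *m _); apply/rowP => i; rewrite [LHS]mxE [RHS]mxE !mxE -invfM -expr2.
pose Xe := diag_mx g *m X *m diag_mx g.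
have AN : mx_of_pd A = Ni^T *m Xe *m Ni.
  have gi : diag_mx g *m diag_mx (map_mx GRing.inv g) = 1%:M.
    rewrite mulmx_diag -diag_const_mx; congr diag_mx; apply/rowP => i.
    rewrite [LHS]mxE [X in _ * X]mxE mulfV; first by rewrite mxE.
    exact: lt0r_neq0.
  have gi' := mulmx1C gi.
  rewrite AE -/X /Ni trmx_mul tr_diag_mx /Xe !mulmxA -(mulmxA M^T (diag_mx _) (diag_mx _)) gi' mulmx1.
  by rewrite -(mulmxA _ (diag_mx g)) gi mulmx1.
have pX : posdef X by apply: posdef_congr => //; exact: posdef_diag.
have pXe : posdef Xe by rewrite /Xe -{1}(tr_diag_mx g); exact: posdef_congr.
have [V [y [V1 XeE y0]]] := posdef_spectral pXe.
have V2 := mulmx1C V1; have uV := (mulmx1_unit V1).2.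
have -> : riem_dist Z A ^+ 2 = \sum_i ln (x 0 i) ^+ 2.
  apply: (@riem_dist_sq R N Z A (O *m M)); first by rewrite unitmx_mul uO.
    by rewrite trmx_mul mulmxA -(mulmxA M^T) O1 mulmx1.
  by rewrite AE trmx_mul !mulmxA.
have -> : riem_dist Ze A ^+ 2 = \sum_i ln (y 0 i) ^+ 2.
  apply: (@riem_dist_sq R N Ze A (V *m Ni)); first by rewrite unitmx_mul uV.
    by rewrite trmx_mul mulmxA -(mulmxA Ni^T) V1 mulmx1.
  by rewrite AN XeE (trmx_mul V Ni) !mulmxA.
have dotE (z : 'cV[R]_N) : (z^T *m z) 0 0 = \sum_i z i 0 ^+ 2.
  by rewrite mxE; apply: eq_bigr => i _; rewrite mxE expr2.
(* Since g >= 1, the eigenvalues of Xe = g X g stay above the bound c chosen for X, so the remainder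
   constant is the same for all e. *)
have cy i : c <= y 0 i.
  pose v : 'cV[R]_N := V^T *m delta_mx i 0.
  have v1 : (v^T *m v) 0 0 = 1.
    rewrite /v trmx_mul trmxK -mulmxA (mulmxA V) V2 mul1mx dotE (bigD1 i)//= big1.
      by rewrite mxE !eqxx expr1n addr0.
    by move=> j ji; rewrite mxE (negPf ji) expr0n.
  have -> : y 0 i = (v^T *m Xe *m v) 0 0.
    rewrite XeE /v trmx_mul trmxK.
    have -> : (delta_mx i 0)^T *m V *m (V^T *m diag_mx y *m V) *m (V^T *m delta_mx i 0) =
      (delta_mx i 0)^T *m (V *m V^T) *m diag_mx y *m (V *m V^T) *m delta_mx i 0 :> 'M[R]_1.
      by rewrite !mulmxA.
    rewrite V2 !mulmx1 quad_diag (bigD1 i)//= big1 ?addr0.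
      by rewrite mxE !eqxx expr1n mulr1.
    by move=> j ji; rewrite mxE (negPf ji) expr0n mulr0.
  pose w := diag_mx g *m v.
  have -> : v^T *m Xe *m v = (O *m w)^T *m diag_mx x *m (O *m w).
    by rewrite /w /Xe /X !trmx_mul tr_diag_mx !mulmxA.
  rewrite quad_diag -[c]mulr1 -v1.
  apply: le_trans (_ : c * (w^T *m w) 0 0 <= _).
    rewrite ler_pM2l// !dotE; apply: ler_sum => a _.
    rewrite /w mul_diag_mx [in leRHS]mxE exprMn ler_peMl ?sqr_ge0//.
    by rewrite exprn_ege1.
  have -> : w^T *m w = (O *m w)^T *m (O *m w).
    by rewrite (trmx_mul O w) -mulmxA (mulmxA O^T) O1 mul1mx.
  rewrite dotE mulr_sumr; apply: ler_sum => a _.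
  by apply: ler_wpM2r; rewrite ?sqr_ge0.
have := trace_ln_sq_le V1 O1 c0 cx cy xl (erefl X) XeE; rewrite -/G -/C1.
have XE a b : (Xe - X) a b = X a b * (e * (tau a + tau b) + e ^+ 2 * (tau a * tau b)).
  rewrite /Xe mul_mx_diag mul_diag_mx; move: (X) => B.
  rewrite !mxE -/(tau a) -/(tau b); ring.
have -> : \tr ((Xe - X) *m G) = 4 * e * (\sum_j \sum_i O i (t j) ^+ 2 * ln (x 0 i)) + e ^+ 2 * K.
  have -> : \tr ((Xe - X) *m G) =
      e * (\sum_a tau a * (X *m G) a a + \sum_a tau a * (G *m X) a a) + e ^+ 2 * K.
    have -> : \sum_a tau a * (X *m G) a a = \sum_a \sum_b X a b * G b a * tau a.
      by apply: eq_bigr => a _; rewrite mxE mulrC mulr_suml.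
    have -> : \sum_a tau a * (G *m X) a a = \sum_a \sum_b X a b * G b a * tau b.
      rewrite exchange_big /=; apply: eq_bigr => a _; rewrite mxE mulrC mulr_suml.
      by apply: eq_bigr => b _; rewrite [G a b * _]mulrC.
    rewrite -big_split /K /mxtrace !mulr_sumr -big_split; apply: eq_bigr => a _ /=.
    rewrite mxE -big_split !mulr_sumr -big_split; apply: eq_bigr => b _ /=.
    rewrite XE; move: (X a b) (G b a) (tau a) (tau b) => p q f h; ring.
  have XG : X *m G = O^T *m diag_mx (map_mx (fun z => 2 * ln z) x) *m O.
    rewrite /X /G !mulmxA -(mulmxA _ O O^T) O2 mulmx1 -(mulmxA O^T) mulmx_diag.
    congr (_ *m diag_mx _ *m _); apply/rowP => i; rewrite [LHS]mxE [RHS]mxE [X in _ * X]mxE.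
    by field; apply: lt0r_neq0.
  have GX : G *m X = X *m G.
    rewrite XG /X /G !mulmxA -(mulmxA _ O O^T) O2 mulmx1 -(mulmxA O^T) mulmx_diag.
    congr (_ *m diag_mx _ *m _); apply/rowP => i; rewrite [LHS]mxE [RHS]mxE [X in X * _]mxE.
    by field; apply: lt0r_neq0.
  rewrite GX; congr (_ + _).
  have -> : \sum_a tau a * (X *m G) a a = 2 * \sum_j \sum_i O i (t j) ^+ 2 * ln (x 0 i).
    rewrite sum_codom// mulr_sumr; apply: eq_bigr => j _.
    rewrite XG mul_mx_diag mxE mulr_sumr; apply: eq_bigr => i _; rewrite !mxE.
    by move: (ln _) (O _ _) => p q; ring.
  by move: (\sum_j _) => p; ring.
have : \tr ((Xe - X) *m (Xe - X)) <= e ^+ 2 * Q.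
  rewrite /mxtrace /Q mulr_sumr; apply: ler_sum => a _.
  rewrite mxE mulr_sumr; apply: ler_sum => b _; rewrite !XE.
  have -> : X b a = X a b by rewrite -[in LHS]pX.1 mxE.
  move: (X a b) => p.
  have -> : p * (e * (tau a + tau b) + e ^+ 2 * (tau a * tau b)) *
     (p * (e * (tau b + tau a) + e ^+ 2 * (tau b * tau a))) =
     p ^+ 2 * (e * ((tau a + tau b) + e * (tau a * tau b))) ^+ 2 by ring.
  rewrite [leRHS]mulrCA; apply: ler_wpM2l; first exact: sqr_ge0.
  rewrite exprMn; apply: ler_wpM2l; first exact: sqr_ge0.
  by apply: indic_sq_le9; rewrite ?(ltW e0)// /tau; case: (_ \in _); by [right|left].
have C10 : 0 <= C1.
  rewrite divr_ge0 ?exprn_ge0 ?ltW// ltr_wpDr// mulr_ge0//; exact: sumr_ge0.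
move=> /(ler_wpM2l C10).
have := ler_wpM2l (sqr_ge0 e) (ler_norm K).
move: (\tr _) (\sum_j \sum_i O i (t j) ^+ 2 * ln (x 0 i)) C1 K Q `|K| C10 => a b f q h z z0.
by move: (\sum_i _) (\sum_i _) => u v; lra.
Qed.

End FirstVariation.

(** * Continuity for the topology induced by the entries *)

Section Topology.
Variable R : realType.

Lemma posdef_lower N (A : 'M[R]_N) : posdef A -> exists2 c, 0 < c &
  forall v : 'cV[R]_N, c * (v^T *m v) 0 0 <= (v^T *m A *m v) 0 0.
Proof.
move=> /posdef_spectral[U [d [U1 -> d0]]].
have S0 : 0 <= \sum_i (d 0 i)^-1 by apply: sumr_ge0 => i _; rewrite invr_ge0 ltW.
exists (1 + \sum_i (d 0 i)^-1)^-1; first by rewrite invr_gt0 ltr_wpDr.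
move=> v; have -> : v^T *m (U^T *m diag_mx d *m U) *m v = (U *m v)^T *m diag_mx d *m (U *m v).
  by rewrite trmx_mul !mulmxA.
have -> : v^T *m v = (U *m v)^T *m diag_mx (const_mx 1) *m (U *m v).
  by rewrite diag_const_mx mulmx1 trmx_mul -mulmxA (mulmxA U^T) U1 mul1mx.
rewrite !quad_diag mulr_sumr; apply: ler_sum => i _; rewrite mxE mul1r.
apply: ler_wpM2r; first exact: sqr_ge0.
rewrite -[leRHS]invrK lef_pV2 ?posrE ?invr_gt0 ?ltr_wpDr//.
rewrite (bigD1 i)//= addrCA lerDl addr_ge0//; apply: sumr_ge0 => j _.
by rewrite invr_ge0 ltW.
Qed.

Lemma spectral_lower N (V : 'M[R]_N) (y : 'rV[R]_N) (c : R) : V^T *m V = 1%:M ->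
  (forall v : 'cV[R]_N, c * (v^T *m v) 0 0 <= (v^T *m (V^T *m diag_mx y *m V) *m v) 0 0) ->
  forall i, c <= y 0 i.
Proof.
move=> V1 h i; have := h (V^T *m delta_mx i 0); have V2 := mulmx1C V1.
have -> : (V^T *m delta_mx i 0)^T *m (V^T *m delta_mx i 0) =
   (delta_mx i 0)^T *m diag_mx (const_mx 1) *m delta_mx i 0 :> 'M[R]_1.
  by rewrite trmx_mul trmxK diag_const_mx mulmx1 -mulmxA (mulmxA V) V2 mul1mx.
have -> : (V^T *m delta_mx i 0)^T *m (V^T *m diag_mx y *m V) *m (V^T *m delta_mx i 0) =
   (delta_mx i 0)^T *m diag_mx y *m delta_mx i 0 :> 'M[R]_1.
  have -> : (V^T *m delta_mx i 0)^T *m (V^T *m diag_mx y *m V) *m (V^T *m delta_mx i 0) =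
   (delta_mx i 0)^T *m (V *m V^T) *m diag_mx y *m (V *m V^T) *m delta_mx i 0 :> 'M[R]_1.
    by rewrite trmx_mul trmxK !mulmxA.
  by rewrite V2 !mulmx1.
have d1 (z : 'rV[R]_N) : ((delta_mx i 0)^T *m diag_mx z *m delta_mx i 0 : 'M[R]_1) 0 0 = z 0 i.
  rewrite quad_diag (bigD1 i)//= big1 ?addr0.
    by rewrite mxE !eqxx expr1n mulr1.
  by move=> j ji; rewrite mxE (negPf ji) expr0n mulr0.
by rewrite !d1 mxE mulr1.
Qed.

Lemma near_entries N (A : pdmx R N) (e : R) : 0 < e ->
  \forall B \near A, forall i j, `|mx_of_pd B i j - mx_of_pd A i j| < e.
Proof.
move=> e0.
have cs : continuous (@mx_of_pd R N) by exact: initial_continuous.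
apply: (cs A [set X : 'M[R]_N | forall i j, `|X i j - mx_of_pd A i j| < e]).
exists (fun i j => ball (mx_of_pd A i j) e) => [i j|X h i j /=].
  exact: nbhsx_ballx.
by rewrite distrC; exact: h.
Qed.

Lemma continuous_mx (T : topologicalType) m n (f : T -> 'M[R]_(m, n)) :
  (forall i j, continuous (fun t => f t i j)) -> continuous f.
Proof.
move=> cf t U [P PN PU]; rewrite /= nbhs_simpl /=.
apply: (@filterS _ _ _ [set s | forall i j, P i j (f s i j)]).
  by move=> s h; apply: PU.
apply: filter_forall => i; apply: filter_forall => j.
exact: (cf i j t _ (PN i j)).
Qed.

Lemma continuous_pd (T : topologicalType) N (f : T -> pdmx R N) :
  (forall i j, continuous (fun t => mx_of_pd (f t) i j)) -> continuous f.
Proof. by move=> cf; apply: continuous_comp_initial; exact: continuous_mx. Qed.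

Lemma continuous_posrow (T : topologicalType) N (f : T -> posrow R N) :
  (forall j, continuous (fun t => row_of_pos (f t) 0 j)) -> continuous f.
Proof.
move=> cf; apply: continuous_comp_initial; apply: continuous_mx => i j.
by rewrite ord1; exact: cf.
Qed.

Lemma posrow_coord_continuous N j : continuous (fun a : posrow R N => row_of_pos a 0 j).
Proof.
move=> a; apply: (@continuous_comp _ _ _ (@row_of_pos R N) (fun x : 'rV[R]_N => x 0 j)).
  exact: initial_continuous.
exact: coord_continuous.
Qed.

Lemma sum_sq_le N (x : 'cV[R]_N) (D : 'M[R]_N) (e : R) : 0 <= e ->
  (forall i j, `|D i j| <= e) ->
  `|(x^T *m D *m x) 0 0| <= e * (N%:R * (x^T *m x) 0 0).
Proof.
move=> e0 De.
have -> : (x^T *m D *m x) 0 0 = \sum_j \sum_i x i 0 * D i j * x j 0.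
  rewrite mxE; apply: eq_bigr => j _; rewrite mxE mulr_suml.
  by apply: eq_bigr => i _; rewrite mxE.
apply: le_trans (_ : e * (\sum_i `|x i 0|) ^+ 2 <= _).
  rewrite expr2 mulr_suml mulr_sumr; apply: le_trans (ler_norm_sum _ _ _) _.
  apply: ler_sum => j _; rewrite mulr_sumr mulr_sumr.
  apply: le_trans (ler_norm_sum _ _ _) _; apply: ler_sum => i _.
  have := ler_wpM2r (mulr_ge0 (normr_ge0 (x i 0)) (normr_ge0 (x j 0))) (De i j).
  rewrite !normrM; move: `|x i 0| `|x j 0| `|D i j| => a b d; lra.
apply: ler_wpM2l => //.
have := sum_CS (fun i : 'I_N => `|x i 0|) (fun _ => 1).
under eq_bigr do rewrite mulr1.
move/le_trans; apply; rewrite mulrC.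
under eq_bigr do rewrite expr1n.
rewrite sumr_const card_ord; apply: ler_wpM2l => //.
rewrite mxE; apply: ler_sum => i _; rewrite mxE -expr2.
by rewrite -normrX ger0_norm ?sqr_ge0.
Qed.

Lemma riem_dist_le_sum N (A B : pdmx R N) (M : 'M[R]_N) (d : 'rV[R]_N) :
  M \in unitmx -> mx_of_pd A = M^T *m M -> mx_of_pd B = M^T *m diag_mx d *m M ->
  riem_dist A B <= \sum_i `|ln (d 0 i)|.
Proof.
move=> uM AE BE; have h : 0 <= \sum_i `|ln (d 0 i)| by exact: sumr_ge0.
rewrite -(@ler_pXn2r _ 2) ?nnegrE ?riem_dist_ge0// (riem_dist_sq uM AE BE).
rewrite [leRHS]expr2 mulr_suml; apply: ler_sum => i _.
rewrite -[leLHS]ger0_norm ?sqr_ge0// normrX expr2 ler_wpM2l//.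
by rewrite (bigD1 i)//= lerDl sumr_ge0.
Qed.

(** Entrywise closeness forces the eigenvalues of B relative to A close to 1, because A is bounded
    below by a positive multiple of the identity. *)
Lemma near_riem_dist N (A : pdmx R N) (e : R) : 0 < e ->
  \forall B \near A, riem_dist A B < e.
Proof.
move=> e0; have [c c0 cA] := posdef_lower (pdP A).
(* N + 1 rather than N keeps the divisions meaningful when N = 0. *)
pose K : R := N.+1%:R; have K0 : 0 < K by rewrite ltr0n.
pose w := Num.min 2^-1 (e / (4 * K)).
have w0 : 0 < w by rewrite lt_min invr_gt0 ltr0n divr_gt0// mulr_gt0.
have ec0 : 0 < w * c / K by rewrite divr_gt0 ?mulr_gt0.
have := near_entries A ec0; apply: filterS => B h.
have [M [d [uM AE BE d0 _]]] := pd_rep A B.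
apply: le_lt_trans (riem_dist_le_sum uM AE BE) _.
have d1 i : `|d 0 i - 1| <= w.
  (* x is a unit vector for A with value d_i for B, so d_i - 1 is the form B - A at x, where |x|^2
     <= 1 / c. *)
  pose x := invmx M *m delta_mx i 0 : 'cV[R]_N.
  have Mx : M *m x = delta_mx i 0 by rewrite /x mulKVmx.
  have xD (z : 'rV[R]_N) : (x^T *m (M^T *m diag_mx z *m M) *m x) 0 0 = z 0 i.
    have -> : x^T *m (M^T *m diag_mx z *m M) *m x = (M *m x)^T *m diag_mx z *m (M *m x).
      by rewrite (trmx_mul M x) !mulmxA.
    rewrite Mx quad_diag (bigD1 i)//= big1 ?addr0.
      by rewrite mxE !eqxx expr1n mulr1.
    by move=> j ji; rewrite mxE (negPf ji) expr0n mulr0.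
  have xA : (x^T *m mx_of_pd A *m x) 0 0 = 1.
    by have := xD (const_mx 1); rewrite diag_const_mx mulmx1 -AE [RHS]mxE.
  have xB : (x^T *m mx_of_pd B *m x) 0 0 = d 0 i by rewrite BE xD.
  have -> : d 0 i - 1 = (x^T *m (mx_of_pd B - mx_of_pd A) *m x) 0 0.
    have subE (P Q : 'M[R]_1) : (P - Q) 0 0 = P 0 0 - Q 0 0 by rewrite !mxE.
    by rewrite mulmxBr mulmxBl subE xA xB.
  have hD a b : `|(mx_of_pd B - mx_of_pd A) a b| <= w * c / K by rewrite !mxE; exact: ltW.
  apply: le_trans (sum_sq_le x (ltW ec0) hD) _.
  have xx : c * (x^T *m x) 0 0 <= 1 by rewrite -xA.
  have x0 : 0 <= (x^T *m x) 0 0.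
    by have := dot_ge0 x^T; rewrite trmxK.
  have -> : w * c / K * (N%:R * (x^T *m x) 0 0) = w * ((c * (x^T *m x) 0 0) * (N%:R / K)).
    by field; rewrite gt_eqF.
  rewrite -[leRHS]mulr1; apply: ler_wpM2l; first exact: ltW.
  rewrite -[leRHS]mulr1; apply: ler_pM => //; first by rewrite mulr_ge0// ltW.
    by rewrite divr_ge0// ltW.
  by rewrite ler_pdivrMr// mul1r ler_nat.
apply: le_lt_trans (_ : \sum_(i < N) (e / (2 * K)) < e).
  apply: ler_sum => i _; apply: le_trans (ln_dist1 _) _.
    by apply: le_trans (d1 i) _; rewrite ge_min lexx.
  apply: le_trans (_ : 2 * w <= _); first by rewrite ler_pM2l.
  have : w <= e / (4 * K) by rewrite ge_min lexx orbT.
  have -> : e / (2 * K) = 2 * (e / (4 * K)) by field; rewrite gt_eqF.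
  by rewrite ler_pM2l.
rewrite sumr_const card_ord.
have -> : e / (2 * K) *+ N = e * (N%:R / (2 * K)).
  by rewrite -[LHS]mulr_natr; field; rewrite gt_eqF.
rewrite -[ltRHS]mulr1 ltr_pM2l// ltr_pdivrMr ?mul1r ?mulr_gt0//.
rewrite /K -natr1; have : 0 <= N%:R :> R by []. lra.
Qed.

Lemma continuous_lip N (f : pdmx R N -> R) (L : R) :
  (forall A B, `|f A - f B| <= L * riem_dist A B) -> continuous f.
Proof.
move=> fL A; apply/(@cvgrPdist_lt _ _ _ _ (nbhs_filter A)) => e e0.
have l0 : 0 < e / (`|L| + 1) by rewrite divr_gt0// ltr_wpDl.
have := near_riem_dist A l0; apply: filterS => B h.
apply: le_lt_trans (fL A B) _.
apply: le_lt_trans (_ : (`|L| + 1) * riem_dist A B < e).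
  by apply: ler_wpM2r; rewrite ?riem_dist_ge0// (le_trans (ler_norm L))// lerDl.
by rewrite mulrC -ltr_pdivlMr// ltr_wpDl.
Qed.

Lemma riem_dist_lip N (z A B : pdmx R N) :
  `|riem_dist z A - riem_dist z B| <= riem_dist A B.
Proof.
have := riem_dist_triangle B z A; have := riem_dist_triangle A z B.
by rewrite (riem_dist_sym B A) ler_norml; lra.
Qed.

Lemma riem_dist_continuous N (z : pdmx R N) : continuous (riem_dist z).
Proof.
by apply: (@continuous_lip _ _ 1) => A B; rewrite mul1r riem_dist_lip.
Qed.

Lemma ln_symp_continuous n m (mn : (m <= n)%N) : continuous (@ln_symp R n m mn).
Proof. exact: continuous_lip (ln_symp_lip mn). Qed.

Lemma symp_eig_top n m (mn : (m.+1 <= n)%N) (A : pdmx R (n + n)) :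
  symp_eig A 0 (top_idx mn ord_max) = expR (ln_symp mn A - ln_symp (ltnW mn) A).
Proof.
rewrite expRB /ln_symp !lnK ?posrE ?symp_prod_gt0//.
have -> : symp_prod mn A = symp_prod (ltnW mn) A * symp_eig A 0 (top_idx mn ord_max).
  rewrite /symp_prod big_ord_recr /=; congr (_ * _).
  by apply: eq_bigr => j _; congr (_ 0 _); apply/val_inj.
by rewrite mulrAC mulfV ?mul1r// gt_eqF// symp_prod_gt0.
Qed.

(** Each entry is a quotient of consecutive products s_m, whose logarithms are Lipschitz for the
    distance. *)
Lemma dhat_continuous n : continuous (@dhat R n).
Proof.
apply: continuous_posrow => i.
have -> : (fun A : pdmx R (n + n) => row_of_pos (dhat A) 0 i) =
    (fun A => expR (ln_symp (ltn_ord (half_ord i)) A - ln_symp (ltnW (ltn_ord (half_ord i))) A)).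
  apply/funext => A; rewrite dhatE mxE -symp_eig_top; congr (_ 0 _); exact/val_inj.
move=> A; apply: continuous_comp; last exact: continuous_expR.
by apply: continuousB; exact: ln_symp_continuous.
Qed.

(** For y <= x and r <= 1, x^r <= y^r (x / y), so x^r - y^r <= y^(r-1) (x - y), and y^(r-1) <=
    c^(r-1). *)
Lemma powR_lip (r c x y : R) : 0 < r <= 1 -> 0 < c -> c <= x -> c <= y ->
  (x `^ r - y `^ r) ^+ 2 <= (c `^ (r - 1)) ^+ 2 * (x - y) ^+ 2.
Proof.
move=> /andP[r0 r1] c0.
wlog yx : x y / y <= x => [h cx cy|cx cy].
  have [yx|/ltW xy] := leP y x; first exact: h.
  by rewrite -sqrrN opprB -[(x - y) ^+ 2]sqrrN opprB; exact: h.
have y0 : 0 < y by lra. have x0 : 0 < x by lra.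
rewrite -exprMn ler_pXn2r ?nnegrE//.
- have : x `^ r <= y `^ r * (x / y).
    have xy1 : 1 <= x / y by rewrite ler_pdivlMr// mul1r.
    have -> : x `^ r = y `^ r * (x / y) `^ r.
      rewrite -powRM ?divr_ge0 ?ltW//; congr powR; by field; rewrite gt_eqF.
    rewrite ler_pM2l ?powR_gt0// -[leRHS]powRr1 ?divr_ge0 ?(ltW x0) ?(ltW y0)//.
    exact: ler_powR.
  have e : y `^ r * (x / y) - y `^ r = y `^ (r - 1) * (x - y).
    have -> : y `^ (r - 1) = y `^ r / y.
      by rewrite powRD ?powRN ?powRr1 ?ltW//; apply/implyP => _; rewrite gt_eqF.
    by field; rewrite gt_eqF.
  have : y `^ (r - 1) * (x - y) <= c `^ (r - 1) * (x - y).
    apply: ler_wpM2r; first lra.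
    rewrite -(opprB 1 r) !powRN lef_pV2 ?posrE ?powR_gt0//.
    by apply: ge0_ler_powR; rewrite ?nnegrE ?(ltW c0) ?(ltW y0) ?subr_ge0.
  lra.
- by rewrite subr_ge0; apply: ge0_ler_powR; rewrite ?nnegrE ?(ltW r0) ?(ltW x0) ?(ltW y0).
- by rewrite mulr_ge0 ?powR_ge0//; lra.
Qed.

(** Double spectral sums transfer the scalar Lipschitz bound of [powR_lip] to the Frobenius norms of
    the differences, which control the entries. *)
Lemma pd_pow_continuous N (r : R) : 0 < r <= 1 -> continuous (@pd_pow R N r).
Proof.
move=> r01; apply: continuous_pd => i j A; apply/(@cvgrPdist_lt _ _ _ _ (nbhs_filter A)) => e e0.
have [c c0 cA] := posdef_lower (pdP A).
(* At distance less than 1 from A the form of B is at least that of A divided by the constant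
   [expR 1], so c1 bounds both spectra from below. *)
pose c1 := c / expR 1; have c10 : 0 < c1 by rewrite divr_gt0 ?expR_gt0.
pose L := c1 `^ (r - 1); have L0 : 0 < L by rewrite powR_gt0.
pose K : R := N.+1%:R; have K0 : 0 < K by rewrite ltr0n.
have d0 : 0 < e / (L * K) by rewrite divr_gt0 ?mulr_gt0.
have h1 := near_riem_dist A ltr01; have h2 := near_entries A d0.
near=> B.
have AB : riem_dist A B < 1 by near: B.
have entB : forall a b, `|mx_of_pd B a b - mx_of_pd A a b| < e / (L * K) by near: B.
have [Q [x [Q1 AE x0]]] := posdef_spectral (pdP A).
have [V [y [V1 BE y0]]] := posdef_spectral (pdP B).
have e1 : 1 <= expR 1 :> R by rewrite -expR0 ler_expR.
have cx i' : c1 <= x 0 i'.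
  apply: (spectral_lower Q1) => v; rewrite -AE; apply: le_trans (cA v).
  have v0 : 0 <= (v^T *m v) 0 0 by have := dot_ge0 v^T; rewrite trmxK.
  by apply: ler_wpM2r => //; rewrite ler_pdivrMr ?expR_gt0// ler_peMr// ltW.
have cy i' : c1 <= y 0 i'.
  apply: (spectral_lower V1) => v; rewrite -BE.
  have v0 : 0 <= (v^T *m v) 0 0 by have := dot_ge0 v^T; rewrite trmxK.
  have vB : 0 <= (v^T *m mx_of_pd B *m v) 0 0.
    by have [->|/((pdP B).2)/ltW//] := eqVneq v 0; rewrite mulmx0 mxE.
  have := quad_riem_le B A v; rewrite riem_dist_sym => h.
  rewrite /c1 mulrAC ler_pdivrMr ?expR_gt0//; apply: le_trans (cA v) _.
  apply: le_trans h _; rewrite mulrC; apply: ler_wpM2l => //.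
  by rewrite ler_expR ltW.
have sA := pd_pow_spectral r Q1 AE; have sB := pd_pow_spectral r V1 BE.
have T1 := trace_sq_diff V1 Q1 x y; rewrite -AE -BE in T1.
have T2 := trace_sq_diff V1 Q1 (map_mx (fun z => z `^ r) x) (map_mx (fun z => z `^ r) y).
rewrite -sA -sB in T2.
have T3 : \tr ((mx_of_pd (pd_pow r B) - mx_of_pd (pd_pow r A)) *m
   (mx_of_pd (pd_pow r B) - mx_of_pd (pd_pow r A))) <= L ^+ 2 *
   \tr ((mx_of_pd B - mx_of_pd A) *m (mx_of_pd B - mx_of_pd A)).
  rewrite T1 T2 mulr_sumr; apply: ler_sum => a _; rewrite mulr_sumr; apply: ler_sum => b _.
  rewrite [leRHS]mulrCA; apply: ler_wpM2l; first exact: sqr_ge0.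
  by rewrite !mxE; exact: powR_lip.
have trsym (X : 'M[R]_N) : X^T = X -> \tr (X *m X) = \sum_a \sum_b X a b ^+ 2.
  move=> sX; apply: eq_bigr => a _; rewrite mxE; apply: eq_bigr => b _.
  have -> : X b a = X a b by rewrite -{1}sX mxE.
  by rewrite expr2.
have sdiff (X Y : pdmx R N) : (mx_of_pd X - mx_of_pd Y)^T = mx_of_pd X - mx_of_pd Y.
  by rewrite linearB /= (pdP X).1 (pdP Y).1.
rewrite !trsym// in T3.
rewrite distrC -(@ltr_pXn2r _ 2) ?nnegrE ?(ltW e0)//.
apply: le_lt_trans (_ : \sum_a \sum_b (mx_of_pd (pd_pow r B) - mx_of_pd (pd_pow r A)) a b ^+ 2 < _).
  rewrite (bigD1 i)//= (bigD1 j)//= -normrX ger0_norm ?sqr_ge0//.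
  rewrite [X in X ^+ 2 + _]mxE [X in (_ + X) ^+ 2 + _]mxE -addrA lerDl addr_ge0//.
    by apply: sumr_ge0 => b _; rewrite sqr_ge0.
  by apply: sumr_ge0 => a _; apply: sumr_ge0 => b _; rewrite sqr_ge0.
apply: le_lt_trans T3 _.
apply: le_lt_trans (_ : L ^+ 2 * (\sum_(a < N) \sum_(b < N) (e / (L * K)) ^+ 2) < _).
  apply: ler_wpM2l; first exact: sqr_ge0.
  apply: ler_sum => a _; apply: ler_sum => b _; rewrite !mxE.
  rewrite -[leLHS]ger0_norm ?sqr_ge0// normrX ler_pXn2r ?nnegrE//; last exact: ltW.
  exact: ltW.
have -> (w : R) : \sum_(a < N) \sum_(b < N) w = w * N%:R * N%:R.
  by rewrite !sumr_const !card_ord !mulr_natr.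
have -> : L ^+ 2 * ((e / (L * K)) ^+ 2 * N%:R * N%:R) = e ^+ 2 * (N%:R / K) ^+ 2.
  by field; rewrite !gt_eqF.
rewrite -[ltRHS]mulr1 ltr_pM2l ?exprn_gt0// expr_lt1//; last by rewrite divr_ge0// ltW.
by rewrite ltr_pdivrMr// mul1r ltr_nat.
Unshelve. all: by end_near. Qed.

End Topology.

(** * Measurability of continuous maps and integration against a probability *)

Section Borel.

Lemma continuous_borel (S T : ptopologicalType) (f : S -> T) : continuous f ->
  measurable_fun setT (f : borel S -> borel T).
Proof.
move=> /continuousP cf; apply: (measurability _ (erefl : @measurable _ (borel T) = <<s @open T >>)).
move=> _ [U oU <-]; rewrite setTI; apply: sub_sigma_algebra; exact: cf.
Qed.

Lemma continuous_borel_real (R : realType) (S : ptopologicalType) (f : S -> R) : continuous f ->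
  measurable_fun setT (f : borel S -> R).
Proof.
move=> /continuousP cf; apply: (measurability _ (RGenOpens.measurableE R)).
move=> _ [_ [a [b ->]] <-]; rewrite setTI; apply: sub_sigma_algebra; apply: cf.
exact: interval_open.
Qed.

End Borel.

Section Expectation.
Context d (T : measurableType d) (R : realType) (mu : probability T R).
Local Notation intg f := (mu.-integrable setT (EFin \o f)).
Local Notation E f := (Rintegral mu setT f).

Lemma intg_meas (f : T -> R) : intg f -> measurable_fun setT f.
Proof. by case/integrableP => /measurable_EFinP. Qed.

Lemma intg_cst (c : R) : intg (fun=> c).
Proof.
by apply: finite_measure_integrable_cst.
Qed.

Lemma intgD (f g : T -> R) : intg f -> intg g -> intg (fun t => f t + g t).
Proof. by move=> h1 h2; have := integrableD measurableT h1 h2; apply: eq_integrable. Qed.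

Lemma intgB (f g : T -> R) : intg f -> intg g -> intg (fun t => f t - g t).
Proof. by move=> h1 h2; have := integrableB measurableT h1 h2; apply: eq_integrable. Qed.

Lemma intgZ (c : R) (f : T -> R) : intg f -> intg (fun t => c * f t).
Proof. by move=> h1; have := integrableZl measurableT c h1; apply: eq_integrable. Qed.

Lemma intg_le (f g : T -> R) : measurable_fun setT f -> (forall t, `|f t| <= g t) ->
  intg g -> intg f.
Proof.
move=> mf fg; apply: le_integrable => //; first exact/measurable_EFinP.
by move=> t _ /=; rewrite lee_fin (le_trans (fg t))// ler_norm.
Qed.

Lemma intg_norm (f : T -> R) : intg f -> intg (fun t => `|f t|).
Proof. by move=> h; have := integrable_norm h. Qed.

Lemma E_cst (c : R) : E (fun=> c) = c.
Proof.
rewrite Rintegral_cst; last exact: measurableT.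
have -> : fine (mu [set: T]) = 1 by have := probability_setT mu => /= ->.
by rewrite mulr1.
Qed.

Lemma E_le (f g : T -> R) : intg f -> intg g -> (forall t, f t <= g t) -> E f <= E g.
Proof. by move=> h1 h2 fg; apply: le_Rintegral. Qed.

Lemma intgE (f : T -> R) : intg f -> (\int[mu]_t (f t)%:E)%E = (E f)%:E.
Proof. by move=> h; rewrite /Rintegral fineK//; exact: integrable_fin_num. Qed.

(* Truncating [h n] from below by [F] turns the limsup bound into pointwise
   convergence, to which dominated convergence applies. *)
Lemma reverse_fatou_ge0 (h : nat -> T -> R) (F G : T -> R) :
  intg F -> intg G -> (forall n, measurable_fun setT (h n)) ->
  (forall n t, `|h n t| <= G t) ->
  (forall t, exists C, forall n, h n t <= F t + C / n.+1%:R) ->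
  (forall n, 0 <= E (h n)) -> 0 <= E F.
Proof.
move=> iF iG mh hG hF Eh; pose k n t := Num.max (h n t) (F t).
have mk n : measurable_fun setT (k n).
  by apply: measurable_maxr => //; exact: intg_meas.
have kG n t : `|k n t| <= G t + `|F t|.
  have G0 : 0 <= G t by apply: le_trans (hG n t).
  rewrite /k maxEle; case: ifP => _; first by rewrite lerDr.
  by apply: le_trans (hG n t) _; rewrite lerDl.
have iGF : intg (fun t => G t + `|F t|) by apply: intgD => //; exact: intg_norm.
have ik n : intg (k n) by apply: intg_le (mk n) (kG n) iGF.
have kF t : (fun n => k n t) @ \oo --> F t.
  have [C hC] := hF t.
  apply/cvgrPdist_le => e e0.
  have n0 : \forall n \near \oo, `|C| / n.+1%:R <= e.
    exists (Num.bound (`|C| / e)) => // n /= hn.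
    rewrite ler_pdivrMr ?ltr0n// mulrC -ler_pdivrMr//.
    apply: le_trans (ltW (archi_boundP _)) _; first by rewrite divr_ge0// ltW.
    by rewrite ler_nat (leq_trans hn).
  near=> n; rewrite distrC.
  have Fk : F t <= k n t by rewrite /k le_max lexx orbT.
  rewrite ger0_norm ?subr_ge0// lerBlDl /k ge_max lerDl (ltW e0) andbT.
  apply: le_trans (hC n) _; rewrite lerD2l; apply: le_trans (_ : `|C| / n.+1%:R <= _).
    by rewrite ler_wpM2r ?invr_ge0// ler_norm.
  by near: n.
have := @dominated_convergence _ T R mu setT measurableT (fun n => EFin \o k n) (EFin \o F)
  (fun t => (G t + `|F t|)%:E).
case.
- by move=> n; exact/measurable_EFinP.
- by apply/measurable_EFinP; exact: intg_meas.
- by apply/aeW => t _; apply/cvg_EFin; [near=> n|exact: kF].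
- exact: iGF.
- by apply/aeW => t n _ /=; rewrite lee_fin.
move=> _ _; under eq_fun do rewrite intgE//.
rewrite intgE// => hc; rewrite -lee_fin; apply: (cvge_ge _ hc).
near=> n; rewrite lee_fin; apply: le_trans (Eh n) _; apply: E_le => //.
  by apply: intg_le (mh n) (hG n) iG.
by move=> t; rewrite /k le_max lexx.
Unshelve. all: by end_near. Qed.

End Expectation.

(** * Compact sets of positive definite matrices *)

Section Compactness.
Variable R : realType.

Lemma compact_mx_box N (b : R) : compact [set X : 'M[R]_N | forall i j, `|X i j| <= b].
Proof.
pose B : set 'rV[R]_(N * N) := [set v | forall i, `[- b, b]%classic (v ord0 i)].
have cB : compact B.
  move=> F PF FB; exact: (@rV_compact R (N * N) (fun=> `[- b, b]%classic)
    (fun=> @segment_compact R (- b) b) F PF FB).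
have cv : continuous (@vec_mx R N N).
  apply: continuous_mx => i j.
  have -> : (fun v : 'rV[R]_(N * N) => vec_mx v i j) = (fun v => v 0 (mxvec_index i j)).
    by apply/funext => v; rewrite mxE.
  exact: coord_continuous.
have -> : [set X : 'M[R]_N | forall i j, `|X i j| <= b] = (@vec_mx R N N) @` B.
  apply/seteqP; split => [X hX|_ [v vB <-] i j].
    exists (mxvec X); last by rewrite mxvecK.
    by move=> k; case/mxvec_indexP: k => i j; rewrite mxvecE /= in_itv /= -ler_norml.
  by have := vB (mxvec_index i j); rewrite /= in_itv /= -ler_norml mxE.
apply: (@continuous_compact _ _ (@vec_mx R N N) B) => //.
exact: continuous_subspaceT.
Qed.

(** The Loewner order interval between a and b times the identity, written with quadratic forms so
    that it is visibly an intersection of closed conditions. *)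
Definition sandwich N (a b : R) : set 'M[R]_N := [set X | X^T = X /\
  forall x : 'cV[R]_N, a * (x^T *m x) 0 0 <= (x^T *m X *m x) 0 0 <= b * (x^T *m x) 0 0].

Lemma continuous_sum (T : topologicalType) (I : Type) (s : seq I) (f : I -> T -> R) :
  (forall i, continuous (f i)) -> continuous (fun x => \sum_(i <- s) f i x).
Proof.
move=> cf; elim: s => [|i s IH] x.
  by under eq_fun do rewrite big_nil; exact: cvg_cst.
under eq_fun do rewrite big_cons.
exact: (@continuousD R R^o T (f i) (fun x => \sum_(j <- s) f j x) x (cf i x) (IH x)).
Qed.

Lemma quad_continuous N (x : 'cV[R]_N) : continuous (fun X : 'M[R]_N => (x^T *m X *m x) 0 0).
Proof.
have -> : (fun X : 'M[R]_N => (x^T *m X *m x) 0 0) =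
    (fun X => \sum_j \sum_i x i 0 * X i j * x j 0).
  apply/funext => X; rewrite mxE; apply: eq_bigr => j _; rewrite mxE mulr_suml.
  by apply: eq_bigr => i _; rewrite mxE.
apply: continuous_sum => j; apply: continuous_sum => i X.
apply: (@continuousM R _ (fun X : 'M[R]_N => x i 0 * X i j) (fun=> x j 0) X); last exact: cst_continuous.
apply: (@continuousM R _ (fun=> x i 0) (fun X : 'M[R]_N => X i j) X); first exact: cst_continuous.
exact: coord_continuous.
Qed.

(** Polarization: evaluate the form at the sum and the difference of the basis vectors i and j. *)
Lemma sandwich_box N (a b : R) (X : 'M[R]_N) : 0 <= a -> sandwich a b X -> forall i j, `|X i j| <= b.
Proof.
move=> a0 [XT h] i j.
have q (Y : 'M[R]_N) (s : R) : Y^T = Y ->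
   ((delta_mx i 0 + s *: delta_mx j 0)^T *m Y *m (delta_mx i 0 + s *: delta_mx j 0) : 'M[R]_1) 0 0 =
   Y i i + 2 * s * Y i j + s ^+ 2 * Y j j.
  move=> YT; have -> : (delta_mx i 0 + s *: delta_mx j 0)^T = delta_mx 0 i + s *: delta_mx 0 j :> 'rV[R]_N.
    by apply/matrixP => u v; rewrite !mxE andbC [(v == j) && _]andbC.
  rewrite !(mulmxDl, mulmxDr) -?(scalemxAl, scalemxAr) -!rowE -!colE.
  rewrite !mxE; have -> : Y i j = Y j i by rewrite -[in LHS]YT mxE.
  ring.
have q1 (s : R) : ((delta_mx i 0 + s *: delta_mx j 0)^T *m (delta_mx i 0 + s *: delta_mx j 0) : 'M[R]_1) 0 0 =
   1 + 2 * s * (i == j)%:R + s ^+ 2.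
  have := q 1%:M s (trmx1 _ _); rewrite mulmx1 => ->; rewrite !mxE !eqxx !mulr1n; ring.
have := h (delta_mx i 0 + 1 *: delta_mx j 0); have := h (delta_mx i 0 + (-1) *: delta_mx j 0).
rewrite !q// !q1 ler_norml.
have [->|_] := eqVneq i j; [move: (X j j) => x|move: (X i j) (X i i) (X j j) => x y z].
  by move=> /andP[h1 h2] /andP[h3 h4]; rewrite !mulr1n in h1 h2 h3 h4; apply/andP; split; lra.
by move=> /andP[h1 h2] /andP[h3 h4]; rewrite !mulr0n in h1 h2 h3 h4; apply/andP; split; lra.
Qed.

Lemma closed_sandwich N (a b : R) : closed (@sandwich N a b).
Proof.
have -> : @sandwich N a b = (\bigcap_(i in [set: 'I_N]) \bigcap_(j in [set: 'I_N])
     [set X : 'M[R]_N | X i j - X j i = 0]) `&`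
   \bigcap_(x in [set: 'cV[R]_N]) ([set X : 'M[R]_N | a * (x^T *m x) 0 0 <= (x^T *m X *m x) 0 0] `&`
     [set X : 'M[R]_N | (x^T *m X *m x) 0 0 <= b * (x^T *m x) 0 0]).
  apply/seteqP; split => X.
    move=> [XT h]; split.
      move=> i _ j _ /=; have -> : X i j = X j i by rewrite -[in LHS]XT mxE.
      exact: subrr.
    by move=> x _; split; case/andP: (h x).
  move=> [XT h]; split.
    by apply/matrixP => i j; rewrite mxE; apply/eqP; rewrite -subr_eq0 (XT j _ i).
  by move=> x; apply/andP; exact: h x I.
apply: closedI.
  apply: closed_bigI => i _; apply: closed_bigI => j _.
  apply: (@preimage_closed _ R (fun X : 'M[R]_N => X i j - X j i) [set x | x = 0]); last exact: closed_eq.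
  move=> X _; apply: (@continuousB R R^o _ (fun X : 'M[R]_N => X i j)
    (fun X : 'M[R]_N => X j i)); exact: coord_continuous.
apply: closed_bigI => x _; apply: closedI.
  apply: (@preimage_closed _ R (fun X : 'M[R]_N => (x^T *m X *m x) 0 0)
    [set y | a * (x^T *m x) 0 0 <= y]); last exact: closed_ge.
  by move=> X _; exact: quad_continuous.
apply: (@preimage_closed _ R (fun X : 'M[R]_N => (x^T *m X *m x) 0 0)
  [set y | y <= b * (x^T *m x) 0 0]); last exact: closed_le.
by move=> X _; exact: quad_continuous.
Qed.

Lemma compact_sandwich N (a b : R) : 0 <= a -> compact (@sandwich N a b).
Proof.
move=> a0; apply: (subclosed_compact (@closed_sandwich N a b) (@compact_mx_box N b)).
by move=> X hX; exact: (sandwich_box a0 hX).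
Qed.

(** A cluster point among all matrices stays in the closed interval, and a > 0 makes it positive
    definite; the induced topology then carries clustering back to the subtype. *)
Lemma compact_pd_sandwich N (a b : R) : 0 < a ->
  compact [set A : pdmx R N | sandwich a b (mx_of_pd A)].
Proof.
move=> a0 F PF FC.
pose G := fmap (@mx_of_pd R N) F.
have [p [[pT hp] clp]] : (@sandwich N a b) `&` cluster G !=set0.
  exact: (@compact_sandwich N a b (ltW a0) G _ FC).
have pp : posdef p.
  split=> // x x0; apply: lt_le_trans (andP (hp x)).1; rewrite mulr_gt0//.
  by have := dot_gt0 (_ : x^T != 0); rewrite trmxK; apply; rewrite trmx_eq0.
exists (pd_of pp); split; first by rewrite /= pd_ofK.
move=> B U FB; rewrite nbhsE => -[W [[V oV VW] WA] WU].
have [_ [[c Bc <-] Vc]] : (@mx_of_pd R N @` B) `&` V !=set0.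
  apply: clp.
    by apply: (@filterS _ F _ B) FB => c Bc; exists c.
  apply: open_nbhs_nbhs; split => //.
  by move: WA; rewrite -VW /= -[set_val _]/(mx_of_pd _) pd_ofK.
by exists c; split => //; apply: WU; rewrite -VW.
Qed.

Lemma riem_ball_sandwich N (A I : pdmx R N) (rho : R) : mx_of_pd I = 1%:M ->
  riem_dist I A <= rho -> sandwich (expR (- rho)) (expR rho) (mx_of_pd A).
Proof.
move=> I1 h; split; first by case: (pdP A).
move=> x; have xx : 0 <= (x^T *m x) 0 0 by have := dot_ge0 x^T; rewrite trmxK.
apply/andP; split.
  have := quad_riem_le A I x; rewrite I1 mulmx1 riem_dist_sym => h1.
  have e1 : expR (riem_dist I A) <= expR rho by rewrite ler_expR.
  have q0 : 0 <= (x^T *m mx_of_pd A *m x) 0 0.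
    by rewrite -(pmulr_rge0 _ (expR_gt0 (riem_dist I A))); apply: le_trans h1.
  rewrite expRN mulrC ler_pdivrMr ?expR_gt0// mulrC.
  by apply: le_trans h1 _; apply: ler_wpM2r.
have := quad_riem_le I A x; rewrite I1 mulmx1 => h1; apply: le_trans h1 _.
by apply: ler_wpM2r => //; rewrite ler_expR.
Qed.

End Compactness.

(** * Existence of the barycenter *)

Section Mean.
Context d (T : measurableType d) (R : realType) (mu : probability T R) (N : nat).
Local Notation intg f := (mu.-integrable setT (EFin \o f)).
Local Notation E f := (Rintegral mu setT f).
Variable F : T -> pdmx R N.
Hypothesis mF : measurable_fun setT (F : T -> borel (pdmx R N)).
Hypothesis iF : exists z, intg (fun t => riem_dist z (F t)).

Lemma dist_meas z : measurable_fun setT (fun t => riem_dist z (F t)).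
Proof.
exact: (measurableT_comp (continuous_borel_real (@riem_dist_continuous R N z)) mF).
Qed.

Lemma dist_intg z : intg (fun t => riem_dist z (F t)).
Proof.
have [w iw] := iF; apply: (intg_le (dist_meas z) _ (intgD (intg_cst mu (riem_dist z w)) iw)).
by move=> t; rewrite ger0_norm ?riem_dist_ge0// riem_dist_triangle.
Qed.

Lemma dist_sq_diff_le (z w A : pdmx R N) : `|riem_dist w A ^+ 2 - riem_dist z A ^+ 2| <=
  riem_dist z w * (2 * riem_dist z A + riem_dist z w).
Proof.
have := riem_dist_triangle z w A; have := riem_dist_triangle w z A.
rewrite (riem_dist_sym w z).
have := riem_dist_ge0 z A; have := riem_dist_ge0 w A; have := riem_dist_ge0 z w.
move: (riem_dist z w) (riem_dist z A) (riem_dist w A) => D a b D0 b0 a0 h1 h2.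
by rewrite ler_norml; apply/andP; split; nra.
Qed.

Lemma dist_sq_diff_meas w z : measurable_fun setT
  (fun t => riem_dist w (F t) ^+ 2 - riem_dist z (F t) ^+ 2).
Proof. by apply: measurable_funB; apply: measurable_funX; exact: dist_meas. Qed.

Lemma dist_sq_bound_intg w z : intg (fun t => riem_dist z w * (2 * riem_dist z (F t) + riem_dist z w)).
Proof. by apply: intgZ; apply: intgD; [apply: intgZ; exact: dist_intg|exact: intg_cst]. Qed.

Lemma dist_sq_diff_intg w z : intg (fun t => riem_dist w (F t) ^+ 2 - riem_dist z (F t) ^+ 2).
Proof.
apply: intg_le (dist_sq_diff_meas w z) _ (dist_sq_bound_intg w z) => t.
exact: dist_sq_diff_le.
Qed.

(** A barycenter of the law of F, expressed by integrals over T; this lets the barycenter of mu^r be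
    studied with integrals against mu. *)
Definition is_mean z := forall w, 0 <= E (fun t => riem_dist w (F t) ^+ 2 - riem_dist z (F t) ^+ 2).

(** phi is continuous, vanishes at the identity and is nonnegative at distance at least 2 m(I) from
    it. The ball of that radius lies in a compact order interval, and a minimizer there is a global
    one. *)
Lemma is_mean_ex : exists z, is_mean z.
Proof.
pose I := pd_of (posdef1 R N); pose phi z := E (fun t => riem_dist z (F t) ^+ 2 - riem_dist I (F t) ^+ 2).
have phiB w z : phi w - phi z = E (fun t => riem_dist w (F t) ^+ 2 - riem_dist z (F t) ^+ 2).
  rewrite /phi -RintegralB; [|exact: measurableT|exact: dist_sq_diff_intg..].
  by apply: eq_Rintegral => t _; ring.
pose m z := E (fun t => riem_dist z (F t)).
have m0 z : 0 <= m z by apply: Rintegral_ge0 => t _; exact: riem_dist_ge0.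
have phi_lip w z : `|phi w - phi z| <= riem_dist z w * (2 * m z + riem_dist z w).
  rewrite phiB; apply: le_trans (le_normr_Rintegral _ (dist_sq_diff_intg w z)) _ => //.
  apply: le_trans (E_le (intg_norm (dist_sq_diff_intg w z)) (dist_sq_bound_intg w z) _) _.
    by move=> t; exact: dist_sq_diff_le.
  rewrite RintegralZl//; last by apply: intgD; [apply: intgZ; exact: dist_intg|exact: intg_cst].
  rewrite RintegralD//; [|by apply: intgZ; exact: dist_intg|exact: intg_cst].
  by rewrite RintegralZl ?E_cst//; exact: dist_intg.
have cphi : continuous phi.
  move=> z; apply/(@cvgrPdist_lt _ _ _ _ (nbhs_filter z)) => e e0.
  have K0 : 0 < 2 * m z + 1 by have := m0 z; lra.
  have u0 : 0 < Num.min 1 (e / (2 * m z + 1)) by rewrite lt_min ltr01 divr_gt0.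
  have := near_riem_dist z u0; apply: filterS => w; rewrite lt_min => /andP[h1 h2].
  rewrite distrC; apply: le_lt_trans (phi_lip w z) _.
  move: h2; rewrite ltr_pdivlMr// => h2; apply: le_lt_trans h2.
  by apply: ler_wpM2l; [exact: riem_dist_ge0|lra].
(* The reverse triangle inequality, squared: delta(w, A)^2 >= (D - delta(I, A))^2. *)
have phi_ge w : riem_dist I w * (riem_dist I w - 2 * m I) <= phi w.
  set D := riem_dist I w.
  have -> : D * (D - 2 * m I) = E (fun t => D * (D - 2 * riem_dist I (F t))).
    have i2 : intg (fun t => 2 * riem_dist I (F t)) by apply: intgZ; exact: dist_intg.
    rewrite RintegralZl//; last by apply: intgB => //; exact: intg_cst.
    by rewrite RintegralB ?E_cst// ?RintegralZl//; [exact: dist_intg|exact: intg_cst].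
  apply: E_le; [|exact: dist_sq_diff_intg|].
    by apply: intgZ; apply: intgB; [exact: intg_cst|apply: intgZ; exact: dist_intg].
  move=> t; have := riem_dist_triangle (F t) I w; rewrite (riem_dist_sym (F t) w) -/D.
  have := riem_dist_triangle w I (F t); rewrite -/D.
  have := riem_dist_triangle I w (F t); rewrite (riem_dist_sym w I) -/D.
  have := riem_dist_ge0 w (F t); have := riem_dist_ge0 I (F t); have : 0 <= D by exact: riem_dist_ge0.
  move: (riem_dist I (F t)) (riem_dist w (F t)) D => a b D; nra.
have phiI : phi I = 0.
  have -> : phi I = phi I - phi I + phi I by ring.
  by rewrite phiB /phi; under eq_Rintegral do rewrite subrr; rewrite E_cst addr0.
pose C := [set A : pdmx R N | sandwich (expR (- (2 * m I))) (expR (2 * m I)) (mx_of_pd A)].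
have CI : C I.
  apply: (@riem_ball_sandwich _ _ _ I); rewrite ?pd_ofK// riem_distxx.
  by rewrite mulr_ge0.
have [c cC hc] := @compact_EVT_min _ _ phi C (ex_intro _ I CI) (compact_pd_sandwich (expR_gt0 _))
   (continuous_subspaceT cphi).
exists c => w; rewrite -phiB subr_ge0.
have [wC|wC] := pselect (C w); first by apply: hc; exact/mem_set.
apply: le_trans (hc I (mem_set CI)) _; rewrite phiI; apply: le_trans (phi_ge w).
apply: mulr_ge0; first exact: riem_dist_ge0.
rewrite subr_ge0 leNgt; apply/negP => h; apply: wC; apply: riem_ball_sandwich (ltW h).
by rewrite pd_ofK.
Qed.

End Mean.

Lemma barycenter_is_mean (R : realType) d (T : measurableType d) (mu : probability T R) N
  (F : T -> pdmx R N) : measurable_fun setT (F : T -> borel (pdmx R N)) ->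
  (exists z, mu.-integrable setT (EFin \o (fun t => riem_dist z (F t)))) ->
  is_mean mu F (cartan_barycenter (@riem_dist R N) (pushforward mu (F : T -> borel (pdmx R N)))).
Proof.
move=> mF iF.
have ip w z : (\int[pushforward mu (F : T -> borel (pdmx R N))]_a
    (riem_dist w a ^+ 2 - riem_dist z a ^+ 2)%:E =
    (Rintegral mu setT (fun t => riem_dist w (F t) ^+ 2 - riem_dist z (F t) ^+ 2))%:E)%E.
  rewrite integral_pushforward//.
  - by rewrite preimage_setT /comp intgE//; exact: dist_sq_diff_intg.
  - apply/measurable_EFinP; apply: measurable_funB; apply: measurable_funX;
      apply: continuous_borel_real; exact: riem_dist_continuous.
  - by rewrite preimage_setT; exact: dist_sq_diff_intg.
have [z hz] := is_mean_ex mF iF.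
rewrite /cartan_barycenter; set G := get _.
have : [set z : pdmx R N | forall y w : pdmx R N,
    (\int[pushforward mu (F : T -> borel (pdmx R N))]_a (riem_dist z a ^+ 2 - riem_dist y a ^+ 2)%:E <=
     \int[pushforward mu (F : T -> borel (pdmx R N))]_a (riem_dist w a ^+ 2 - riem_dist y a ^+ 2)%:E)%E] G.
  apply: (@getPex (pdmx R N) _); exists z => y w; rewrite !ip lee_fin -subr_ge0.
  rewrite -RintegralB//; [|exact: dist_sq_diff_intg..].
  under eq_Rintegral do rewrite opprB addrA subrK.
  exact: hz.
(* With the reference point y taken to be G, the left integral is 0. *)
move=> hG w; have := hG G w; rewrite !ip lee_fin; apply: le_trans.
by under eq_Rintegral do rewrite subrr; rewrite E_cst.
Qed.

(** * Inequalities at the barycenter from its minimality *)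

Section MeanInequality.
Context d (T : measurableType d) (R : realType) (mu : probability T R).
Local Notation intg f := (mu.-integrable setT (EFin \o f)).
Local Notation E f := (Rintegral mu setT f).

Lemma ln_symp_intg n m (mn : (m <= n)%N) (F : T -> pdmx R (n + n)) :
  measurable_fun setT (F : T -> borel (pdmx R (n + n))) ->
  (exists z, intg (fun t => riem_dist z (F t))) ->
  intg (fun t => ln_symp mn (F t)).
Proof.
move=> mF [z iz].
apply: (intg_le _ _ (intgD (intg_cst mu `|ln_symp mn z|) (intgZ m%:R iz))).
  exact: (measurableT_comp (continuous_borel_real (@ln_symp_continuous R n m mn)) mF).
move=> t; have := ln_symp_lip mn z (F t); rewrite distrC => h.
have -> : ln_symp mn (F t) = ln_symp mn z + (ln_symp mn (F t) - ln_symp mn z) by ring.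
by apply: le_trans (ler_normD _ _) _; rewrite lerD2l.
Qed.

Lemma shrink_dist N k (t : 'I_k -> 'I_N) (M : 'M[R]_N) (e : R) (Z Ze : pdmx R N) :
  M \in unitmx -> mx_of_pd Z = M^T *m M -> 0 <= e ->
  mx_of_pd Ze = M^T *m diag_mx (map_mx (fun z => z ^- 2) (shrink t e)) *m M ->
  riem_dist Z Ze <= (2 * N%:R) * e.
Proof.
move=> uM ZE e0 ZeE; apply: le_trans (riem_dist_le_sum uM ZE ZeE) _.
have -> : (2 * N%:R) * e = \sum_(i < N) 2 * e :> R by rewrite sumr_const card_ord -[RHS]mulr_natr; ring.
apply: ler_sum => i _; rewrite mxE.
have s1 := shrink_ge1 t i e0; have s0 : 0 < shrink t e 0 i by lra.
rewrite lnV ?posrE ?exprn_gt0// lnXn// normrN normrMn ger0_norm ?ln_ge0// -[leLHS]mulr_natl.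
rewrite ler_wpM2l//; have : shrink t e 0 i <= 1 + e.
  by rewrite mxE lerD2l -[leRHS]mul1r ler_wpM2r// lern1; case: (_ \in _).
have := le_ln1Dx (x := shrink t e 0 i - 1); rewrite (addrC 1) subrK; lra.
Qed.

(* First variation of the mean along the perturbation of [Z] that shrinks the
   directions selected by [top2 mn]: its derivative is dominated by the
   subgradient of [ln_symp]. *)
Lemma mean_ln_symp_le n m (mn : (m <= n)%N) (F : T -> pdmx R (n + n)) (Z : pdmx R (n + n)) :
  measurable_fun setT (F : T -> borel (pdmx R (n + n))) ->
  (exists z, intg (fun t => riem_dist z (F t))) ->
  is_mean mu F Z -> ln_symp mn Z <= E (fun t => ln_symp mn (F t)).
Proof.
move=> mF iF hZ; have iL := ln_symp_intg mn mF iF.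
have [M [uM ZE sub]] := ln_symp_subgradient mn Z.
pose w (e : R) := map_mx (fun z => z ^- 2) (shrink (top2 mn) e).
have w0 e : 0 <= e -> forall i, 0 < w e 0 i.
  move=> e0 i; rewrite mxE invr_gt0 exprn_gt0//.
  by apply: lt_le_trans (shrink_ge1 _ i e0).
have e0 k : 0 < (k.+1%:R^-1 : R) by rewrite invr_gt0.
pose Ze k := pd_of (posdef_congr (posdef_diag (w0 _ (ltW (e0 k)))) uM).
pose K : R := 2 * (n + n)%:R.
have dZe k : riem_dist Z (Ze k) <= K / k.+1%:R.
  by apply: (shrink_dist (t := top2 mn) uM ZE (ltW (e0 k))); rewrite pd_ofK.
have K0 : 0 <= K by rewrite mulr_ge0.
pose h k t := k.+1%:R * (riem_dist (Ze k) (F t) ^+ 2 - riem_dist Z (F t) ^+ 2).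
have ih k : intg (h k) by apply: intgZ; exact: dist_sq_diff_intg.
(* The 8 is the 4 of the first variation times the 2 of the subgradient inequality. *)
have : 0 <= E (fun t => 8 * (ln_symp mn (F t) - ln_symp mn Z)).
  apply: (@reverse_fatou_ge0 _ _ _ mu h _ (fun t => K * (2 * riem_dist Z (F t) + K))).
  - by apply: intgZ; apply: intgB => //; exact: intg_cst.
  - apply: intgZ; apply: intgD; last exact: intg_cst.
    by apply: intgZ; exact: dist_intg.
  - by move=> k; exact: (intg_meas (ih k)).
  - move=> k t; rewrite normrM (ger0_norm (ler0n _ _)) mulrC.
    rewrite -ler_pdivlMr ?ltr0n//; apply: le_trans (dist_sq_diff_le _ _ _) _.
    have D1 := dZe k; have D0 := riem_dist_ge0 Z (Ze k); have a0 := riem_dist_ge0 Z (F t).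
    have D2 : riem_dist Z (Ze k) <= K.
      by apply: le_trans D1 _; rewrite ler_pdivrMr ?ltr0n// ler_peMr// ler1n.
    apply: le_trans (ler_wpM2r _ D1) _; first by rewrite addr_ge0// mulr_ge0.
    rewrite mulrAC ler_wpM2r ?invr_ge0// ler_wpM2l// lerD2l//.
  - move=> t.
    have uiM : invmx M \in unitmx by rewrite unitmx_inv.
    have [U [x [U1 XE x0]]] := posdef_spectral (posdef_congr (pdP (F t)) uiM).
    have AE : mx_of_pd (F t) = M^T *m (U^T *m diag_mx x *m U) *m M.
      by rewrite -XE !mulmxA -trmx_mul mulVmx// trmx1 mul1mx mulmxKV.
    (* This C varies with t; the reverse Fatou argument accepts a separate constant at each
       point. *)
    have [C hC] := riem_dist_variation (@top2_inj _ _ mn) uM ZE U1 x0 AE.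
    have h2 := sub _ _ _ U1 x0 AE.
    exists C => k; rewrite /h.
    have e1 : 0 < (k.+1%:R^-1 : R) <= 1 by rewrite e0 invf_le1 ?ltr0n// ler1n.
    have := hC _ (Ze k) e1 (erefl _); move: h2.
    have : (k.+1%:R : R) * k.+1%:R^-1 = 1 by rewrite mulfV.
    move/andP: e1 => [e1 e2].
    move: (\sum_j _) (ln_symp mn (F t)) (ln_symp mn Z) (riem_dist (Ze k) _) (riem_dist Z _) e1 e2.
    move: (k.+1%:R : R) (k.+1%:R^-1) (ler0n R k.+1) => p e p0 S a b u v e1 e2 pe h1 h2.
    have : p * (u ^+ 2 - v ^+ 2) <= p * (4 * e * S + C * e ^+ 2) by apply: ler_wpM2l; lra.
    move/le_trans; apply.
    have -> : p * (4 * e * S + C * e ^+ 2) = (p * e) * (4 * S + C * e) by ring.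
    by rewrite pe mul1r; lra.
  - move=> k; rewrite RintegralZl//; last exact: dist_sq_diff_intg.
    by rewrite mulr_ge0.
rewrite RintegralZl//; last by apply: intgB => //; exact: intg_cst.
rewrite RintegralB ?E_cst//; last exact: intg_cst.
by rewrite pmulr_rge0// subr_ge0.
Qed.

(** The point is exp(s) Z: all eigenvalues of A relative to it are multiplied by exp(-s), so their
    logarithms shift by -s and the sum of squares expands exactly. *)
Lemma scaled_pd N (Z : pdmx R N) (s : R) : exists Zs : pdmx R N, forall A,
  riem_dist Zs A ^+ 2 = riem_dist Z A ^+ 2 -
     2 * s * (ln (\det (mx_of_pd A)) - ln (\det (mx_of_pd Z))) + N%:R * s ^+ 2.
Proof.
have [L uL ZL] := posdef_factor (pdP Z).
have trZ (c : R) (X : 'M[R]_N) : (c *: X)^T = c *: X^T by apply/matrixP => i j; rewrite !mxE.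
have uc : expR (s / 2) \is a GRing.unit by rewrite unitfE gt_eqF ?expR_gt0.
have uL' : expR (s / 2) *: L \in unitmx by rewrite unitmxZ.
exists (pd_of (posdef_gram uL')) => A.
have [M [x [uM ZE AE x0 _]]] := pd_rep Z A.
have uM' : expR (s / 2) *: M \in unitmx by rewrite unitmxZ.
have ZsE : mx_of_pd (pd_of (posdef_gram uL')) = (expR (s / 2) *: M)^T *m (expR (s / 2) *: M).
  by rewrite pd_ofK !trZ -!(scalemxAl, scalemxAr) -ZE -ZL.
have AsE : mx_of_pd A = (expR (s / 2) *: M)^T *m diag_mx (map_mx (fun y => expR (- s) * y) x) *m (expR (s / 2) *: M).
  have -> : diag_mx (map_mx (fun y => expR (- s) * y) x) = expR (- s) *: diag_mx x.
    by apply/matrixP => i j; rewrite !mxE mulrnAr.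
  rewrite trZ -!(scalemxAl, scalemxAr) !scalerA -AE -!expRD.
  have -> : s / 2 + (s / 2 - s) = 0 by field.
  by rewrite expR0 scale1r.
rewrite (riem_dist_sq uM' ZsE AsE) (riem_dist_sq uM ZE AE) -(sum_ln_det x0 ZE AE).
rewrite mulr_sumr -sumrB; have -> : N%:R * s ^+ 2 = \sum_(i < N) s ^+ 2.
  by rewrite sumr_const card_ord mulr_natl.
rewrite -big_split; apply: eq_bigr => i _ /=.
rewrite mxE lnM ?posrE ?expR_gt0// expRK; ring.
Qed.

(** Minimality under the scalings of Z gives 0 <= N s^2 - 2 s E g for every real s of either sign,
    which forces E g = 0. *)
Lemma mean_ln_det N (F : T -> pdmx R N) (Z : pdmx R N) :
  measurable_fun setT (F : T -> borel (pdmx R N)) ->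
  (exists z, intg (fun t => riem_dist z (F t))) ->
  is_mean mu F Z ->
  ln (\det (mx_of_pd Z)) = E (fun t => ln (\det (mx_of_pd (F t)))).
Proof.
move=> mF iF hZ.
pose g t := ln (\det (mx_of_pd (F t))) - ln (\det (mx_of_pd Z)).
(* The scaling s = 1 expresses g through a difference of squared distances, already known to be
   integrable. *)
have ig : intg g.
  have [Z1 h1] := scaled_pd Z 1.
  have -> : g = (fun t => 2^-1 * (N%:R - (riem_dist Z1 (F t) ^+ 2 - riem_dist Z (F t) ^+ 2))).
    by apply/funext => t; rewrite h1 /g; field.
  by apply: intgZ; apply: intgB; [exact: intg_cst|exact: dist_sq_diff_intg].
have Eg s : 0 <= N%:R * s ^+ 2 - 2 * s * E g.
  have [Zs hs] := scaled_pd Z s; have := hZ Zs.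
  under eq_Rintegral do rewrite hs.
  have -> : N%:R * s ^+ 2 - 2 * s * E g = E (fun t => N%:R * s ^+ 2 - 2 * s * g t).
    rewrite [RHS]RintegralB; [|exact: measurableT|exact: intg_cst|exact: intgZ].
    by rewrite E_cst RintegralZl.
  by congr (_ <= _); apply: eq_Rintegral => t _; rewrite /g; ring.
have E0 : E g = 0.
  (* With this s the quadratic equals - (N + 2) s^2; the denominator N + 1 is nonzero also for N =
     0. *)
  have := Eg (E g / (N%:R + 1)); move: (N%:R : R) (ler0n R N) => p p0.
  have -> : E g = E g / (p + 1) * (p + 1) by rewrite mulfVK// gt_eqF// ltr_wpDl.
  rewrite mulfK ?gt_eqF ?ltr_wpDl//; move: (E g / (p + 1)) => q h.
  have q2 : q ^+ 2 <= 0 by have : 0 <= (p + 1) * - q ^+ 2; [nra|rewrite pmulr_rge0 ?ltr_wpDl//; lra].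
  have /eqP : q ^+ 2 = 0 by apply: le_anti; rewrite q2 sqr_ge0.
  by rewrite sqrf_eq0 => /eqP ->; rewrite mul0r.
have -> : (fun t => ln (\det (mx_of_pd (F t)))) = (fun t => g t + ln (\det (mx_of_pd Z))).
  by apply/funext => t; rewrite /g subrK.
by rewrite RintegralD ?E_cst ?E0 ?add0r//; exact: intg_cst.
Qed.

End MeanInequality.

(** * The barycenter of positive vectors *)

Section LogBarycenter.
Context d (T : measurableType d) (R : realType) (mu : probability T R).
Local Notation intg f := (mu.-integrable setT (EFin \o f)).
Local Notation E f := (Rintegral mu setT f).

Lemma intg_sum (I : Type) (s : seq I) (f : I -> T -> R) : (forall i, intg (f i)) ->
  intg (fun t => \sum_(i <- s) f i t).
Proof.
move=> hf; elim: s => [|i s IH].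
  by under eq_fun do rewrite big_nil; exact: intg_cst.
by under eq_fun do rewrite big_cons; exact: intgD.
Qed.

Lemma E_sum (I : Type) (s : seq I) (f : I -> T -> R) : (forall i, intg (f i)) ->
  E (fun t => \sum_(i <- s) f i t) = \sum_(i <- s) E (f i).
Proof.
move=> hf; elim: s => [|i s IH].
  by rewrite big_nil; under eq_Rintegral do rewrite big_nil; exact: E_cst.
rewrite big_cons -IH -RintegralD//; last exact: intg_sum.
by apply: eq_Rintegral => t _; rewrite big_cons.
Qed.

Lemma ln_coord_continuous N i : continuous (fun a : posrow R N => ln (row_of_pos a 0 i)).
Proof.
move=> a; apply: (@continuous_comp _ _ _ (fun a : posrow R N => row_of_pos a 0 i) (@ln R)).
  exact: posrow_coord_continuous.
apply: continuous_ln; exact: (posP a).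
Qed.

Lemma log_dist_sq N (a b : posrow R N) : log_dist a b ^+ 2 =
  \sum_i (ln (row_of_pos a 0 i) - ln (row_of_pos b 0 i)) ^+ 2.
Proof. by rewrite sqr_sqrtr// sumr_ge0// => i _; exact: sqr_ge0. Qed.

Lemma log_dist_sq_diff N (a b c : posrow R N) : log_dist a c ^+ 2 - log_dist b c ^+ 2 =
  \sum_i ((ln (row_of_pos a 0 i) - ln (row_of_pos b 0 i)) *
    (ln (row_of_pos a 0 i) + ln (row_of_pos b 0 i) - 2 * ln (row_of_pos c 0 i))).
Proof. by rewrite !log_dist_sq -sumrB; apply: eq_bigr => i _; ring. Qed.

(** In logarithmic coordinates the distance is Euclidean, so a difference of squared distances is
    affine in the integrated vector. The functional to minimize is thus explicit in the means e i,
    with completed square at ln z_i = e i. *)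
Lemma log_barycenter N (F : T -> posrow R N) : measurable_fun setT (F : T -> borel (posrow R N)) ->
  (forall i, intg (fun t => ln (row_of_pos (F t) 0 i))) ->
  forall i, ln (row_of_pos
    (cartan_barycenter (@log_dist R N) (pushforward mu (F : T -> borel (posrow R N)))) 0 i) =
  E (fun t => ln (row_of_pos (F t) 0 i)).
Proof.
move=> mF iF; pose e i := E (fun t => ln (row_of_pos (F t) 0 i)).
have ih (a b : R) i : intg (fun t => (a - b) * (a + b - 2 * ln (row_of_pos (F t) 0 i))).
  by apply: intgZ; apply: intgB; [exact: intg_cst|exact: intgZ].
have ip (w z : posrow R N) : (\int[pushforward mu (F : T -> borel (posrow R N))]_a
    (log_dist w a ^+ 2 - log_dist z a ^+ 2)%:E =
    (\sum_i ((ln (row_of_pos w 0 i) - ln (row_of_pos z 0 i)) *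
    (ln (row_of_pos w 0 i) + ln (row_of_pos z 0 i) - 2 * e i)))%:E)%E.
  have im : intg (fun t => log_dist w (F t) ^+ 2 - log_dist z (F t) ^+ 2).
    by under eq_fun do rewrite log_dist_sq_diff; apply: intg_sum => i; exact: ih.
  rewrite integral_pushforward//.
  - rewrite preimage_setT /comp intgE//; congr (_%:E).
    under eq_Rintegral do rewrite log_dist_sq_diff.
    rewrite E_sum; last by move=> i; exact: ih.
    apply: eq_bigr => i _; rewrite RintegralZl//; last first.
      by apply: intgB; [exact: intg_cst|exact: intgZ].
    rewrite RintegralB ?E_cst ?RintegralZl//; [exact: intg_cst|exact: intgZ].
  - apply/measurable_EFinP; apply: continuous_borel_real.
    under eq_fun do rewrite log_dist_sq_diff.
    apply: continuous_sum => i a.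
    move: (ln (row_of_pos w 0 i)) (ln (row_of_pos z 0 i)) => u v.
    apply: (@continuousM R _ (fun=> u - v) (fun b : posrow R N => u + v - 2 * ln (row_of_pos b 0 i)) a).
      exact: cst_continuous.
    apply: (@continuousB R R^o _ (fun=> u + v) (fun b : posrow R N => 2 * ln (row_of_pos b 0 i)) a).
      exact: cst_continuous.
    apply: (@continuousM R _ (fun=> 2) (fun b : posrow R N => ln (row_of_pos b 0 i)) a).
      exact: cst_continuous.
    exact: ln_coord_continuous.
have c0 : posrow_set (\row_i expR (e i) : 'rV[R]_N) by move=> i; rewrite mxE expR_gt0.
pose c : posrow R N := exist (fun a => a \in @posrow_set R N) _ (mem_set c0).
have cE i : ln (row_of_pos c 0 i) = e i.
  by rewrite /row_of_pos /c /= mxE expRK.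
rewrite /cartan_barycenter; set G := get _.
have : [set z : posrow R N | forall y w : posrow R N,
    (\int[pushforward mu (F : T -> borel (posrow R N))]_a (log_dist z a ^+ 2 - log_dist y a ^+ 2)%:E <=
     \int[pushforward mu (F : T -> borel (posrow R N))]_a (log_dist w a ^+ 2 - log_dist y a ^+ 2)%:E)%E] G.
  apply: (@getPex (posrow R N) _); exists c => y w; rewrite !ip lee_fin.
  apply: ler_sum => i _; rewrite cE; move: (ln _) (ln _) (e i) => u v x.
  by have := sqr_ge0 (u - x); nra.
(* Tested against the explicit candidate c, minimality of G bounds a sum of squares by 0. *)
move=> /(_ c c); rewrite !ip lee_fin [leRHS]big1; last by move=> i _; rewrite subrr mul0r.
have -> : \sum_i (ln (row_of_pos G 0 i) - ln (row_of_pos c 0 i)) *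
    (ln (row_of_pos G 0 i) + ln (row_of_pos c 0 i) - 2 * e i) =
    \sum_i (ln (row_of_pos G 0 i) - e i) ^+ 2.
  by apply: eq_bigr => i _; rewrite cE; ring.
move=> h i; apply/eqP; rewrite -subr_eq0 -sqrf_eq0 -/(e i); apply/eqP.
have sq0 j : true -> 0 <= (ln (row_of_pos G 0 j) - e j) ^+ 2 by rewrite sqr_ge0.
apply: (psumr_eq0P sq0) => //; apply: le_anti; rewrite h sumr_ge0 // => j _; exact: sqr_ge0.
Qed.

End LogBarycenter.

(** * Partial products of doubled decreasing vectors *)

Section Decreasing.
Variable R : realType.

(** Each increment of s occurs twice in a row, so the entries at even and at odd positions telescope
    separately, to s at [uphalf k] and at [k./2]; the vector is already sorted. *)
Lemma decr_prod_expR N (a : 'rV[R]_N) (s : nat -> R) (k : nat) : s 0%N = 0 ->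
  (forall i : 'I_N, a 0 i = expR (s (i./2).+1 - s i./2)) ->
  (forall i j : 'I_N, (i <= j)%N -> a 0 j <= a 0 i) -> (k <= N)%N ->
  decr_prod a k = expR (s k./2 + s (uphalf k)).
Proof.
move=> s0 aE ad kN; pose f i := expR (s (i./2).+1 - s i./2).
have mE : [seq a 0 i | i <- enum 'I_N] = map f (iota 0 N).
  by rewrite -val_enum_ord -map_comp; apply: eq_map => i /=; exact: aE.
rewrite /decr_prod mE sorted_sort; last 2 first.
- by move=> x y z /= h1 h2; exact: le_trans h2 h1.
- apply/(sortedP 0) => i; rewrite size_map size_iota => iN.
  rewrite !(nth_map 0%N) ?size_iota ?nth_iota// ?(ltnW iN)// !add0n.
  by have := ad (Ordinal (ltnW iN)) (Ordinal iN) (leqnSn i); rewrite !aE.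
rewrite -map_take take_iota (minn_idPl kN) big_map /f -expR_sum; congr expR.
elim: k {kN} => [|k IH]; first by rewrite big_nil s0 addr0.
rewrite -addn1 iotaD big_cat IH /= big_seq1 add0n addn1 /= uphalfE.
ring.
Qed.

End Decreasing.

(** * Moments of the powers, and [dhat] in terms of ln s_m *)

Section SymplecticMean.
Variable R : realType.

Lemma riem_dist_pow N (r : R) (A I : pdmx R N) : mx_of_pd I = 1%:M -> 0 <= r ->
  riem_dist I (pd_pow r A) = r * riem_dist I A.
Proof.
move=> I1 r0; have [U [d [U1 AE d0]]] := posdef_spectral (pdP A).
have uU := (mulmx1_unit U1).2.
have IE : mx_of_pd I = U^T *m U by rewrite I1 U1.
apply/eqP; rewrite -(@eqrXn2 _ 2) ?mulr_ge0 ?riem_dist_ge0//.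
rewrite exprMn (riem_dist_sq uU IE AE) (riem_dist_sq uU IE (pd_pow_spectral r U1 AE)) mulr_sumr.
by apply/eqP; apply: eq_bigr => i _; rewrite mxE ln_powR exprMn.
Qed.

Lemma finite_moment_intg N (mu : probability (borel (pdmx R N)) R) :
  finite_first_moment (@riem_dist R N) mu ->
  exists z, mu.-integrable setT (EFin \o (fun A : borel (pdmx R N) => riem_dist z A)).
Proof.
case=> z hz; exists z; apply/integrableP; split.
  by apply/measurable_EFinP; apply: continuous_borel_real; exact: riem_dist_continuous.
apply: le_lt_trans hz; rewrite le_eqVlt; apply/orP; left; apply/eqP.
by apply: eq_integral => A _ /=; rewrite ger0_norm ?riem_dist_ge0// riem_dist_sym.
Qed.

Lemma ln_symp_congr n m m' (e : m = m') (mn : (m <= n)%N) (mn' : (m' <= n)%N) (A : pdmx R (n + n)) :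
  ln_symp mn A = ln_symp mn' A.
Proof. by case: _ / e mn' => mn'; rewrite (bool_irrelevance mn mn'). Qed.

(* Capping the index at [n] makes it total in [m]. *)
Definition lns n (m : nat) (A : pdmx R (n + n)) : R := ln_symp (geq_minr m n) A.

Lemma lnsE n m (mn : (m <= n)%N) (A : pdmx R (n + n)) : lns m A = ln_symp mn A.
Proof. by apply: ln_symp_congr; exact/minn_idPl. Qed.

Lemma ln_dhat n (A : pdmx R (n + n)) (i : 'I_(n + n)) :
  ln (row_of_pos (dhat A) 0 i) = lns i./2.+1 A - lns i./2 A.
Proof.
have hn : (i./2 < n)%N by exact: (ltn_ord (half_ord i)).
rewrite dhatE mxE.
have -> : rev_ord (half_ord i) = top_idx hn ord_max by exact/val_inj.
by rewrite symp_eig_top expRK (lnsE hn) (lnsE (ltnW hn)).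
Qed.

Lemma dhat_decr n (A : pdmx R (n + n)) (i j : 'I_(n + n)) : (i <= j)%N ->
  row_of_pos (dhat A) 0 j <= row_of_pos (dhat A) 0 i.
Proof.
move=> ij; rewrite dhatE !mxE; have [_ + _] := symp_eigP A; apply.
by rewrite /= leq_sub2l// ltnS half_leq.
Qed.

Lemma lns0 n (A : pdmx R (n + n)) : lns 0 A = 0.
Proof.
by rewrite (lnsE (leq0n n)) /ln_symp /symp_prod big_ord0 ln1.
Qed.

End SymplecticMean.

Theorem theorem4p3 (R : realType) (n : nat)
    (mu : probability (borel (pdmx R (n + n))) R)
    (mu1 : finite_first_moment (@riem_dist R (n + n)) mu)
    (r : R) (r0 : 0 < r) (r1 : r <= 1) :
  log_major
    (map_mx (fun x : R => x `^ (1 / r))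
       (row_of_pos (dhat (cartan_barycenter (@riem_dist R (n + n))
                            (push_pow r mu)))))
    (row_of_pos (cartan_barycenter (@log_dist R (n + n)) (push_dhat mu))).
Proof.
have r01 : 0 < r <= 1 by rewrite r0.
have mid : measurable_fun setT (fun A : borel (pdmx R (n + n)) => A : borel (pdmx R (n + n))).
  exact: measurable_id.
have i1 := finite_moment_intg mu1.
pose F := @pd_pow R (n + n) r : borel (pdmx R (n + n)) -> pdmx R (n + n).
have mF : measurable_fun setT (F : borel (pdmx R (n + n)) -> borel (pdmx R (n + n))).
  exact: continuous_borel (pd_pow_continuous r01).
have iF : exists z, mu.-integrable setT (EFin \o (fun A => riem_dist z (F A))).
  (* Seen from the identity, the distance to A^r is r times the distance to A, so mu^r inherits the
     first moment. *)
  exists (pd_of (posdef1 R (n + n))).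
  under eq_fun do rewrite /F riem_dist_pow ?(ltW r0)//.
  by apply: intgZ; exact: (dist_intg mid i1).
have hZ := barycenter_is_mean mF iF.
rewrite -[pushforward _ _]/(push_pow r mu) in hZ.
set Z := cartan_barycenter _ (push_pow r mu) in hZ *.
pose l m := Rintegral mu setT (@lns R n m).
have il m : mu.-integrable setT (EFin \o (@lns R n m)).
  exact: (ln_symp_intg (geq_minr m n) mid i1).
have hl m : lns m Z <= r * l m.
  apply: le_trans (mean_ln_symp_le (geq_minr m n) mF iF hZ) _.
  rewrite /l -(RintegralZl r measurableT (il m)).
  apply: E_le; [exact: ln_symp_intg|exact: intgZ|].
  by move=> A; exact: ln_symp_pow.
have hln : lns n Z = r * l n.
  have lE (A : pdmx R (n + n)) : lns n A = 2^-1 * ln (\det (mx_of_pd A)).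
    by rewrite (lnsE (leqnn n)) -ln_symp_det mulKf.
  rewrite lE (mean_ln_det mF iF hZ) /l.
  have -> : (fun A : borel (pdmx R (n + n)) => ln (\det (mx_of_pd (F A)))) =
     (fun A => (2 * r) * lns n A).
    by apply/funext => A; rewrite ln_det_pow lE; field.
  by rewrite (RintegralZl (2 * r) measurableT (il n)); field.
have hW i : ln (row_of_pos (cartan_barycenter (@log_dist R (n + n)) (push_dhat mu)) 0 i) =
    l i./2.+1 - l i./2.
  rewrite /push_dhat log_barycenter.
  - by under eq_Rintegral do rewrite ln_dhat; rewrite RintegralB.
  - exact: continuous_borel (@dhat_continuous R n).
  - by move=> j; under eq_fun do rewrite ln_dhat; exact: intgB.
set W := cartan_barycenter _ (push_dhat mu) in hW *.
pose s1 m := r^-1 * lns m Z.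
set a := map_mx _ _.
have aE (i : 'I_(n + n)) : a 0 i = expR (s1 i./2.+1 - s1 i./2).
  rewrite mxE /powR gt_eqF; last exact: (posP (dhat Z)).
  by rewrite ln_dhat mul1r mulrBr.
have ad (i j : 'I_(n + n)) : (i <= j)%N -> a 0 j <= a 0 i.
  move=> ij; rewrite !mxE; apply: ge0_ler_powR; rewrite ?nnegrE ?(ltW (posP _ _))//.
    by rewrite mul1r invr_ge0 ltW.
  exact: dhat_decr.
have WE (i : 'I_(n + n)) : row_of_pos W 0 i = expR (l i./2.+1 - l i./2).
  by rewrite -hW lnK// posrE; exact: (posP W).
(* The entries of [dhat] are ordered pointwise, and the order passes to the means of their
   logarithms. *)
have Wd (i j : 'I_(n + n)) : (i <= j)%N -> row_of_pos W 0 j <= row_of_pos W 0 i.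
  move=> ij; rewrite !WE ler_expR.
  rewrite /l -(RintegralB measurableT (il j./2.+1) (il j./2)).
  rewrite -(RintegralB measurableT (il i./2.+1) (il i./2)).
  apply: E_le; [exact: intgB|exact: intgB|].
  move=> A; rewrite -!ln_dhat ler_ln ?posrE; [exact: dhat_decr|exact: (posP (dhat A))..].
have s10 : s1 0%N = 0 by rewrite /s1 lns0 mulr0.
have l0 : l 0%N = 0 
  by rewrite /l (_ : @lns R n 0 = fun=> 0) ?E_cst//; apply/funext => A; exact: lns0.
have s1l m : s1 m <= l m by rewrite /s1 ler_pdivrMl.
(* Both vectors have the doubled form, so every partial product reduces to [s1l] at the two halves
   of k. *)
split=> [k /andP[_ kN]|].
  by rewrite (decr_prod_expR s10 aE ad kN) (decr_prod_expR l0 WE Wd kN) ler_expR lerD.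
(* At k = 2n both halves are n, where the determinant identity [hln] turns the inequality into an
   equality. *)
rewrite (decr_prod_expR s10 aE ad (leqnn _)) (decr_prod_expR l0 WE Wd (leqnn _)).
have s1n : s1 n = l n by rewrite /s1 hln mulKf// gt_eqF.
by rewrite addnn doubleK uphalf_double s1n.
Qed.
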